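(* Let $T>0$ and $n,m,d\ge1$. There is an integer $k\ge1$ such that the following holds. Let $b:[0,T]\times\mathbb{R}^n\to\mathbb{R}^n$, $\sigma:[0,T]\times\mathbb{R}^n\to\mathbb{R}^{n\times d}$ and $g:\Delta[0,T]\times\mathbb{R}^n\times\mathbb{R}^n\times\mathbb{R}^m\times\mathbb{R}^{m\times d}\times\mathbb{R}^{m\times d}\to\mathbb{R}^m$ be bounded and $k$ times continuously differentiable in all variables with bounded derivatives up to order $k$, and suppose there is $\bar\sigma>0$ such that $|\sigma(s,x)^\top\xi|^2\ge\bar\sigma|\xi|^2$ for all $(s,x,\xi)\in[0,T]\times\mathbb{R}^n\times\mathbb{R}^n$. Then the system $$\begin{cases}\Gamma_s(t,s,x)+\frac12\sigma(s,x)^\top\Gamma_{xx}(t,s,x)\sigma(s,x)+\Gamma_x(t,s,x)b(s,x)=0,\quad(s,x)\in[0,t]\times\mathbb{R}^n,\\ \Theta_s(t,s,\xi,x)+\frac12\sigma(s,x)^\top\Theta_{xx}(t,s,\xi,x)\sigma(s,x)+\Theta_x(t,s,\xi,x)b(s,x)\\ \quad+g\big(t,s,\xi,x,\Theta(s,s,x,x),\Theta_x(t,s,\xi,x)\sigma(s,x),\Gamma_\xi(s,t,\xi)\sigma(s,x)\big)=0,\quad(s,x)\in[t,T]\times\mathbb{R}^n,\\ \Gamma(t,t,x)=\Theta(t,t,x,x),\quad x\in\mathbb{R}^n,\\ \Theta(t,T,\xi,x)=0,\quad x\in\mathbb{R}^n,\end{cases}$$ (parameterized by $(t,\xi)$)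 admits a unique mild solution $(\Gamma,\Theta)$.
   Context: $\Delta[0,T]=\{(t,s)\in[0,T]^2:0\le t\le s\le T\}$. $\Gamma$ and $\Theta$ are $\mathbb{R}^m$-valued; $\Theta$ is defined on $\Delta[0,T]\times\mathbb{R}^n\times\mathbb{R}^n$ and $\Gamma$ on $\{0\le s\le t\le T\}\times\mathbb{R}^n$. For $\Theta=(\Theta^1,\dots,\Theta^m)^\top$ and $\sigma=(\sigma_1,\dots,\sigma_d)$ (columns), $\sigma^\top\Theta_{xx}\sigma\in\mathbb{R}^m$ has $i$-th component $\sum_{k=1}^d\sigma_k^\top\Theta^i_{xx}\sigma_k$; similarly for $\Gamma$. $\Theta_x$ is the Jacobian in the last variable, and $\Gamma_\xi(s,t,\xi)$ is the Jacobian of $\Gamma(s,t,\cdot)$ at $\xi$. $G(s,x;\tau,\eta)$, $0\le s<\tau\le T$, $x,\eta\in\mathbb{R}^n$, denotes the fundamental solution of the (backward) parabolic operator $v\mapsto v_s+\sum_{i,j}a_{ij}(s,x)v_{x_ix_j}+\sum_ib_i(s,x)v_{x_i}$, with $(a_{ij})=\frac12\sigma\sigma^\top$: the solution of the Cauchy problem $v_s+\sum a_{ij}v_{x_ix_j}+\sum b_iv_{x_i}+f=0$, $v(T,\cdot)=h$ is $v(s,x)=\int_{\mathbb{R}^n}G(s,x;T,\eta)h(\eta)d\eta+\int_s^T\int_{\mathbb{R}^n}G(s,x;\tau,\eta)f(\tau,\eta)d\eta\,d\tau$. $G_\xi(t,\xi;\tau,\bar\eta)$ is its gradient (as a row vector)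 in the second argument. Mild solution: a pair $(\Gamma,\Theta)$ such that $\Theta$ is measurable, differentiable in $x$, and satisfies the nonlinear integral equation $$\Theta(t,s,\xi,x)=\int_s^T\!\!\int_{\mathbb{R}^n}G(s,x;\tau,\eta)\,g\Big(t,\tau,\xi,\eta,\Theta(\tau,\tau,\eta,\eta),\Theta_\eta(t,\tau,\xi,\eta)\sigma(\tau,\eta),\Big[\int_{\mathbb{R}^n}\Theta(\tau,\tau,\bar\eta,\bar\eta)\,G_\xi(t,\xi;\tau,\bar\eta)\,d\bar\eta\Big]\sigma(\tau,\eta)\Big)d\eta\,d\tau$$ for all $(t,s,\xi,x)\in\Delta[0,T]\times\mathbb{R}^n\times\mathbb{R}^n$ (with $\Theta_\eta(t,\tau,\xi,\eta)$ the Jacobian in the last variable), and $\Gamma$ is given by $$\Gamma(t,s,x)=\int_{\mathbb{R}^n}G(s,x;t,\eta)\,\Theta(t,t,\eta,\eta)\,d\eta,\qquad 0\le s\le t\le T,\ x\in\mathbb{R}^n,$$ understood as $\Gamma(t,t,x)=\Theta(t,t,x,x)$ when $s=t$. *)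

(* Defs.v *)
From HB Require Import structures.
From mathcomp Require Import all_boot all_order all_algebra.
From mathcomp Require Import all_classical all_reals all_analysis.

Set Implicit Arguments.
Unset Strict Implicit.
Unset Printing Implicit Defensive.
Import Order.TTheory GRing.Theory Num.Theory.
Import numFieldNormedType.Exports.

Local Open Scope classical_set_scope.
Local Open Scope ring_scope.

(* Points of R^n are columns ['cV[R]_n], which carry the norm and the
   derivatives. Measurability and integration over R^n go through the product
   sigma-algebra of [n.-tuple R] (the Borel sets of R^n) and [tcol]. *)
Notation Rtuple R n := (n.-tuple (measurableTypeR R)) (only parsing).

Definition tcol (R : realType) (n : nat) (y : Rtuple R n) : 'cV[R]_n :=
  \col_i tnth y i.

Section lebesgue_tuple.
Context (R : realType) (n : nat).
Variable mu : {sigma_finite_measure set (Rtuple R n) -> \bar R}.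

Definition tcons (p : measurableTypeR R * Rtuple R n) : Rtuple R n.+1 :=
  [the n.+1.-tuple _ of p.1 :: p.2].

Lemma measurable_tcons : measurable_fun [set: measurableTypeR R * Rtuple R n] tcons.
Proof. by apply: measurable_cons; [exact: measurable_fst|exact: measurable_snd]. Qed.

Definition lebesgueS : set (Rtuple R n.+1) -> \bar R :=
  pushforward (@lebesgue_measure R \x mu)%E tcons.

Let lebesgueS0 : lebesgueS set0 = 0%E.
Proof. by rewrite /lebesgueS /pushforward preimage_set0 measure0. Qed.

Let lebesgueS_ge0 A : (0 <= lebesgueS A)%E.
Proof. by rewrite /lebesgueS /pushforward measure_ge0. Qed.

Let lebesgueS_sigma_additive : semi_sigma_additive lebesgueS.
Proof.
move=> F mF tF mUF; rewrite /lebesgueS /pushforward preimage_bigcup.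
apply: measure_semi_sigma_additive.
- by move=> i; rewrite -[X in measurable X]setTI; exact: measurable_tcons.
- apply/trivIsetP => /= i j _ _ ij; rewrite -preimage_setI.
  by move/trivIsetP : tF => /(_ _ _ _ _ ij) ->//; rewrite preimage_set0.
- by rewrite -preimage_bigcup -[X in measurable X]setTI; exact: measurable_tcons.
Qed.

HB.instance Definition _ := isMeasure.Build _ _ _ lebesgueS
  lebesgueS0 lebesgueS_ge0 lebesgueS_sigma_additive.

Lemma lebesgueS_sigma_finite : sigma_finite [set: Rtuple R n.+1] lebesgueS.
Proof.
have /sigma_finiteP[F [TF ndF Foo]] := sigma_finiteT (@lebesgue_measure R).
have /sigma_finiteP[G [TG ndG Goo]] := sigma_finiteT mu.
pose dec (y : Rtuple R n.+1) : measurableTypeR R * Rtuple R n :=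
  (thead y, [tuple of behead y]).
have decK : cancel tcons dec.
  by move=> [a t]; rewrite /dec /tcons/= theadE; congr pair; apply: val_inj.
have mdec : measurable_fun [set: Rtuple R n.+1] dec.
  by apply/measurable_fun_pairP; split;
    [exact: measurable_tnth|exact: measurable_behead].
exists (fun i => dec @^-1` (F i `*` G i)).
  apply/seteqP; split => // y _.
  have [i _ Fi] : (\bigcup_i F i) (thead y) by rewrite -TF.
  have [j _ Gj] : (\bigcup_i G i) [tuple of behead y] by rewrite -TG.
  exists (maxn i j) => //; split => /=.
    by move: Fi; exact/subsetPset/ndF/leq_maxl.
  by move: Gj; exact/subsetPset/ndG/leq_maxr.
move=> i; have [mF Fioo] := Foo i; have [mG Gioo] := Goo i; split.
  by rewrite -[X in measurable X]setTI; apply: mdec => //; exact: measurableX.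
rewrite /lebesgueS /pushforward (_ : tcons @^-1` _ = F i `*` G i).
  by rewrite product_measure1E// lte_mul_pinfty// ge0_fin_numE.
by apply/funext => p; rewrite /preimage /mkset decK.
Qed.

HB.instance Definition _ :=
  Measure_isSigmaFinite.Build _ _ _ lebesgueS lebesgueS_sigma_finite.

End lebesgue_tuple.

Fixpoint lebesgueN (R : realType) (n : nat) :
    {sigma_finite_measure set (Rtuple R n) -> \bar R} :=
  if n is n'.+1 then lebesgueS (lebesgueN R n')
  else \d_([tuple] : Rtuple R 0).

Section smoothness.
Context (R : realType).

(* [f] is k times continuously differentiable on [D], bounded together with its
   derivatives up to order k. Derivatives are Frechet derivatives relative to
   [D], so boundary points of [D] are allowed; [D] is meant to be a convex set
   with nonempty interior, where such derivatives are unique. The directional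
   derivatives [df ^~ v], over all directions [v], stand for the partial ones. *)
Fixpoint Cb (k : nat) (V W : normedModType R) (D : set V) (f : V -> W) : Prop :=
  [/\ {within D, continuous f},
      exists M : R, forall x, D x -> `|f x| <= M &
      if k is k'.+1 then
        exists df : V -> {linear V -> W},
          (forall x, D x -> forall e : R, 0 < e ->
             \forall y \near within D (nbhs x),
               `|f y - f x - df x (y - x)| <= e * `|y - x|) /\
          (forall v : V, Cb k' D (fun x => df x v))
      else True].

Definition sqnorm (n : nat) (v : 'cV[R]_n) : R := \sum_i v i 0 ^+ 2.

Definition unitv (n : nat) (i : 'I_n) : 'cV[R]_n := delta_mx i 0.

Definition jac (n m : nat) (f : 'cV[R]_n -> 'cV[R]_m) (x : 'cV[R]_n)
    : 'M[R]_(m, n) :=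
  \matrix_(i, j) ('D_(unitv j) f x) i 0.

Definition grad (n : nat) (f : 'cV[R]_n -> R) (x : 'cV[R]_n) : 'rV[R]_n :=
  \row_j 'D_(unitv j) f x.

End smoothness.

Section parabolic.
Context (R : realType) (n d : nat).
Variables (b : R -> 'cV[R]_n -> 'cV[R]_n) (sigma : R -> 'cV[R]_n -> 'M[R]_(n, d)).

Definition strip (tau : R) : set (R * 'cV[R]_n) := [set p | 0 <= p.1 < tau].
Definition open_strip (tau : R) : set (R * 'cV[R]_n) := [set p | 0 < p.1 < tau].
Definition closed_strip (tau : R) : set (R * 'cV[R]_n) := [set p | 0 <= p.1 <= tau].

(* Class C^{1,2}: time derivative on ]0, tau[, space derivatives on [0, tau[. *)
Definition C12 (tau : R) (v : R -> 'cV[R]_n -> R) : Prop :=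
  [/\ {within strip tau, continuous (fun p => v p.1 p.2)},
      (forall (s : R) x, 0 < s < tau -> derivable (v ^~ x) s 1) /\
      {within open_strip tau, continuous (fun p => 'D_1 (v ^~ p.2) p.1)},
      forall i,
        (forall (s : R) x, 0 <= s < tau -> derivable (v s) x (unitv R i)) /\
        {within strip tau, continuous (fun p => 'D_(unitv R i) (v p.1) p.2)} &
      forall i j,
        (forall (s : R) x, 0 <= s < tau ->
           derivable ('D_(unitv R i) (v s)) x (unitv R j)) /\
        {within strip tau, continuous
           (fun p => 'D_(unitv R j) ('D_(unitv R i) (v p.1)) p.2)}].

Definition diffusion (s : R) (x : 'cV[R]_n) : 'M[R]_n :=
  2^-1 *: (sigma s x *m (sigma s x)^T).

Definition parabolic_op (v : R -> 'cV[R]_n -> R) (s : R) (x : 'cV[R]_n) : R :=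
  'D_1 (v ^~ x) s
  + \sum_i \sum_j diffusion s x i j * 'D_(unitv R j) ('D_(unitv R i) (v s)) x
  + \sum_i b s x i 0 * 'D_(unitv R i) (v s) x.

(* Bounded classical solutions of L v + f = 0 on [0, tau[ with v(tau, .) = h. *)
Definition cauchy_solution (tau : R) (f : R -> 'cV[R]_n -> R)
    (h : 'cV[R]_n -> R) (v : R -> 'cV[R]_n -> R) : Prop :=
  [/\ C12 tau v,
      {within closed_strip tau, continuous (fun p => v p.1 p.2)},
      exists M : R, forall (s : R) x, 0 <= s <= tau -> `|v s x| <= M,
      forall (s : R) x, 0 < s < tau -> parabolic_op v s x + f s x = 0 &
      forall x, v tau x = h x].

Definition source_data (tau : R) (f : R -> 'cV[R]_n -> R) : Prop :=
  [/\ {within closed_strip tau, continuous (fun p => f p.1 p.2)},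
      exists M : R, forall (s : R) x, 0 <= s <= tau -> `|f s x| <= M &
      exists alpha C : R, 0 < alpha <= 1 /\
        forall (s : R) x y, 0 <= s <= tau -> `|f s x - f s y| <= C * `|x - y| `^ alpha].

Definition terminal_data (h : 'cV[R]_n -> R) : Prop :=
  continuous h /\ exists M : R, forall x, `|h x| <= M.

Local Notation lambda := (lebesgueN R n).
Local Notation leb := (@lebesgue_measure R).

(* The unique such [G]: a solution of L G = 0 in its first two arguments that
   represents the solution of every Cauchy problem with regular bounded data
   (the double integral is iterated, [G] being integrable on ]s, tau] * R^n).
   G s x tau eta is relevant for 0 <= s < tau <= T only. *)
Definition fundamental_solution (T : R)
    (G : R -> 'cV[R]_n -> R -> 'cV[R]_n -> R) : Prop :=
  [/\ {within [set p : R * 'cV[R]_n * R * 'cV[R]_n |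
           0 <= p.1.1.1 < p.1.2 /\ p.1.2 <= T],
        continuous (fun p => G p.1.1.1 p.1.1.2 p.1.2 p.2)},
      forall (tau : R) eta, 0 < tau <= T ->
        C12 tau (fun s x => G s x tau eta) /\
        forall (s : R) x, 0 < s < tau -> parabolic_op (fun r y => G r y tau eta) s x = 0,
      forall (s : R) x (tau : R), 0 <= s < tau -> tau <= T ->
        lambda.-integrable setT (fun y => (G s x tau (tcol y))%:E),
      forall (s : R) x (tau : R), 0 <= s < tau -> tau <= T ->
        (leb \x lambda)%E.-integrable (`]s, tau] `*` setT)
          (fun p => (G s x p.1 (tcol p.2))%:E) &
      forall (tau : R) f h, 0 < tau <= T -> source_data tau f -> terminal_data h ->
        (exists v, cauchy_solution tau f h v) /\
        forall v, cauchy_solution tau f h v ->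
        forall (s : R) x, 0 <= s < tau ->
          v s x = \int[lambda]_y (G s x tau (tcol y) * h (tcol y))
                + \int[leb]_(r in `]s, tau])
                    \int[lambda]_y (G s x r (tcol y) * f r (tcol y))].

End parabolic.

Section mild.
Context (R : realType) (n m d : nat).
Variables (T : R) (sigma : R -> 'cV[R]_n -> 'M[R]_(n, d)).
Variable g : R -> R -> 'cV[R]_n -> 'cV[R]_n ->
  'cV[R]_m -> 'M[R]_(m, d) -> 'M[R]_(m, d) -> 'cV[R]_m.
Variable G : R -> 'cV[R]_n -> R -> 'cV[R]_n -> R.
Implicit Types (Gamma : R -> R -> 'cV[R]_n -> 'cV[R]_m)
  (Theta : R -> R -> 'cV[R]_n -> 'cV[R]_n -> 'cV[R]_m).

Local Notation lambda := (lebesgueN R n).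
Local Notation leb := (@lebesgue_measure R).

(* The integrand of the integral below, Theta(tau,tau,.,.) G_xi(t,xi;tau,.). *)
Definition Gamma_xi_integrand Theta (t tau : R) (xi eta : 'cV[R]_n)
    : 'M[R]_(m, n) :=
  Theta tau tau eta eta *m grad (fun z => G t z tau eta) xi.

Definition Gamma_xi Theta (t tau : R) (xi : 'cV[R]_n) : 'M[R]_(m, n) :=
  \matrix_(i, j) \int[lambda]_y Gamma_xi_integrand Theta t tau xi (tcol y) i j.

Definition Theta_integrand Theta (t s : R) (xi x : 'cV[R]_n) (tau : R)
    (eta : 'cV[R]_n) : 'cV[R]_m :=
  G s x tau eta *:
    g t tau xi eta (Theta tau tau eta eta)
      (jac (Theta t tau xi) eta *m sigma tau eta)
      (Gamma_xi Theta t tau xi *m sigma tau eta).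

(* A mild solution of the system is by definition a solution of its integral
   form; the drift enters through the fundamental solution [G] alone.
   [Rintegral] is total, so absolute convergence of every integral involved is
   part of the definition. The value tau = s, where G is undefined, is left out
   of the outer integral. *)
Definition mild_solution Gamma Theta : Prop :=
  [/\ forall i, measurable_fun
        [set p : measurableTypeR R * measurableTypeR R * Rtuple R n * Rtuple R n
           | 0 <= p.1.1.1 <= p.1.1.2 /\ p.1.1.2 <= T]
        (fun p => Theta p.1.1.1 p.1.1.2 (tcol p.1.2) (tcol p.2) i 0 : measurableTypeR R),
      forall (t s : R) xi x, 0 <= t <= s -> s <= T -> differentiable (Theta t s xi) x,
      forall (t tau : R) xi, 0 <= t < tau -> tau <= T -> forall i j,
        lambda.-integrable setT
          (fun y => (Gamma_xi_integrand Theta t tau xi (tcol y) i j)%:E),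
      forall (t s : R) xi x, 0 <= t <= s -> s <= T -> forall i,
        (leb \x lambda)%E.-integrable (`]s, T] `*` setT)
          (fun p => (Theta_integrand Theta t s xi x p.1 (tcol p.2) i 0)%:E) /\
        Theta t s xi x i 0 =
          \int[leb]_(tau in `]s, T])
            \int[lambda]_y Theta_integrand Theta t s xi x tau (tcol y) i 0 &
      (forall (t : R) x, 0 <= t <= T -> Gamma t t x = Theta t t x x) /\
      forall (t s : R) x, 0 <= s < t -> t <= T -> forall i,
        lambda.-integrable setT
          (fun y => (G s x t (tcol y) * Theta t t (tcol y) (tcol y) i 0)%:E) /\
        Gamma t s x i 0 =
          \int[lambda]_y (G s x t (tcol y) * Theta t t (tcol y) (tcol y) i 0)].

Definition eq_on_domains Gamma Theta Gamma' Theta' : Prop :=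
  (forall (t s : R) x, 0 <= s <= t -> t <= T -> Gamma t s x = Gamma' t s x) /\
  (forall (t s : R) xi x, 0 <= t <= s -> s <= T -> Theta t s xi x = Theta' t s xi x).

Definition unique_mild_solution : Prop :=
  exists Gamma Theta, mild_solution Gamma Theta /\
    forall Gamma' Theta', mild_solution Gamma' Theta' ->
      eq_on_domains Gamma Theta Gamma' Theta'.

End mild.

(* Main.v *)
(* A bounded solution v of the Cauchy problem with terminal time tau and data
   bounded by M satisfies |v(s,x) - v(s,y)| <= K M |x - y| / sqrt(tau - s): this is
   proved by doubling the variables and testing the maximum principle with a
   reflection coupling of the two noises. By duality the total mass of |G(s,x;tau,.)|
   is at most 1 and that of |G_x(s,x;tau,.)| at most K / sqrt(tau - s), and by
   Chapman-Kolmogorov the kernel maps bounded Borel functions to differentiable ones.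

   The integral equation is a fixed point equation for the pair (Theta, Theta_x).
   With the weights exp(-(T - s)/a^2) on Theta and exp(-(T - s)/a^2) sqrt(s - t) on
   Theta_x, the driver is Lipschitz up to a factor 1 / sqrt(tau - t), and one more
   kernel estimate costs the integrable factor 1 / sqrt(tau - s); since
   exp(-r/a^2) / sqrt(r) has integral O(a), the map is a contraction for small a.
   Every mild solution is bounded because g is, so the contraction also gives
   uniqueness. One bounded derivative of the coefficients suffices (k = 1). *)
From HB Require Import structures.
Require Import Defs.
From mathcomp Require Import all_boot all_order all_algebra.
From mathcomp Require Import all_classical all_reals all_analysis.
From mathcomp Require Import measurable_realfun.
From mathcomp Require Import ring lra.

Set Implicit Arguments.
Unset Strict Implicit.
Unset Printing Implicit Defensive.
Import Order.TTheory GRing.Theory Num.Theory.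
Import numFieldNormedType.Exports.

Local Open Scope classical_set_scope.
Local Open Scope ring_scope.

(** * Calculus in R^n *)

(** Neither positivity nor Gaussian bounds for [G] are part of its definition: it is known through
    the solutions that it represents, and these have continuous data. Every bound on [G] is
    therefore extracted from the Cauchy problem, by choosing terminal data close to the sign of the
    kernel, and L^1 norms replace pointwise estimates. The functions that the integral equation
    feeds to the kernel are only Borel, since the diagonal values [Theta tau tau eta eta] are merely
    measurable; hence the passage from continuous to Borel data has to come before any
    differentiation of [Theta].

    The weight [sqrt (s - t)] answers a borderline divergence. In a difference of two drivers the
    argument [Gamma_xi] costs [1 / sqrt (tau - t)], and differentiating the outer kernel costs
    [1 / sqrt (tau - s)]. At [s = t] the product is [1 / (tau - s)], which is not integrable. Since
    [sqrt (s - t) <= sqrt (tau - t)], the weight cancels the first factor and leaves the second.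

    The doubled function is maximized on [|x - y| <= l sqrt (tau - s)], the parabolic scale, which
    is where the rate [1 / sqrt (tau - s)] comes from. *)

Section calculus.
Context (R : realType).

Lemma within_comp (U V W : topologicalType) (D : set V) (E : set U)
    (f : V -> W) (phi : U -> V) :
  {within D, continuous f} -> {within E, continuous phi} ->
  (forall u, E u -> D (phi u)) -> {within E, continuous (fun u => f (phi u))}.
Proof.
move=> /subspace_continuousP cf /subspace_continuousP cphi ED.
apply/subspace_continuousP => u Eu A nA.
have := cphi _ Eu _ (cf _ (ED _ Eu) _ nA).
rewrite /= !nbhs_simpl /= /within /= => H.
by apply: filterS H => w /= h Ew; exact: h Ew (ED _ Ew).
Qed.

Lemma withinT_continuous (U W : topologicalType) (f : U -> W) :
  {within [set: U], continuous f} -> continuous f.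
Proof. by rewrite continuous_subspace_setT. Qed.

Lemma within_comp_continuous (U V W : topologicalType) (D : set V)
    (f : V -> W) (phi : U -> V) :
  {within D, continuous f} -> continuous phi ->
  (forall u, D (phi u)) -> continuous (fun u => f (phi u)).
Proof.
move=> cf cphi ED; apply: withinT_continuous; apply: within_comp cf _ _ => //.
exact: continuous_subspaceT.
Qed.

Lemma differentiable_eps (V W : normedModType R) (f : V -> W)
    (df : {linear V -> W}) x : continuous df ->
  (forall e, 0 < e -> \forall h \near 0, `|f (h + x) - f x - df h| <= e * `|h|) ->
  differentiable f x /\ 'd f x = df :> (V -> W).
Proof.
move=> cdf Hf.
have H : f \o shift x = cst (f x) + df +o_ 0 id.
  apply/eqaddoP => e e0; have := Hf e e0; apply: filterS => h /=.
  by rewrite opprD addrA.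
have E := diff_unique cdf H; split => //.
by apply/diff_locallyP; rewrite E.
Qed.

Lemma mx_norm_entry m n (A : 'M[R]_(m, n)) i j : `|A i j| <= `|A|.
Proof.
rewrite [leRHS]mx_normrE.
exact: (le_bigmax _ (fun ij : 'I_m * 'I_n => `|A ij.1 ij.2|) (i, j)).
Qed.

Lemma mx_norm_le m n (A : 'M[R]_(m, n)) (c : R) : 0 <= c ->
  (forall i j, `|A i j| <= c) -> `|A| <= c.
Proof.
move=> c0 H; rewrite [leLHS]mx_normrE.
by apply/bigmax_leP; split => // -[i j] _; exact: H.
Qed.

Lemma cvg_sumr (T : Type) (F : set_system T) {FF : Filter F} (I : Type)
    (r : seq I) (P : pred I) (f : I -> T -> R) (a : I -> R) :
  (forall i, f i x @[x --> F] --> a i) ->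
  \sum_(i <- r | P i) f i x @[x --> F] --> \sum_(i <- r | P i) a i.
Proof.
move=> fa; elim: r => [|i r IH].
  under eq_fun do rewrite big_nil.
  by rewrite big_nil; exact: cvg_cst.
under eq_fun do rewrite big_cons.
by rewrite big_cons; case: ifP => // _; exact: cvgD.
Qed.

Section partials.
Variable n : nat.

Definition dot (c u : 'cV[R]_n) : R := \sum_i c i 0 * u i 0.

Lemma dot_is_linear c : linear (dot c).
Proof.
move=> a u v; rewrite /dot scaler_sumr -big_split/=; apply: eq_bigr => i _.
by rewrite !mxE mulrDr mulrCA.
Qed.

HB.instance Definition _ c :=
  GRing.isLinear.Build R 'cV[R]_n R _ (dot c) (dot_is_linear c).

Lemma dot_continuous c : continuous (dot c).
Proof.
move=> u; apply: (@cvg_sumr _ (nbhs u) (nbhs_filter u)) => i; apply: cvgM; first exact: cvg_cst.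
exact: coord_continuous.
Qed.

Lemma is_derive_line (f : 'cV[R]_n -> R) x v (t : R) : derivable f (t *: v + x) v ->
  is_derive t 1 (fun s : R => f (s *: v + x)) ('D_v f (t *: v + x)).
Proof.
move=> H.
have E : (fun h : R => h^-1 *: (((fun s : R => f (s *: v + x)) \o shift t) (h *: 1)
             - f (t *: v + x))) =
    (fun h => h^-1 *: ((f \o shift (t *: v + x)) (h *: v) - f (t *: v + x))).
  apply/funext => h /=.
  by rewrite scalerDl -addrA scaler1.
by split; rewrite /derivable ?/derive ?E.
Qed.

(* Telescoping over the coordinates, one mean value theorem per coordinate. *)
Lemma differentiable_partials (f : 'cV[R]_n -> R) x :
  (forall y i, derivable f y (unitv R i)) ->
  (forall i, {for x, continuous (fun y => 'D_(unitv R i) f y)}) ->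
  differentiable f x /\ forall h, 'd f x h = \sum_i 'D_(unitv R i) f x * h i 0.
Proof.
move=> df cdf.
pose c : 'cV[R]_n := \col_i 'D_(unitv R i) f x.
have [] // := @differentiable_eps _ _ f (dot c) x (@dot_continuous c); last first.
  by move=> ? dE; split => // h; rewrite dE; apply: eq_bigr => i _; rewrite mxE.
move=> e e0.
have n1 : 0 < n%:R + 1 :> R by rewrite ltr_wpDl.
have e1 : 0 < e / (n%:R + 1) by rewrite divr_gt0.
have /nbhs_ballP[r /= r0 Hr] : \forall y \near x,
    forall i, `|'D_(unitv R i) f y - 'D_(unitv R i) f x| < e / (n%:R + 1).
  apply: (@filter_forall _ _ _ (nbhs x) (nbhs_filter x)) => i; have /cvgrPdist_lt/(_ _ e1) := cdf i.
  by apply: filterS => y; rewrite distrC.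
apply/nbhs_ballP; exists r => //= h; rewrite -ball_normE/= sub0r normrN => hr.
pose g k : 'cV[R]_n := \col_i (if (i < k)%N then h i 0 else 0).
have g0 : g 0%N = 0 by apply/matrixP => i j; rewrite !mxE.
have gn : g n = h by apply/matrixP => i j; rewrite !mxE ltn_ord (ord1 j).
have gS (k : 'I_n) : g k.+1 = h k 0 *: unitv R k + g k.
  apply/matrixP => i j; rewrite !mxE (ord1 j) andbT ltnS leq_eqVlt.
  case: (altP (i =P k)) => [->|ik]; first by rewrite eqxx ltnn mulr1 addr0.
  by rewrite (negbTE ik : (i == k :> nat) = false) mulr0 add0r.
have -> : f (h + x) - f x = \sum_(k < n) (f (g k.+1 + x) - f (g k + x)).
  by rewrite -(big_mkord xpredT (fun k => f (g k.+1 + x) - f (g k + x)))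
     (telescope_sumr (fun k => f (g k + x)))// gn g0 add0r.
rewrite -sumrB (le_trans (ler_norm_sum _ _ _))//.
apply: (@le_trans _ _ (\sum_(k < n) (e / (n%:R + 1) * `|h|))); last first.
  rewrite sumr_const card_ord (_ : _ *+ n = e * `|h| * (n%:R / (n%:R + 1))).
    by rewrite ler_piMr ?mulr_ge0 ?(ltW e0)// ler_pdivrMr// mul1r lerDl.
  by rewrite -[LHS]mulr_natr; ring.
apply: ler_sum => k _; rewrite mxE gS -[_ + _ + x]addrA.
set p := g k + x.
have [th tI ->] : exists2 th, `|th| <= `|h k 0| &
    f (h k 0 *: unitv R k + p) - f p = 'D_(unitv R k) f (th *: unitv R k + p) * h k 0.
  have D (s : R) : is_derive s 1 (fun s : R => f (s *: unitv R k + p))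
       ('D_(unitv R k) f (s *: unitv R k + p)) by apply: is_derive_line; exact: df.
  have C a b : {within `[a, b], continuous (fun s : R => f (s *: unitv R k + p))}.
    apply: continuous_subspaceT => s; apply: differentiable_continuous.
    by apply/derivable1_diffP.
  have [h0|h0] := leP 0 (h k 0).
    have [s + E] := MVT_segment h0 (fun s _ => D s) (C _ _).
    rewrite in_itv/= => /andP[s0 sh]; exists s; first by rewrite !ger0_norm.
    by move: E; rewrite scale0r add0r subr0.
  have [s + E] := MVT_segment (ltW h0) (fun s _ => D s) (C _ _).
  rewrite in_itv/= => /andP[s0 sh]; exists s.
    by rewrite !ler0_norm// ?lerN2// ltW.
  move: E; rewrite scale0r add0r sub0r mulrN => /eqP.
  by rewrite -eqr_opp opprB opprK => /eqP.
rewrite -mulrBl normrM ler_pM//; last exact: mx_norm_entry.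
apply/ltW/Hr; rewrite -ball_normE/= /p addrA opprD addrCA subrr addr0 normrN.
apply: le_lt_trans hr; apply: mx_norm_le => // i j; rewrite !mxE (ord1 j) andbT.
case: (altP (i =P k)) => [->|ik]; first by rewrite ltnn mulr1 addr0 (le_trans tI)// mx_norm_entry.
by rewrite mulr0 add0r; case: ifP => _; rewrite ?normr0// mx_norm_entry.
Qed.

(* Second order conditions are read off one-dimensional restrictions. *)
Lemma derive_line (f : 'cV[R]_n -> R) (x p : 'cV[R]_n) (t : R) :
  (forall y i, derivable f y (unitv R i)) ->
  (forall i, continuous ('D_(unitv R i) f)) ->
  is_derive t 1 (fun s : R => f (s *: p + x))
    (\sum_i p i 0 * 'D_(unitv R i) f (t *: p + x)).
Proof.
move=> df cdf; have [dfx dE] := differentiable_partials df (cdf ^~ (t *: p + x)).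
have -> : \sum_i p i 0 * 'D_(unitv R i) f (t *: p + x) = 'D_p f (t *: p + x).
  by rewrite deriveE// dE; apply: eq_bigr => i _; rewrite mulrC.
by apply: is_derive_line; exact: diff_derivable.
Qed.

Lemma derive2_line (f : 'cV[R]_n -> R) (x p : 'cV[R]_n) :
  (forall y i, derivable f y (unitv R i)) ->
  (forall i, continuous ('D_(unitv R i) f)) ->
  (forall y i j, derivable ('D_(unitv R i) f) y (unitv R j)) ->
  (forall i j, continuous ('D_(unitv R j) ('D_(unitv R i) f))) ->
  is_derive (0 : R) 1 (fun s : R => \sum_i p i 0 * 'D_(unitv R i) f (s *: p + x))
    (\sum_i \sum_j p i 0 * p j 0 * 'D_(unitv R j) ('D_(unitv R i) f) x).
Proof.
move=> df cdf ddf cddf.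
have -> : (fun s : R => \sum_i p i 0 * 'D_(unitv R i) f (s *: p + x)) =
    \sum_i (fun s : R => p i 0 *: 'D_(unitv R i) f (s *: p + x)).
  by apply/funext => s; rewrite fct_sumE.
apply: is_derive_sum => i.
have := derive_line x p 0 (ddf ^~ i) (cddf i).
move=> /(is_deriveZ (p i 0)); rewrite scale0r add0r scaler_sumr.
move=> H; apply: is_derive_eq.
by apply: eq_bigr => j _; rewrite -mulrA.
Qed.

End partials.

(** If [c > 0], then [dphi] vanishes at 0 and is positive just to the right of it, and the mean
    value theorem puts [phi] above [phi 0] there. *)
Lemma second_order_max (phi dphi : R -> R) (c : R) :
  (forall t : R, is_derive t 1 phi (dphi t)) -> is_derive (0 : R) 1 dphi c ->
  (\forall t \near (0 : R), phi t <= phi 0) -> dphi 0 = 0 /\ c <= 0.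
Proof.
move=> D1 D2 /nbhs_ballP[r /= r0 Hr].
have mx t : `|t| < r -> phi t <= phi 0.
  by move=> tr; apply: Hr; rewrite -ball_normE/= sub0r normrN.
have d0 : dphi 0 = 0.
  have H0 : (0 : R) \in `](- r), r[ by rewrite in_itv/= oppr_lt0 r0.
  have [|t _|t trr|_ E] := @derive1_at_max _ phi (- r) r 0 _ _ H0.
  - by rewrite ge0_cp// ltW.
  - by have [] := D1 t.
  - by move: trr; rewrite in_itv/= -ltr_norml; exact: mx.
  by have [_ D10] := D1 0; rewrite -D10 E.
split=> //; rewrite leNgt; apply/negP => c0.
have [D2x D2v] := D2.
have : (fun h : R => h^-1 *: ((dphi \o shift 0) (h *: 1) - dphi 0)) @ 0^' --> c.
  by rewrite -D2v; exact: D2x.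
move=> /cvgrPdist_lt/(_ _ c0) /nbhs_ballP[r' /= r'0 Hr'].
have pos t : 0 < t < r' -> 0 < dphi t.
  move=> /andP[t0 tr].
  have := Hr' t; rewrite -ball_normE/= sub0r normrN gtr0_norm// => /(_ tr).
  rewrite gt_eqF// => /(_ isT).
  rewrite addr0 d0 subr0 [_ *: 1]mulr1 ltr_norml => /andP[_].
  by rewrite ltrBlDr ltrDl pmulr_rgt0// invr_gt0.
pose t := Num.min r r' / 2.
have t0 : 0 < t by rewrite divr_gt0// lt_min r0.
have tm : t < Num.min r r' by rewrite ltr_pdivrMr// ltr_pMr ?ltr1n// lt_min r0.
move: (tm); rewrite lt_min => /andP[tr tr'].
have C : {within `[0, t], continuous phi}.
  apply: continuous_subspaceT => s; apply: differentiable_continuous.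
  by apply/derivable1_diffP; have [] := D1 s.
have [s] := MVT t0 (fun s _ => D1 s) C.
rewrite in_itv/= => /andP[s0 st] E.
have : phi t <= phi 0 by apply: mx; rewrite gtr0_norm.
rewrite -subr_le0 E leNgt => /negP; apply.
by rewrite subr0 mulr_gt0// pos// s0 (lt_trans st).
Qed.

(** The Taylor polynomial of order three is a global majorant: its square exceeds [1 + u] by a
    nonnegative multiple of [u ^+ 4]. In [pair_test] it replaces the norm of [x - y] by a polynomial
    that touches it to second order at the maximum. *)
Lemma sqrt_taylor (u : R) : -1 <= u ->
  Num.sqrt (1 + u) <= 1 + u / 2 - u ^+ 2 / 8 + u ^+ 3 / 16.
Proof.
move=> u1.
have p0 : 0 <= 1 + u / 2 - u ^+ 2 / 8 + u ^+ 3 / 16.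
  (* Division of the cubic by [u + 1]: the remainder 5/16 is its value at -1, and the quotient is a
     sum of squares. *)
  have -> : 1 + u / 2 - u ^+ 2 / 8 + u ^+ 3 / 16 =
    5 / 16 + (u + 1) * ((u - 3 / 2) ^+ 2 + 35 / 4) / 16 by field.
  rewrite addr_ge0// ?divr_ge0// mulr_ge0//; first by lra.
  by rewrite addr_ge0// ?sqr_ge0//; lra.
rewrite -[leRHS]ger0_norm// -sqrtr_sqr ler_wsqrtr//.
rewrite -subr_ge0.
have -> : (1 + u / 2 - u ^+ 2 / 8 + u ^+ 3 / 16) ^+ 2 - (1 + u) =
    u ^+ 4 * ((u / 16 - 1 / 8) ^+ 2 + 1 / 16) by field.
by rewrite mulr_ge0// ?exprn_even_ge0// addr_ge0// ?sqr_ge0//; lra.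
Qed.

End calculus.

(** * Maximum tests with quadratic penalties, for one point and for two *)

Section quadratic.
Context (R : realType) (n : nat).
Implicit Types x y p q z : 'cV[R]_n.

Lemma sqnorm_dot x : sqnorm x = dot x x.
Proof. by apply: eq_bigr => i _; rewrite expr2. Qed.

Lemma sqnorm_ge0 x : 0 <= sqnorm x.
Proof. by apply: sumr_ge0 => i _; exact: sqr_ge0. Qed.

Lemma sqnorm_gt0 x : x != 0 -> 0 < sqnorm x.
Proof.
move=> x0; rewrite lt_neqAle sqnorm_ge0 andbT eq_sym psumr_neq0; last first.
  by move=> i _; exact: sqr_ge0.
have [i xi] : exists i, x i 0 != 0.
  apply/existsP; rewrite -negb_forall; apply: contra x0 => /forallP H.
  by apply/eqP/matrixP => i j; rewrite (ord1 j) mxE; exact/eqP/H.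
by apply/hasP; exists i; rewrite ?mem_index_enum//= exprn_even_gt0.
Qed.

Lemma dotC x y : dot x y = dot y x.
Proof. by apply: eq_bigr => i _; rewrite mulrC. Qed.

Lemma dotZl a x y : dot (a *: x) y = a * dot x y.
Proof. by rewrite dotC [LHS]linearZ/= dotC. Qed.

Lemma dotDl x y z : dot (x + y) z = dot x z + dot y z.
Proof. by rewrite dotC linearD/= !(dotC z). Qed.

Lemma sqnormD x y : sqnorm (x + y) = sqnorm x + 2 * dot x y + sqnorm y.
Proof. by rewrite !sqnorm_dot !(dotDl, linearD)/= (dotC y x); ring. Qed.

Lemma sqnormZ a x : sqnorm (a *: x) = a ^+ 2 * sqnorm x.
Proof. by rewrite !sqnorm_dot dotZl [dot _ (a *: x)]linearZ/= mulrA. Qed.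

Lemma sqnorm_line (t : R) p x :
  sqnorm (t *: p + x) = sqnorm x + 2 * t * dot x p + t ^+ 2 * sqnorm p.
Proof. by rewrite sqnormD sqnormZ dotZl dotC; ring. Qed.

(** The remainder [t ^+ 3 * s.[t]] has zero first and second derivatives at 0, so it does not enter
    the conditions at the maximum. *)
Lemma poly_max (phi dphi : R -> R) (c a1 a2 : R) (s : {poly R}) :
  (forall t : R, is_derive t 1 phi (dphi t)) -> is_derive (0 : R) 1 dphi c ->
  (\forall t \near (0 : R),
    phi t + (a1 * t + a2 * t ^+ 2 + t ^+ 3 * s.[t]) <= phi 0) ->
  dphi 0 + a1 = 0 /\ c + 2 * a2 <= 0.
Proof.
move=> D1 D2 H.
pose P := a1 *: 'X + a2 *: 'X^2 + 'X^3 * s.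
have PE t : P.[t] = a1 * t + a2 * t ^+ 2 + t ^+ 3 * s.[t] by rewrite !hornerE.
have E1 : P^`().[0] = a1.
  by rewrite horner_coef0 coef_deriv !coefD !coefZ coefX coefXn coefXnM/=; ring.
have E2 : P^`()^`().[0] = 2 * a2.
  rewrite horner_coef0 !coef_deriv !coefD !coefZ coefX coefXn coefXnM/=.
  by rewrite mulr1n; ring.
have [] // := @second_order_max _ (phi + horner P) (dphi + horner P^`()) (c + 2 * a2).
- by rewrite -E2; apply: is_deriveD.
- have P0 : P.[0] = 0 by rewrite PE; ring.
  by apply: filterS H => t; rewrite -PE /= !fctE P0 addr0.
by rewrite fctE E1.
Qed.

Definition C2 (f : 'cV[R]_n -> R) :=
  [/\ forall y i, derivable f y (unitv R i),
      forall i, continuous ('D_(unitv R i) f),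
      forall y i j, derivable ('D_(unitv R i) f) y (unitv R j) &
      forall i j, continuous ('D_(unitv R j) ('D_(unitv R i) f))].

Definition dir1 (f : 'cV[R]_n -> R) x p := \sum_i p i 0 * 'D_(unitv R i) f x.
Definition dir2 (f : 'cV[R]_n -> R) x p :=
  \sum_i \sum_j p i 0 * p j 0 * 'D_(unitv R j) ('D_(unitv R i) f) x.

(** On a line the penalty is an exact quadratic in [t]. With the columns of [sigma] and the drift as
    directions [p], the test controls the whole generator at a maximum. *)
Lemma single_test f x p (a del : R) : C2 f ->
  (\forall t \near (0 : R), a * f (t *: p + x) - del * sqnorm (t *: p + x) <=
                             a * f x - del * sqnorm x) ->
  a * dir1 f x p = 2 * del * dot x p /\ a * dir2 f x p <= 2 * del * sqnorm p.
Proof.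
move=> [f1 f2 f3 f4] H.
have [] := @poly_max _ _ _ (- (2 * del * dot x p)) (- (del * sqnorm p)) 0
  (fun t => is_deriveZ a (derive_line x p t f1 f2))
  (is_deriveZ a (derive2_line x p f1 f2 f3 f4)).
  apply: filterS H => t; rewrite /= sqnorm_line horner0 mulr0 !scale0r !add0r.
  rewrite -![a *: f _]/(a * f _).
  by move: (f _) (f x) (sqnorm x) (sqnorm p) (dot x p) => A B C D E; lra.
rewrite scale0r add0r -/(dir1 f x p) -/(dir2 f x p).
rewrite -[a *: dir1 f x p]/(a * dir1 f x p) -[a *: dir2 f x p]/(a * dir2 f x p).
move: (dir1 f x p) (dir2 f x p) (dot x p) (sqnorm p) => A B C D.
by clear=> ? ?; split; lra.
Qed.

(** Both points move at once, [x] along [p] and [y] along [q]; choosing [q] in terms of [p] is a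
    coupling of the noises. The factor of [c1] in the second condition is the Hessian of the
    Euclidean norm at [x - y] in the direction [p - q]. It vanishes when [p - q] is parallel to
    [x - y], and then only the [c2] term is left. *)
Lemma pair_test f x y p q (th c1 c2 del : R) : C2 f -> 0 <= c1 -> x != y ->
  let H x y := th * (f x - f y) - c1 * Num.sqrt (sqnorm (x - y))
               + c2 * sqnorm (x - y) - del * (sqnorm x + sqnorm y) in
  (\forall t \near (0 : R), H (t *: p + x) (t *: q + y) <= H x y) ->
  let r := Num.sqrt (sqnorm (x - y)) in
  let k := dot (x - y) (p - q) in
  th * (dir1 f x p - dir1 f y q) =
    c1 * k / r - 2 * c2 * k + 2 * del * (dot x p + dot y q) /\
  th * (dir2 f x p - dir2 f y q) <=
    c1 * (sqnorm (p - q) / r - k ^+ 2 / r ^+ 3) - 2 * c2 * sqnorm (p - q)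
    + 2 * del * (sqnorm p + sqnorm q).
Proof.
move=> [f1 f2 f3 f4] c10 xy H nH r k.
have r0 : 0 < r by rewrite sqrtr_gt0 sqnorm_gt0// subr_eq0.
have rr : sqnorm (x - y) = r ^+ 2 by rewrite sqr_sqrtr// sqnorm_ge0.
set Z := sqnorm (p - q).
(* The coefficients in [|x - y + t (p - q)|^2 = r^2 (1 + a t + b t^2)]. *)
pose a := 2 * k / r ^+ 2; pose b := Z / r ^+ 2.
pose phi t := th * (f (t *: p + x) - f (t *: q + y)).
pose dphi t := th * (dir1 f (t *: p + x) p - dir1 f (t *: q + y) q).
have D1 (t : R) : is_derive t 1 phi (dphi t).
  have := is_deriveZ th (is_deriveB (derive_line x p t f1 f2) (derive_line y q t f1 f2)).
  exact.
have D2 : is_derive (0 : R) 1 dphi (th * (dir2 f x p - dir2 f y q)).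
  have := is_deriveZ th (is_deriveB (derive2_line x p f1 f2 f3 f4)
    (derive2_line y q f1 f2 f3 f4)).
  exact.
(* The terms of order at least three in [- c1 r (1 + u / 2 - u^2 / 8 + u^3 / 16)] with
   [u = a t + b t^2], divided by [t^3]. *)
pose s : {poly R} := (- c1 * r) *: ((- (a * b / 4))%:P - (b ^+ 2 / 8) *: 'X
   + 16^-1 *: (a%:P + b *: 'X) ^+ 3).
have [] := @poly_max phi dphi _ (- c1 * r * (a / 2) + 2 * c2 * k - 2 * del * (dot x p + dot y q))
   (- c1 * r * (b / 2 - a ^+ 2 / 8) + c2 * Z - del * (sqnorm p + sqnorm q)) s D1 D2.
  apply: filterS nH => t.
  have -> : phi 0 = th * (f x - f y) by rewrite /phi !scale0r !add0r.
  rewrite /H -/r rr.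
  have zE : t *: p + x - (t *: q + y) = t *: (p - q) + (x - y).
    by rewrite scalerBr opprD addrACA.
  pose u := a * t + b * t ^+ 2.
  have QE : sqnorm (t *: p + x - (t *: q + y)) = r ^+ 2 * (1 + u).
    rewrite zE sqnorm_line rr /u /a /b -/k -/Z.
    by field; rewrite gt_eqF.
  have u1 : -1 <= u.
    rewrite -subr_ge0 opprK addrC.
    have := sqnorm_ge0 (t *: p + x - (t *: q + y)).
    by rewrite QE pmulr_rge0// exprn_gt0.
  rewrite QE sqrtrM ?sqr_ge0// sqrtr_sqr gtr0_norm// !sqnorm_line.
  have := ler_wpM2l (mulr_ge0 c10 (ltW r0)) (sqrt_taylor u1).
  have -> : s.[t] = - c1 * r * (- (a * b / 4) - b ^+ 2 / 8 * t + 16^-1 * (a + b * t) ^+ 3).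
    by rewrite /s !hornerE.
  rewrite -/(phi t).
  have -> : r ^+ 2 * (1 + u) = r ^+ 2 + 2 * t * k + t ^+ 2 * Z.
    by rewrite /u /a /b; field; rewrite gt_eqF.
  move: (Num.sqrt _) => S; rewrite /u; move: (phi t) => P.
  set X := sqnorm x; set Y := sqnorm y.
  by set pp := sqnorm p; set qq := sqnorm q; lra.
have -> : dphi 0 = th * (dir1 f x p - dir1 f y q) by rewrite /dphi !scale0r !add0r.
have -> : - c1 * r * (a / 2) = - (c1 * k / r).
  by rewrite /a; field; rewrite gt_eqF.
have -> : - c1 * r * (b / 2 - a ^+ 2 / 8) = - (c1 * (Z / r - k ^+ 2 / r ^+ 3) / 2).
  by rewrite /a /b; field; rewrite gt_eqF.
move: (dir1 _ _ _ - _) (dir2 _ _ _ - _) (c1 * k / r) (c1 * (Z / r - _)).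
move: (dot x p + dot y q) (sqnorm p + sqnorm q) => A B C D E F.
clear; move: Z k => Z k H1 H2; split; lra.
Qed.

End quadratic.

Section compactness.
Context (R : realType).

Lemma cvg_matrix (T : Type) (F : set_system T) {FF : Filter F} m n
    (f : T -> 'M[R]_(m, n)) (A : 'M[R]_(m, n)) :
  (forall i j, f x i j @[x --> F] --> A i j) -> f @ F --> A.
Proof.
move=> H; apply/cvg_ballP => e e0.
have : \forall x \near F, forall i j, ball (A i j) e (f x i j).
  apply: filter_forall => i; apply: filter_forall => j.
  by have /cvg_ballP/(_ e e0) := H i j.
by apply: filterS => x Hx; split.
Qed.

Lemma pairr_continuous (U V : topologicalType) (s : U) :
  continuous (fun x : V => (s, x)).
Proof. by move=> x; apply: cvg_pair; [exact: cvg_cst|exact: cvg_id]. Qed.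

Lemma pairl_continuous (U V : topologicalType) (x : V) :
  continuous (fun s : U => (s, x)).
Proof. by move=> s; apply: cvg_pair; [exact: cvg_id|exact: cvg_cst]. Qed.

Lemma compact_cball n (r : R) : compact [set x : 'cV[R]_n | `|x| <= r].
Proof.
(* [bounded_closed_compact] concerns row vectors; transposition preserves the norm and is
   continuous. *)
have -> : [set x : 'cV[R]_n | `|x| <= r] = trmx @` [set x : 'rV[R]_n | `|x| <= r].
  apply/seteqP; split => x /=.
    move=> xr; exists x^T; rewrite ?trmxK//.
    apply: mx_norm_le => [|i j]; first exact: le_trans xr.
    by rewrite mxE (le_trans (mx_norm_entry _ _ _)).
  move=> [y yr <-].
  apply: mx_norm_le => [|i j]; first exact: le_trans yr.
  by rewrite mxE (le_trans (mx_norm_entry _ _ _)).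
apply: continuous_compact.
  apply: continuous_subspaceT => x; apply: (@cvg_matrix _ (nbhs x) (nbhs_filter x)) => i j.
  under eq_fun do rewrite mxE.
  by rewrite mxE; exact: coord_continuous.
apply: bounded_closed_compact.
  exists r; split; first exact: num_real.
  by move=> M rM x /= xr; rewrite (le_trans xr)// ltW.
apply: (@closed_comp _ _ (fun x : 'rV[R]_n => `|x|) [set x | x <= r]); last exact: closed_le.
by move=> x _; exact: norm_continuous.
Qed.

End compactness.

(** * The parabolic operator at a maximum, and the reflection of the noise *)

Section parabolic_tests.
Context (R : realType) (n d : nat).
Variables (b : R -> 'cV[R]_n -> 'cV[R]_n) (sigma : R -> 'cV[R]_n -> 'M[R]_(n, d)).

Lemma C12_C2 tau (v : R -> 'cV[R]_n -> R) s :
  C12 tau v -> 0 <= s < tau -> C2 (v s).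
Proof.
move=> [_ _ H1 H2] st; split.
- by move=> y i; exact: (H1 i).1.
- move=> i; apply: (within_comp_continuous (phi := fun x => (s, x)) (H1 i).2) => //.
  exact: pairr_continuous.
- by move=> y i j; exact: (H2 i j).1.
- move=> i j; apply: (within_comp_continuous (phi := fun x => (s, x)) (H2 i j).2) => //.
  exact: pairr_continuous.
Qed.

(** The second order part depends on [S] only through [S *m S^T]. The columns of any matrix with the
    same Gram matrix serve as test directions, and this is the freedom that the coupling uses. *)
Lemma dir2_gram (f : 'cV[R]_n -> R) x (S : 'M[R]_(n, d)) :
  \sum_k dir2 f x (col k S) =
  \sum_i \sum_j (S *m S^T) i j * 'D_(unitv R j) ('D_(unitv R i) f) x.
Proof.
rewrite /dir2 exchange_big/=; apply: eq_bigr => i _.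
rewrite exchange_big/=; apply: eq_bigr => j _.
by rewrite !mxE mulr_suml; apply: eq_bigr => k _; rewrite !mxE.
Qed.

Lemma sqnorm_gram (S : 'M[R]_(n, d)) :
  \sum_k sqnorm (col k S) = \sum_i (S *m S^T) i i.
Proof.
rewrite /sqnorm exchange_big/=; apply: eq_bigr => i _.
by rewrite !mxE; apply: eq_bigr => k _; rewrite !mxE expr2.
Qed.

Lemma parabolic_dir v s x : parabolic_op b sigma v s x =
  'D_1 (v ^~ x) s + 2^-1 * (\sum_k dir2 (v s) x (col k (sigma s x)))
  + dir1 (v s) x (b s x).
Proof.
rewrite /parabolic_op; congr (_ + _ + _); rewrite dir2_gram mulr_sumr.
apply: eq_bigr => i _; rewrite mulr_sumr; apply: eq_bigr => j _.
by rewrite mxE mulrA.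
Qed.

(** One-sided, because the maximum may sit at the lower end of the time interval, from which only
    later times can be compared. The sign obtained is the one that suits a backward equation. *)
Lemma right_max (phi : R -> R) (s c : R) : is_derive s 1 phi c ->
  (exists2 r, 0 < r & forall e, 0 < e < r -> phi (e + s) <= phi s) -> c <= 0.
Proof.
move=> [dx dv] [r r0 H]; rewrite leNgt; apply/negP => c0.
have : (fun h : R => h^-1 *: ((phi \o shift s) (h *: 1) - phi s)) @ 0^' --> c.
  by rewrite -dv; exact: dx.
move=> /cvgrPdist_lt/(_ _ c0) /nbhs_ballP[r' /= r'0 Hr'].
pose t := Num.min r r' / 2.
have t0 : 0 < t by rewrite divr_gt0// lt_min r0.
have tm : t < Num.min r r' by rewrite ltr_pdivrMr// ltr_pMr ?ltr1n// lt_min r0.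
move: (tm); rewrite lt_min => /andP[tr tr'].
have := Hr' t; rewrite -ball_normE/= sub0r normrN gtr0_norm// => /(_ tr').
rewrite gt_eqF// => /(_ isT).
rewrite [_ *: 1]mulr1 ltr_norml => /andP[_].
rewrite ltrBlDr ltrDl pmulr_rgt0 ?invr_gt0// subr_gt0 ltNge => /negP; apply.
by apply: H; rewrite t0.
Qed.

(** [Q = S (1 - 2 w w^T / |w|^2)] is [S] followed on the right by the Householder reflection along
    [w], which is orthogonal; [S *m w = z] gives the form used here. *)
Lemma reflect_gram (S : 'M[R]_(n, d)) (z : 'cV[R]_n) (w : 'cV[R]_d) :
  S *m w = z -> sqnorm w != 0 ->
  let Q := S - (2 / sqnorm w) *: (z *m w^T) in Q *m Q^T = S *m S^T.
Proof.
move=> Sw w0 Q.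
have ww : w^T *m w = (sqnorm w)%:M.
  apply/matrixP => i j; rewrite !ord1 !mxE eqxx mulr1n.
  by apply: eq_bigr => k _; rewrite !mxE expr2.
have wS : w^T *m S^T = z^T by rewrite -trmx_mul Sw.
set c := 2 / sqnorm w.
have QT : Q^T = S^T - c *: (w *m z^T).
  by rewrite /Q [LHS]linearB/= linearZ/= trmx_mul trmxK.
have SW : S *m (c *: (w *m z^T)) = c *: (z *m z^T).
  by rewrite -scalemxAr mulmxA Sw.
have WS : c *: (z *m w^T) *m S^T = c *: (z *m z^T).
  by rewrite -scalemxAl -mulmxA wS.
have WW : c *: (z *m w^T) *m (c *: (w *m z^T)) = (c + c) *: (z *m z^T).
  rewrite -scalemxAl -scalemxAr scalerA -mulmxA (mulmxA w^T) ww mul_scalar_mx.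
  by rewrite -scalemxAr scalerA; congr (_ *: _); rewrite /c; field.
rewrite QT /Q mulmxBl !mulmxBr SW WS WW scalerDl opprB.
by rewrite addrK subrK.
Qed.

Lemma dot_AMGM (x y : 'cV[R]_n) k : 0 < k ->
  2 * `|dot x y| <= k * sqnorm x + sqnorm y / k.
Proof.
move=> k0; have H (e : R) : `|e| = 1 -> 2 * (e * dot x y) <= k * sqnorm x + sqnorm y / k.
  move=> e1; have ee : e ^+ 2 = 1 by rewrite -real_normK ?num_real// e1 expr1n.
  have := mulr_ge0 (ltW k0) (sqnorm_ge0 (x + (- e / k) *: y)).
  rewrite sqnormD sqnormZ [dot x (_ *: y)]linearZ/= exprMn sqrrN ee mul1r.
  rewrite -[_ *: dot _ _]/(_ * _) => H; rewrite -subr_ge0; move: H.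
  by congr (_ <= _); field; rewrite gt_eqF.
have [h|h] := leP 0 (dot x y).
  by rewrite ger0_norm//; have := H 1 (normr1 _); rewrite mul1r.
by rewrite ltr0_norm//; have := H (-1); rewrite normrN normr1 mulN1r; exact.
Qed.

(** The preimage is [w = S^T q] with [q = (S S^T)^-1 z]; ellipticity makes [S S^T] invertible. Then
    [|w|^2] is the scalar product of [q] and [z], and Young's inequality combined with
    [sb |q|^2 <= |w|^2] bounds it by [|z|^2 / sb]. *)
Lemma elliptic_preimage (S : 'M[R]_(n, d)) (sb : R) (z : 'cV[R]_n) : 0 < sb ->
  (forall xi, sb * sqnorm xi <= sqnorm (S^T *m xi)) -> z != 0 ->
  exists w : 'cV[R]_d, [/\ S *m w = z, 0 < sqnorm w & sb * sqnorm w <= sqnorm z].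
Proof.
move=> sb0 ell z0; pose A := S *m S^T.
have dotA q : dot q (A *m q) = sqnorm (S^T *m q).
  rewrite /A -mulmxA sqnorm_dot /dot.
  under eq_bigr do rewrite mxE mulr_sumr.
  rewrite exchange_big/=; apply: eq_bigr => k _.
  rewrite [X in X * _]mxE mulr_suml; apply: eq_bigr => i _.
  by rewrite !mxE mulrCA mulrA.
have Au : A \in unitmx.
  rewrite -row_free_unit -kermx_eq0; apply/eqP/row_matrixP => i; rewrite row0.
  have /sub_kermxP := row_sub i (kermx A).
  move: (row i _) => u uA.
  have Au : A *m u^T = 0.
    have At : A^T = A by rewrite trmx_mul trmxK.
    by rewrite -[LHS]trmxK trmx_mul At trmxK uA trmx0.
  apply/eqP; rewrite -trmx_eq0; apply/eqP; apply: contrapT => /eqP u0.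
  have := ell u^T; rewrite -dotA Au linear0 leNgt => /negP; apply.
  by rewrite mulr_gt0// sqnorm_gt0.
pose q := invmx A *m z.
have Aq : A *m q = z by rewrite /q mulmxA mulmxV// mul1mx.
have Sw : S *m (S^T *m q) = z by rewrite mulmxA Aq.
exists (S^T *m q); split => //.
  apply: sqnorm_gt0; apply: contraNneq z0 => w0.
  by rewrite -Sw w0 mulmx0.
have E := dotA q; rewrite Aq in E.
have := dot_AMGM q z sb0; have := ell q; rewrite -E.
have /ger0_norm -> : 0 <= dot q z by rewrite E sqnorm_ge0.
set D := dot q z => h1 h2.
rewrite -ler_pdivlMl// mulrC; move: h1 h2; set X := sqnorm z / sb; lra.
Qed.

End parabolic_tests.

Lemma generator_difference (R : realType) (th S1 S2 d1 d2 : R) :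
  th * (- (2^-1 * S1 + d1) - - (2^-1 * S2 + d2)) =
  - (2^-1 * (th * (S1 - S2)) + th * (d1 - d2)).
Proof. by ring. Qed.

(** The contradiction that ends [lip_aux], with its nonlinear terms made opaque. [D] is the
    difference of the two values, [X1] and [X2] the second and first order terms, [X6 = c2 * sb] the
    gain from the reflection, [X7] and [X8] the losses due to the variation of [sigma] and [b], and
    [X3], [X4], [X5] come from the penalty. Altogether [D + X1 / 2 + X2] is at most
    [- 4 M + M / 4 + M / 2], while the first hypothesis makes it nonnegative. *)
Lemma lip_arith (R : realType) (M D X1 X2 X3 X4 X5 X6 X7 X8 X9 X10 : R) :
  - D - (2^-1 * X1 + X2) <= 0 -> X1 <= X9 - 2 * X6 + 4 * X4 ->
  X2 <= X10 + X10 + (X3 + 2 * X5) -> X3 <= M / 4 ->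
  6 * M + 2 * X7 + 8 * X8 <= X6 -> D <= 2 * M -> X9 <= 4 * X7 -> X10 <= 4 * X8 ->
  4 * X4 + 4 * X5 <= M -> 0 < M -> 0 <= X4 -> False.
Proof. by move=> *; lra. Qed.

(** * The gradient estimate for the Cauchy problem *)

Section gradient_estimate.
Context (R : realType) (n d : nat).

Lemma pair_continuous (U V W : topologicalType) (f : U -> V) (g : U -> W) :
  continuous f -> continuous g -> continuous (fun x => (f x, g x)).
Proof. by move=> cf cg x; apply: cvg_pair; [exact: cf|exact: cg]. Qed.

Lemma sqnorm_continuous : continuous (@sqnorm R n).
Proof.
move=> x; apply: (@cvg_sumr _ _ (nbhs x) (nbhs_filter x)) => i.
under eq_fun do rewrite expr2.
by rewrite expr2; apply: cvgM; exact: coord_continuous.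
Qed.

Lemma norm_le_sqnorm (x : 'cV[R]_n) : `|x| ^+ 2 <= sqnorm x.
Proof.
rewrite -(sqr_sqrtr (sqnorm_ge0 x)) lerXn2r ?nnegrE ?sqrtr_ge0//.
apply: mx_norm_le => [|i j]; first exact: sqrtr_ge0.
rewrite (ord1 j) -sqrtr_sqr ler_wsqrtr// /sqnorm (bigD1 i)//= lerDl.
by apply: sumr_ge0 => k _; exact: sqr_ge0.
Qed.

Lemma sqnorm_le_norm (x : 'cV[R]_n) : sqnorm x <= n%:R * `|x| ^+ 2.
Proof.
rewrite /sqnorm (le_trans (ler_sum _ (G := fun=> `|x| ^+ 2) _))//.
  by move=> i _; rewrite -real_normK ?num_real// lerXn2r ?nnegrE// mx_norm_entry.
by rewrite sumr_const card_ord mulr_natl.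
Qed.

Lemma near_line (x p : 'cV[R]_n) rho : `|x| < rho ->
  \forall t \near (0 : R), `|t *: p + x| <= rho.
Proof.
move=> xr; have p1 : 0 < `|p| + 1 by rewrite ltr_wpDl.
apply/nbhs_ballP; exists ((rho - `|x|) / (`|p| + 1)) => /=.
  by rewrite divr_gt0// subr_gt0.
move=> t; rewrite -ball_normE/= sub0r normrN ltr_pdivlMr// => tp.
rewrite (le_trans (ler_normD _ _))// normrZ -lerBrDr (le_trans _ (ltW tp))//.
by rewrite ler_wpM2l// lerDl.
Qed.

Lemma near_sqnorm (z p : 'cV[R]_n) (c : R) : sqnorm z < c ->
  \forall t \near (0 : R), sqnorm (t *: p + z) <= c.
Proof.
move=> zc; have : sqnorm (t *: p + z) @[t --> (0 : R)] --> sqnorm z.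
  have -> : sqnorm z = sqnorm ((0 : R) *: p + z) by rewrite scale0r add0r.
  apply: (@continuous_comp _ _ _ (fun t : R => t *: p + z) (@sqnorm R n) 0).
    by apply: cvgD; [exact: scalel_continuous|exact: cvg_cst].
  exact: sqnorm_continuous.
by move=> /cvgr_lt/(_ _ zc); apply: filterS => t /ltW.
Qed.

(** A solution satisfies the equation for [0 < s] only, so the estimates are proved there and reach
    [s = 0] by continuity. *)
Lemma strip_bottom (tau : R) (g : R -> R) (c : R) : 0 < tau ->
  {within [set s | 0 <= s <= tau], continuous g} ->
  (forall s, 0 < s <= tau -> g s <= c) -> g 0 <= c.
Proof.
move=> tau0 /subspace_continuousP/(_ 0) cg gc; rewrite leNgt; apply/negP => c0.
have e0 : 0 < g 0 - c by rewrite subr_gt0.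
have /cg/cvgrPdist_lt/(_ _ e0) : [set s | 0 <= s <= tau] 0 by rewrite /= lexx ltW.
move=> /nbhs_ballP[r /= r0 Hr].
pose t := Num.min r tau / 2.
have t0 : 0 < t by rewrite divr_gt0// lt_min r0.
have : t < Num.min r tau by rewrite ltr_pdivrMr// ltr_pMr ?ltr1n// lt_min r0.
rewrite lt_min => /andP[tr ttau].
have := Hr t; rewrite -ball_normE/= sub0r normrN gtr0_norm// => /(_ tr).
rewrite (ltW t0) (ltW ttau)/= => /(_ isT); rewrite ltr_norml => /andP[_].
rewrite ltrD2l ltrN2 ltNge => /negP; apply.
by apply: gc; rewrite t0 ltW.
Qed.

Variables (b : R -> 'cV[R]_n -> 'cV[R]_n) (sigma : R -> 'cV[R]_n -> 'M[R]_(n, d)).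
Variables (T B L sb : R).
Hypotheses (B_gt0 : 0 < B) (L_gt0 : 0 < L) (sb_gt0 : 0 < sb).
Hypothesis b_bound : forall s x, 0 <= s <= T -> sqnorm (b s x) <= B.
Hypothesis b_lip : forall s x y, 0 <= s <= T ->
  sqnorm (b s x - b s y) <= L ^+ 2 * sqnorm (x - y).
Hypothesis sigma_bound : forall s x, 0 <= s <= T ->
  \sum_k sqnorm (col k (sigma s x)) <= B.
Hypothesis sigma_lip : forall s x y, 0 <= s <= T ->
  \sum_k sqnorm (col k (sigma s x - sigma s y)) <= L ^+ 2 * sqnorm (x - y).
Hypothesis elliptic : forall s x xi, 0 <= s <= T ->
  sb * sqnorm xi <= sqnorm ((sigma s x)^T *m xi).

Let zero_source : R -> 'cV[R]_n -> R := fun _ _ => 0.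

Lemma closed_strip_continuous tau (v : R -> 'cV[R]_n -> R) (x : 'cV[R]_n) :
  {within closed_strip tau, continuous (fun p => v p.1 p.2)} ->
  {within [set s | 0 <= s <= tau], continuous (v ^~ x)}.
Proof.
move=> cv; apply: (within_comp (phi := fun s => (s, x)) cv) => //.
exact/continuous_subspaceT/pairl_continuous.
Qed.

(** The factor [a] stands for a sign, so that the upper and the lower bound share one proof. *)
Lemma max_principle_aux tau h v (a M : R) : 0 < tau <= T ->
  cauchy_solution b sigma tau zero_source h v -> `|a| <= 1 ->
  (forall x, a * h x <= M) -> forall s x, 0 < s <= tau -> a * v s x <= M.
Proof.
move=> /andP[tau0 tauT] [vC vc [Mv vM] vL vh] a1 hM s1 x1 /andP[s10 s1tau].
rewrite leNgt; apply/negP => eta0.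
have T0 : 0 < T by exact: lt_le_trans tauT.
set eta := a * v s1 x1 - M.
have {}eta0 : 0 < eta by rewrite subr_gt0.
have av s x : 0 <= s <= tau -> a * v s x <= Mv.
  move=> /(vM s x) h1; rewrite (le_trans (ler_norm _))// normrM.
  by rewrite (le_trans _ h1)// ler_piMl.
have Mv0 : 0 <= Mv by rewrite (le_trans _ (vM 0 0 _))// lexx ltW.
pose W := Mv + `|M| + 1.
have W0 : 0 < W by rewrite ltr_wpDl// addr_ge0.
have etaW : eta <= W.
  have := av s1 x1; rewrite (ltW s10) s1tau => /(_ isT).
  by rewrite /eta /W; have := ler_norm (- M); rewrite normrN; lra.
(* At the maximum the equation is to contradict [a * D_t v <= - e]. The second order term is at most
   [del * B]. Young's inequality with parameter [k] splits the drift into [k * del |x|^2], at most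
   [k * W = e / 4], and [del * B / k]. By [del * c2 <= e] the total is at most [e / 2]. The choice
   of [e] keeps the variation of [e s] below [eta / 4]. *)
pose e := eta / (4 * T); have e0 : 0 < e by rewrite divr_gt0// mulr_gt0.
pose k := e / (4 * W); have k0 : 0 < k by rewrite divr_gt0// mulr_gt0.
pose c1 := 4 * (sqnorm x1 + 1); pose c2 := 4 * (B + B / k).
have c10 : 0 < c1 by rewrite mulr_gt0// ltr_wpDl// sqnorm_ge0.
have c20 : 0 < c2 by rewrite mulr_gt0// addr_gt0// divr_gt0.
have [del [del0 del1 del2]] : exists del, [/\ 0 < del, del * c1 <= eta & del * c2 <= e].
  exists (Num.min (eta / c1) (e / c2)); split.
  - by rewrite lt_min; apply/andP; split; exact: divr_gt0.
  - by rewrite -ler_pdivlMr// ge_min lexx.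
  - by rewrite -ler_pdivlMr// ge_min lexx orbT.
pose rho := Num.sqrt (W / del).
have rho2 : rho ^+ 2 = W / del by rewrite sqr_sqrtr// divr_ge0// ltW.
have small (x : 'cV[R]_n) : del * sqnorm x < W -> `|x| < rho.
  move=> xW; rewrite -(@ltr_pXn2r _ 2)// ?nnegrE// ?sqrtr_ge0//.
  by rewrite rho2 (le_lt_trans (norm_le_sqnorm x))// ltr_pdivlMr// mulrC.
have del_x1 : del * sqnorm x1 <= eta / 4.
  by move: del1; rewrite /c1; have := sqnorm_ge0 x1; nra.
(* The penalty [del |x|^2] makes the maximum attained although R^n is not
   compact; the term [e s] makes the inequality at the maximum strict. *)
pose H (p : R * 'cV[R]_n) :=
  (a * v p.1 p.2) + (e * p.1 - del * sqnorm p.2).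
pose K := [set s : R | s \in `[s1, tau]] `*` [set x : 'cV[R]_n | `|x| <= rho].
have K1 : K (s1, x1).
  split => /=; first by rewrite in_itv/= lexx.
  by apply/ltW/small; lra.
have cK : compact K by apply: compact_setX; [exact: segment_compact|exact: compact_cball].
have HK : {within K, continuous H}.
  apply: (@within_continuousD _ _ _ _ (fun p : R * 'cV[R]_n => a * v p.1 p.2)
    (fun p : R * 'cV[R]_n => e * p.1 - del * sqnorm p.2)).
    have vc' : {within K, continuous (fun p => v p.1 p.2)}.
      apply: continuous_subspaceW vc => -[s x] [/=]; rewrite in_itv/= => /andP[ss st] _.
      by rewrite /closed_strip/= st (le_trans (ltW s10)).
    move=> p; apply: (@cvgMr _ _ (nbhs p) (nbhs_filter p) (fun p => v p.1 p.2) a (v p.1 p.2)).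
    exact: vc'.
  apply: continuous_subspaceT => p; apply: cvgB.
    by apply: cvgMr; exact: cvg_fst.
  apply: cvgMr; apply: (cvg_comp snd (@sqnorm R n)); first exact: cvg_snd.
  exact: sqnorm_continuous.
have K0 : K !=set0 by exists (s1, x1).
have [[s x] /set_mem[/=]] := compact_EVT_max K0 cK HK.
rewrite in_itv/= => /andP[s1s stau] xrho Hmax.
have s0 : 0 < s by exact: lt_le_trans s1s.
have Hx : H (s1, x1) <= H (s, x) by apply: Hmax; rewrite inE.
have H1 : M + e * tau + eta / 2 <= H (s1, x1).
  rewrite /H /=.
  have : e * (tau - s1) <= eta / 4.
    rewrite /e (_ : eta / (4 * T) * (tau - s1) = (eta / 4) * ((tau - s1) / T)).
      by rewrite ler_piMr ?divr_ge0 ?(ltW eta0)// ler_pdivrMr// mul1r; lra.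
    by field; rewrite gt_eqF.
  by rewrite /eta in del_x1 *; lra.
have Hpos : M + e * tau < a * v s x + (e * s - del * sqnorm x).
  by move: Hx H1; rewrite {2}/H/=; lra.
have es : e * s <= e * tau by rewrite ler_pM2l.
have dx : del * sqnorm x < W.
  have := av s x; rewrite (ltW s0) stau => /(_ isT).
  by rewrite /W; have := ler_norm (- M); rewrite normrN; lra.
have dx0 : 0 <= del * sqnorm x by rewrite mulr_ge0 ?sqnorm_ge0// ltW.
(* At [s = tau] the terminal data would give a value of [H] at most [M + e * tau], against
   [Hpos]. *)
have {}stau : s < tau.
  rewrite lt_neqAle stau andbT; apply: contraTneq Hpos => ->.
  by rewrite vh -leNgt; have := hM x; rewrite -/(tau); lra.
have sT : 0 <= s <= T by rewrite (ltW s0) (le_trans (ltW stau)).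
have xrho' := small _ dx.
have vs2 : C2 (v s) by apply: C12_C2 vC _; rewrite (ltW s0).
have test p := @single_test _ _ (v s) x p a del vs2.
have {}test p : a * dir1 (v s) x p = 2 * del * dot x p /\
    a * dir2 (v s) x p <= 2 * del * sqnorm p.
  apply: test; apply: filterS (near_line p xrho') => t xt.
  have : H (s, t *: p + x) <= H (s, x).
    by apply: Hmax; rewrite inE; split => //=; rewrite in_itv/= s1s ltW.
  by rewrite /H/=; lra.
have time : a * 'D_1 (v ^~ x) s + e <= 0.
  have dv : derivable (v ^~ x) s 1 by case: vC => _ [+ _] _ _; apply; rewrite s0.
  pose phi (r : R) := a * v r x + e * r.
  have D : is_derive s 1 phi (a * 'D_1 (v ^~ x) s + e).
    have := is_deriveD (is_deriveZ a (derivableP dv)) (is_deriveZ e (is_derive_id s 1)).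
    by rewrite -[e *: 1]/(e * 1) mulr1.
  apply: (right_max D).
  exists (tau - s); first by rewrite subr_gt0.
  move=> u /andP[u0 ut].
  have : H (u + s, x) <= H (s, x).
    by apply: Hmax; rewrite inE; split => //=; rewrite in_itv/=; apply/andP; split; lra.
  by rewrite /H/= /phi; lra.
have := vL s x; rewrite s0 stau => /(_ isT); rewrite /zero_source addr0 parabolic_dir => E.
have E2 : a * 'D_1 (v ^~ x) s + 2^-1 * (\sum_k a * dir2 (v s) x (col k (sigma s x)))
    + a * dir1 (v s) x (b s x) = 0.
  by rewrite -mulr_sumr mulrCA -!mulrDr E mulr0.
have S2 : \sum_k a * dir2 (v s) x (col k (sigma s x)) <= 2 * del * B.
  apply: (@le_trans _ _ (\sum_k 2 * del * sqnorm (col k (sigma s x)))).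
    by apply: ler_sum => i _; exact: (test _).2.
  by rewrite -mulr_sumr ler_wpM2l ?sigma_bound// mulr_ge0// ltW.
have D1 : a * dir1 (v s) x (b s x) <= del * (k * sqnorm x + B / k).
  rewrite (test _).1 (mulrC 2) -mulrA ler_pM2l//.
  have bk : sqnorm (b s x) / k <= B / k by rewrite ler_pM2r ?invr_gt0// b_bound.
  have := dot_AMGM x (b s x) k0; have := ler_norm (dot x (b s x)); move: bk.
  by clear; lra.
have kW : k * (del * sqnorm x) <= e / 4.
  have -> : e / 4 = k * W by rewrite /k; field; rewrite gt_eqF.
  by rewrite ler_wpM2l// ltW.
move: del2; rewrite /c2 => del2.
have : del * (4 * (B + B / k)) = 4 * (del * B) + 4 * (del * (B / k)) by ring.
have : del * (k * sqnorm x + B / k) = k * (del * sqnorm x) + del * (B / k) by ring.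
have : 0 <= del * (B / k) by apply: mulr_ge0; [exact: ltW|apply: divr_ge0; exact: ltW].
rewrite -mulrA in S2; move: time E2 S2 D1 kW del2 e0; clear.
set X := \sum_k _; set Y := a * dir1 _ _ _; set Z := a * derive _ _ _.
set U := del * (B / k); set V := k * (del * _); set V' := del * B.
by move=> *; lra.
Qed.

Lemma max_principle tau h v M : 0 < tau <= T ->
  cauchy_solution b sigma tau zero_source h v ->
  (forall x, `|h x| <= M) -> forall s x, 0 <= s <= tau -> `|v s x| <= M.
Proof.
move=> tauT sv hM.
have H (a : R) : `|a| = 1 -> forall s x, 0 <= s <= tau -> a * v s x <= M.
  move=> a1; have Ha s x : 0 < s <= tau -> a * v s x <= M.
    apply: (max_principle_aux tauT sv) => [|y]; first by rewrite a1.
    by rewrite (le_trans (ler_norm _))// normrM a1 mul1r.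
  move=> s x /andP[]; rewrite le_eqVlt => /predU1P[<- _|s0 st]; last first.
    by apply: Ha; rewrite s0.
  have [tau0 _] := andP tauT; have [_ vc _ _ _] := sv.
  apply: (@strip_bottom tau (fun s => a * v s x)) => //; last by move=> r; exact: Ha.
  have vc' := closed_strip_continuous (x := x) vc.
  move=> p; apply: (@cvgMr _ _ (nbhs p) (nbhs_filter p) (fun p => v p x) a (v p x)).
  exact: vc'.
move=> s x st; rewrite ler_norml -lerN2 opprK.
have := H 1 (normr1 _) s x st; rewrite mul1r => ->.
by have := H (-1) _ s x st; rewrite normrN normr1 mulN1r => ->.
Qed.

(* Doubling of variables: the function [H] below, multiplied by [tau - s] to absorb
   the singularity at [s = tau], would have a positive maximum off the diagonal. *)
Lemma lip_aux tau h v (M l : R) : 0 < tau <= T ->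
  cauchy_solution b sigma tau zero_source h v -> 0 < M ->
  (forall s x, 0 <= s <= tau -> `|v s x| <= M) ->
  0 < l -> l ^+ 2 * (3 + L ^+ 2 * T + 4 * L * T) <= sb ->
  forall s x y, 0 < s <= tau -> sqnorm (x - y) <= l ^+ 2 * (tau - s) ->
  (tau - s) * (v s x - v s y) <=
    4 * M / l * Num.sqrt (tau - s) * Num.sqrt (sqnorm (x - y)).
Proof.
move=> /andP[tau0 tauT] [vC vc _ vL vh] M0 vM l0 lsb s1 x1 y1 /andP[s10 s1tau] xyl.
rewrite leNgt; apply/negP => eta0.
have T0 : 0 < T by exact: lt_le_trans tauT.
have l20 : 0 < l ^+ 2 by rewrite exprn_gt0.
(* The modulus subtracted in [H] is [c1 r - c2 r^2] with [r = |x - y|]. Its curvature [- 2 c2]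
   provides the negative second order term; it is of order [1 / l^2], and the hypothesis on [l]
   makes it outweigh all the others. *)
pose c1 s := 4 * M / l * Num.sqrt (tau - s).
pose c2 := 2 * M / l ^+ 2.
have c10 s : 0 <= c1 s by rewrite mulr_ge0 ?sqrtr_ge0// divr_ge0 ?mulr_ge0// ltW.
have c20 : 0 < c2 by rewrite divr_gt0// mulr_gt0.
set eta := (tau - s1) * (v s1 x1 - v s1 y1)
  - 4 * M / l * Num.sqrt (tau - s1) * Num.sqrt (sqnorm (x1 - y1)).
have {}eta0 : 0 < eta by rewrite subr_gt0.
have Dv s x y : 0 <= s <= tau -> v s x - v s y <= 2 * M.
  move=> st; have := vM s x st; have := vM s y st.
  rewrite !ler_norml => /andP[+ +] /andP[+ +]; clear -b sigma T B L sb => *; lra.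
pose W := 2 * M * T + 1.
have W0 : 0 < W by rewrite addr_gt0// !mulr_gt0.
(* [ka] is the parameter of Young's inequality for the drift, tuned so that its quadratic part costs
   at most [M / 4] where the penalty is below [W]. The bound by [d2] limits the other penalty terms
   to [M / 2], and the bound by [d1] limits the penalty at the starting pair to [eta / 2]. *)
pose ka := M / (4 * W); have ka0 : 0 < ka by rewrite divr_gt0// mulr_gt0.
pose d1 := 2 * (sqnorm x1 + sqnorm y1 + 1); pose d2 := 4 * (B + B / ka).
have d10 : 0 < d1 by rewrite mulr_gt0// ltr_wpDl// addr_ge0 ?sqnorm_ge0.
have d20 : 0 < d2 by rewrite mulr_gt0// addr_gt0// divr_gt0.
have [del [del0 del1 del2]] : exists del, [/\ 0 < del, del * d1 <= eta & del * d2 <= M].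
  exists (Num.min (eta / d1) (M / d2)); split.
  - by rewrite lt_min; apply/andP; split; exact: divr_gt0.
  - by rewrite -ler_pdivlMr// ge_min lexx.
  - by rewrite -ler_pdivlMr// ge_min lexx orbT.
pose rho := Num.sqrt (W / del).
have rho2 : rho ^+ 2 = W / del by rewrite sqr_sqrtr// divr_ge0// ltW.
have small (x y : 'cV[R]_n) : del * (sqnorm x + sqnorm y) < W -> `|x| < rho /\ `|y| < rho.
  have aux (z : 'cV[R]_n) : del * sqnorm z < W -> `|z| < rho.
    move=> xW; rewrite -(@ltr_pXn2r _ 2)// ?nnegrE// ?sqrtr_ge0//.
    by rewrite rho2 (le_lt_trans (norm_le_sqnorm _))// ltr_pdivlMr// mulrC.
  move=> xyW; split; apply: aux; apply: le_lt_trans xyW; rewrite ler_pM2l//.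
    by rewrite lerDl sqnorm_ge0.
  by rewrite lerDr sqnorm_ge0.
pose H s x y := (tau - s) * (v s x - v s y) - c1 s * Num.sqrt (sqnorm (x - y))
  + c2 * sqnorm (x - y) - del * (sqnorm x + sqnorm y).
have pen0 (x y : 'cV[R]_n) : 0 <= del * (sqnorm x + sqnorm y).
  by rewrite mulr_ge0 ?addr_ge0 ?sqnorm_ge0// ltW.
(* [- c1 r + c2 r^2 <= 0] on [r <= l sqrt th], with [<= - 2 M th] at equality *)
have rad (s : R) (x y : 'cV[R]_n) : 0 <= s <= tau -> sqnorm (x - y) <= l ^+ 2 * (tau - s) ->
    Num.sqrt (sqnorm (x - y)) <= l * Num.sqrt (tau - s).
  move=> /andP[s0 st] h1; have := ler_wsqrtr h1.
  by rewrite sqrtrM ?sqr_ge0// sqrtr_sqr gtr0_norm.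
have barrier (s : R) (x y : 'cV[R]_n) : 0 <= s <= tau -> sqnorm (x - y) <= l ^+ 2 * (tau - s) ->
    c2 * sqnorm (x - y) <= c1 s * Num.sqrt (sqnorm (x - y)) / 2.
  move=> st h1; have := rad _ _ _ st h1.
  rewrite -{2}(sqr_sqrtr (sqnorm_ge0 (x - y))); set r := Num.sqrt _ => h2.
  have r0 : 0 <= r by exact: sqrtr_ge0.
  have -> : c1 s * r / 2 = c2 * (r * (l * Num.sqrt (tau - s))).
    by rewrite /c1 /c2; field; rewrite gt_eqF.
  by rewrite ler_pM2l// expr2 ler_wpM2l.
pose K := ([set s : R | s \in `[s1, tau]] `*` ([set x : 'cV[R]_n | `|x| <= rho]
   `*` [set x : 'cV[R]_n | `|x| <= rho])) `&`
   [set q | sqnorm (q.2.1 - q.2.2) - l ^+ 2 * (tau - q.1) <= 0].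
have inK (s : R) (x y : 'cV[R]_n) : s1 <= s <= tau -> `|x| <= rho -> `|y| <= rho ->
    sqnorm (x - y) <= l ^+ 2 * (tau - s) -> K (s, (x, y)).
  by move=> ss xr yr h1; split => //=; rewrite ?in_itv//= subr_le0.
pose HH (q : R * ('cV[R]_n * 'cV[R]_n)) := H q.1 q.2.1 q.2.2.
have sqd (F : R * ('cV[R]_n * 'cV[R]_n) -> 'cV[R]_n) :
    continuous F -> continuous (fun q => sqnorm (F q)).
  by move=> cF q; apply: (continuous_comp (cF q)); exact: sqnorm_continuous.
have c21 : continuous (fun q : R * ('cV[R]_n * 'cV[R]_n) => q.2.1).
  by move=> q; apply: (@continuous_comp _ _ _ snd fst); [exact: cvg_snd|exact: cvg_fst].
have c22 : continuous (fun q : R * ('cV[R]_n * 'cV[R]_n) => q.2.2).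
  by move=> q; apply: (@continuous_comp _ _ _ snd snd); [exact: cvg_snd|exact: cvg_snd].
have cts : continuous (fun q : R * ('cV[R]_n * 'cV[R]_n) => tau - q.1).
  by move=> q; apply: cvgB; [exact: cvg_cst|exact: cvg_fst].
have cxy : continuous (fun q : R * ('cV[R]_n * 'cV[R]_n) => sqnorm (q.2.1 - q.2.2)).
  by apply: sqd => q; apply: cvgB; [exact: c21|exact: c22].
have cK : compact K.
  apply: compact_closedI.
    apply: compact_setX; first exact: segment_compact.
    by apply: compact_setX; exact: compact_cball.
  apply: (@closed_comp _ _ (fun q : R * ('cV[R]_n * 'cV[R]_n) =>
    sqnorm (q.2.1 - q.2.2) - l ^+ 2 * (tau - q.1)) [set x | x <= 0]); last exact: closed_le.
  by move=> q _; apply: cvgB; [exact: cxy|apply: cvgMr; exact: cts].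
have vK (F : R * ('cV[R]_n * 'cV[R]_n) -> 'cV[R]_n) : continuous F ->
    {within K, continuous (fun q => v q.1 (F q))}.
  move=> cF; apply: (within_comp (phi := fun q => (q.1, F q)) vc).
    apply/continuous_subspaceT/pair_continuous; last exact: cF.
    by move=> q; exact: cvg_fst.
  move=> [s [x y]] [[/= + _] _]; rewrite in_itv/= => /andP[ss st].
  by rewrite /closed_strip/= st (le_trans (ltW s10)).
have cH : {within K, continuous HH}.
  move=> q; apply: cvgB; last first.
    apply: (continuous_subspaceT (A := K) (f := fun q : R * ('cV[R]_n * 'cV[R]_n) =>
      del * (sqnorm q.2.1 + sqnorm q.2.2))).
    by move=> {}q; apply: cvgMr; apply: cvgD; [exact: (sqd _ c21)|exact: (sqd _ c22)].
  apply: cvgD; last first.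
    apply: (continuous_subspaceT (A := K) (f := fun q : R * ('cV[R]_n * 'cV[R]_n) =>
      c2 * sqnorm (q.2.1 - q.2.2))).
    by move=> {}q; apply: cvgMr; exact: cxy.
  apply: cvgB; last first.
    apply: (continuous_subspaceT (A := K) (f := fun q : R * ('cV[R]_n * 'cV[R]_n) =>
      c1 q.1 * Num.sqrt (sqnorm (q.2.1 - q.2.2)))).
    move=> {}q; apply: cvgM.
      apply: cvgMr; apply: (continuous_comp (cts q)); exact: sqrt_continuous.
    by apply: (continuous_comp (cxy q)); exact: sqrt_continuous.
  apply: cvgM.
    by apply: (continuous_subspaceT (A := K) (f := fun q : R * ('cV[R]_n * 'cV[R]_n) =>
      tau - q.1)).
  by apply: cvgB; [exact: (vK _ c21)|exact: (vK _ c22)].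
have Hub (s : R) (x y : 'cV[R]_n) : 0 <= s <= tau -> sqnorm (x - y) <= l ^+ 2 * (tau - s) ->
    H s x y <= 2 * M * T - del * (sqnorm x + sqnorm y).
  move=> st h1; have := barrier _ _ _ st h1.
  have : 0 <= c1 s * Num.sqrt (sqnorm (x - y)) by rewrite mulr_ge0 ?sqrtr_ge0.
  have : (tau - s) * (v s x - v s y) <= 2 * M * T.
    apply: (@le_trans _ _ ((tau - s) * (2 * M))).
      by apply: ler_wpM2l; [case/andP: st; lra|exact: Dv].
    rewrite mulrC ler_wpM2l ?mulr_ge0 ?(ltW M0)//.
    by case/andP: st => ss _; rewrite lerBlDr (le_trans tauT)// lerDl.
  by rewrite /H; clear -b sigma T B L sb; lra.
have s1r : 0 <= s1 <= tau by rewrite (ltW s10).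
have H1 : eta / 2 <= H s1 x1 y1.
  have : 0 <= c2 * sqnorm (x1 - y1) by rewrite mulr_ge0 ?sqnorm_ge0// ltW.
  have : del * (sqnorm x1 + sqnorm y1) <= eta / 2.
    by move: del1 del0; rewrite /d1; clear -b sigma T B L sb; lra.
  by rewrite /H /eta -/(c1 s1); clear -b sigma T B L sb; lra.
have [x1r y1r] : `|x1| < rho /\ `|y1| < rho.
  apply: small; have := Hub _ _ _ s1r xyl.
  by rewrite /W; move: H1 eta0; clear -b sigma T B L sb; lra.
have K1 : K (s1, (x1, y1)) by apply: inK => //; rewrite ?lexx ?s1tau// ltW.
have K0 : K !=set0 by exists (s1, (x1, y1)).
have [[s [x y]] /set_mem[[/= + []]]] := compact_EVT_max K0 cK cH.
rewrite in_itv/= subr_le0 => /andP[s1s stau] xrho yrho xyK Hmax.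
have s0 : 0 < s by exact: lt_le_trans s1s.
have sr : 0 <= s <= tau by rewrite ltW.
have Hpos : 0 < H s x y.
  have : HH (s1, (x1, y1)) <= HH (s, (x, y)) by apply: Hmax; rewrite inE.
  by rewrite /HH/=; move: H1 eta0; clear -b sigma T B L sb; lra.
have pen : del * (sqnorm x + sqnorm y) < W.
  by have := Hub _ _ _ sr xyK; rewrite /W; move: Hpos; clear -b sigma T B L sb; lra.
have [xr yr] := small _ _ pen.
have xy : x != y.
  apply: contraTneq Hpos => ->; rewrite -leNgt /H !subrr !mulr0.
  have -> : sqnorm (0 : 'cV[R]_n) = 0 by rewrite sqnorm_dot linear0.
  by rewrite sqrtr0 !mulr0 !subr0 addr0 sub0r oppr_le0.
have z0 : 0 < sqnorm (x - y) by rewrite sqnorm_gt0// subr_eq0.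
(* At [s = tau] the region [K] reduces to the diagonal, so a maximum off the diagonal occurs
   earlier. *)
have th0 : 0 < tau - s.
  by have := lt_le_trans z0 xyK; rewrite pmulr_rgt0.
have stau' : s < tau by rewrite -subr_gt0.
have r0 : 0 < Num.sqrt (sqnorm (x - y)) by rewrite sqrtr_gt0.
have xyK' : sqnorm (x - y) < l ^+ 2 * (tau - s).
  rewrite lt_neqAle xyK andbT; apply: contraTneq Hpos => xyE.
  have cE : c1 s * Num.sqrt (sqnorm (x - y)) = 4 * M * (tau - s).
    rewrite xyE sqrtrM ?sqr_ge0// sqrtr_sqr gtr0_norm// /c1.
    rewrite -[in RHS](sqr_sqrtr (ltW th0)); field.
    by rewrite gt_eqF.
  have c2E : c2 * sqnorm (x - y) = 2 * M * (tau - s).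
    by rewrite xyE /c2; field; rewrite gt_eqF.
  have := ler_wpM2l (ltW th0) (Dv s x y sr); have := pen0 x y.
  by rewrite -leNgt /H cE c2E; lra.
have sT : 0 <= s <= T by rewrite (ltW s0) (le_trans stau).
have vs2 : C2 (v s) by apply: C12_C2 vC _; rewrite (ltW s0).
have test p q := @pair_test _ _ (v s) x y p q (tau - s) (c1 s) c2 del vs2 (c10 s) xy.
have {}test p q : (tau - s) * (dir1 (v s) x p - dir1 (v s) y q) =
    c1 s * dot (x - y) (p - q) / Num.sqrt (sqnorm (x - y))
    - 2 * c2 * dot (x - y) (p - q) + 2 * del * (dot x p + dot y q) /\
  (tau - s) * (dir2 (v s) x p - dir2 (v s) y q) <=
    c1 s * (sqnorm (p - q) / Num.sqrt (sqnorm (x - y))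
            - dot (x - y) (p - q) ^+ 2 / Num.sqrt (sqnorm (x - y)) ^+ 3)
    - 2 * c2 * sqnorm (p - q) + 2 * del * (sqnorm p + sqnorm q).
  apply: test; near=> t.
  have : HH (s, (t *: p + x, t *: q + y)) <= HH (s, (x, y)).
    apply: Hmax; rewrite inE; apply: inK; rewrite ?s1s//.
    - by near: t; exact: near_line.
    - by near: t; exact: near_line.
    - rewrite opprD addrACA -scalerBr.
      by near: t; exact: near_sqnorm.
  by [].
have time : - (v s x - v s y) + (tau - s) * ('D_1 (v ^~ x) s - 'D_1 (v ^~ y) s) <= 0.
  have dv z : derivable (v ^~ z) s 1 by case: vC => _ [+ _] _ _; apply; rewrite s0.
  pose phi (r : R) := (tau - r) * (v r x - v r y).
  have D : is_derive s 1 phi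
      (- (v s x - v s y) + (tau - s) * ('D_1 (v ^~ x) s - 'D_1 (v ^~ y) s)).
    have D1 : is_derive s 1 (fun r : R => tau - r) (- 1).
      by have := is_deriveB (is_derive_cst tau s 1) (is_derive_id s 1); rewrite sub0r.
    have := is_deriveM D1 (is_deriveB (derivableP (dv x)) (derivableP (dv y))).
    by rewrite [X in is_derive _ _ _ X]addrC -[_ *: -1]/(_ * -1) mulrN1.
  apply: (right_max D).
  (* The region narrows as time grows; the strict inequality [xyK'] leaves room to move forward. *)
  exists (tau - s - sqnorm (x - y) / l ^+ 2).
    by rewrite subr_gt0 ltr_pdivrMr// mulrC.
  move=> u /andP[u0 ut].
  have ul : sqnorm (x - y) <= l ^+ 2 * (tau - (u + s)).
    rewrite mulrC -ler_pdivrMr//; move: ut; set X := _ / _; lra.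
  have us : u + s <= tau.
    by have := le_trans (sqnorm_ge0 _) ul; rewrite pmulr_rge0// subr_ge0.
  have : HH (u + s, (x, y)) <= HH (s, (x, y)).
    by apply: Hmax; rewrite inE; apply: inK => //; rewrite us (le_trans s1s)// lerDr ltW.
  rewrite /HH/= /H !lerD2r /phi.
  (* [c1] is nonincreasing in time, so the change of the term [- c1 r] has the favourable sign and
     is dropped. *)
  rewrite lerBlDr => /le_trans; apply; rewrite -addrA gerDl addrC subr_le0.
  rewrite ler_wpM2r ?sqrtr_ge0// ler_wpM2l ?divr_ge0 ?mulr_ge0 ?(ltW M0) ?(ltW l0)//.
  by rewrite ler_wsqrtr// lerD2l lerN2 lerDr ltW.
have z0' : x - y != 0 by rewrite subr_eq0.
have [w [Sw N0 wN]] := elliptic_preimage sb_gt0 (fun xi => elliptic y xi sT) z0'.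
set r := Num.sqrt (sqnorm (x - y)) in test r0.
have rr : sqnorm (x - y) = r ^+ 2 by rewrite sqr_sqrtr// ltW.
rewrite rr in wN xyK z0.
(* Reflection coupling: [Q Q^T] is unchanged, but [col k (sigma s x) - col k Q]
   has a component along [x - y], on which the concave modulus of [H] gains. *)
pose Q := sigma s y - (2 / sqnorm w) *: ((x - y) *m w^T).
have QQ : Q *m Q^T = sigma s y *m (sigma s y)^T.
  by apply: reflect_gram => //; rewrite gt_eqF.
pose D k := col k (sigma s x - sigma s y).
pose lam k := 2 / sqnorm w * w k 0.
have zeta k : col k (sigma s x) - col k Q = lam k *: (x - y) + D k.
  apply/matrixP => i j; rewrite !mxE big_ord1 !mxE (ord1 j) /lam.
  by rewrite [ord0]ord1; ring.
have sumlam : \sum_k lam k ^+ 2 = 4 / sqnorm w.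
  have -> : \sum_k lam k ^+ 2 = (2 / sqnorm w) ^+ 2 * sqnorm w.
    by rewrite /sqnorm mulr_sumr; apply: eq_bigr => k _; rewrite exprMn.
  by field; rewrite gt_eqF.
have sqD : \sum_k sqnorm (D k) <= L ^+ 2 * r ^+ 2 by rewrite -rr sigma_lip.
have second : (tau - s) * (\sum_k dir2 (v s) x (col k (sigma s x))
      - \sum_k dir2 (v s) y (col k Q))
    <= c1 s * (L ^+ 2 * r) - 2 * c2 * sb + 2 * del * (2 * B).
  have SB : \sum_k (sqnorm (col k (sigma s x)) + sqnorm (col k Q)) <= 2 * B.
    rewrite big_split/= (_ : \sum_i sqnorm (col i Q) = \sum_i sqnorm (col i (sigma s y))).
      have := sigma_bound y sT; have := sigma_bound x sT; set X := \sum_i _; set Y := \sum_i _.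
      by rewrite mulr_natl mulr2n => ? ?; exact: lerD.
    by rewrite !sqnorm_gram QQ.
  (* Summation of [|lam z + D|^2 >= lam^2 |z|^2 / 2 - |D|^2]: the reflected part contributes
     [2 r^2 / |w|^2 >= 2 sb], and the error [L^2 r^2] is at most [sb] because [r^2 <= l^2 T]. *)
  have Ssb : sb <= \sum_k sqnorm (col k (sigma s x) - col k Q).
    apply: (@le_trans _ _ (\sum_k (lam k ^+ 2 * (r ^+ 2 / 2) - sqnorm (D k)))).
      rewrite big_split/= sumrN -mulr_suml sumlam.
      have h1 : 4 / sqnorm w * (r ^+ 2 / 2) = 2 * (r ^+ 2 / sqnorm w).
        by field; rewrite gt_eqF.
      have h2 : sb <= r ^+ 2 / sqnorm w by rewrite ler_pdivlMr.
      have h3 : L ^+ 2 * r ^+ 2 <= sb.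
        apply: le_trans lsb; rewrite mulrC.
        apply: (@le_trans _ _ (l ^+ 2 * T * L ^+ 2)).
          rewrite ler_wpM2r ?sqr_ge0// (le_trans xyK)// ler_pM2l// lerBlDr.
          by rewrite (le_trans tauT)// lerDl ltW.
        rewrite -mulrA ler_pM2l// mulrC [3 + _]addrC -addrA lerDl.
        by rewrite addr_ge0// mulr_ge0 ?mulr_ge0// ltW.
      by rewrite h1; lra.
    apply: ler_sum => k _; rewrite zeta sqnorm_line rr.
    have := sqnorm_ge0 ((lam k / 2) *: (x - y) + D k).
    rewrite sqnorm_line rr; set X := dot _ _; set Y := sqnorm _; set Z := lam k.
    have -> : Y + 2 * (Z / 2) * X + (Z / 2) ^+ 2 * r ^+ 2 =
      (Y + Z * X + Z ^+ 2 * r ^+ 2 / 4) by field.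
    move=> hh; rewrite -subr_ge0.
    rewrite (_ : _ - _ = 2 * (Y + Z * X + Z ^+ 2 * r ^+ 2 / 4)); first by rewrite mulr_ge0.
    by field.
  (* In the Hessian of the norm the component [lam k *: (x - y)] cancels, which leaves at most
     [|D k|^2 / r], of order [r] after summation. *)
  apply: (@le_trans _ _ (\sum_k (c1 s * (sqnorm (D k) / r)
      - 2 * c2 * sqnorm (col k (sigma s x) - col k Q)
      + 2 * del * (sqnorm (col k (sigma s x)) + sqnorm (col k Q))))).
    rewrite -sumrB mulr_sumr; apply: ler_sum => k _.
    apply: le_trans (test _ _).2 _; rewrite !lerD2r ler_wpM2l//.
    have dE : dot (x - y) (lam k *: (x - y) + D k) = lam k * r ^+ 2 + dot (D k) (x - y).
      by rewrite dotC dotDl dotZl -sqnorm_dot rr.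
    rewrite zeta dE sqnorm_line rr.
    set X := dot _ _; set Y := sqnorm _; set Z := lam k.
    have -> : (Y + 2 * Z * X + Z ^+ 2 * r ^+ 2) / r - (Z * r ^+ 2 + X) ^+ 2 / r ^+ 3 =
      Y / r - X ^+ 2 / r ^+ 3 by field; rewrite gt_eqF.
    by rewrite gerBl divr_ge0 ?sqr_ge0// exprn_ge0// ltW.
  rewrite !big_split/= sumrN -!mulr_sumr -mulr_suml.
  apply: lerD; [apply: lerB|].
  - rewrite ler_wpM2l// ler_pdivrMr// (le_trans sqD)// le_eqVlt; apply/orP; left; apply/eqP; ring.
  - by rewrite ler_wpM2l// mulr_ge0// ltW.
  - by rewrite ler_wpM2l// mulr_ge0// ltW.
have := vL s y; rewrite s0 stau' => /(_ isT); rewrite /zero_source addr0 parabolic_dir.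
rewrite dir2_gram -QQ -dir2_gram => Ey.
have := vL s x; rewrite s0 stau' => /(_ isT); rewrite /zero_source addr0 parabolic_dir => Ex.
have [first _] := test (b s x) (b s y).
have kap : `|dot (x - y) (b s x - b s y)| <= L * r ^+ 2.
  have := dot_AMGM (x - y) (b s x - b s y) L_gt0; rewrite rr.
  have : sqnorm (b s x - b s y) / L <= L * r ^+ 2.
    by rewrite ler_pdivrMr// mulrAC -expr2 -rr b_lip.
  move=> h1 h2; rewrite -(@ler_pM2l _ 2)// (le_trans h2)//.
  by rewrite mulr_natl mulr2n lerD2l.
have bar : c2 * r ^+ 2 <= c1 s * r / 2.
  by rewrite -rr; exact: barrier sr (ltW xyK').
have c1r : c1 s * r <= 4 * M * T.
  have -> : 4 * M * T = 4 * M / l * (l * T) by field; rewrite gt_eqF.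
  rewrite /c1 -mulrA ler_wpM2l ?divr_ge0 ?mulr_ge0 ?(ltW M0) ?(ltW l0)//.
  have h1 : r <= l * Num.sqrt (tau - s) := rad s x y sr (ltW xyK').
  apply: (@le_trans _ _ (Num.sqrt (tau - s) * (l * Num.sqrt (tau - s)))).
    by rewrite ler_wpM2l ?sqrtr_ge0.
  rewrite mulrCA -expr2 sqr_sqrtr ?(ltW th0)// ler_pM2l// lerBlDr.
  by rewrite (le_trans tauT)// lerDl ltW.
have first' : (tau - s) * (dir1 (v s) x (b s x) - dir1 (v s) y (b s y)) <=
    c1 s * r * L + c1 s * r * L + del * (ka * (sqnorm x + sqnorm y) + 2 * (B / ka)).
  rewrite first -!addrA; apply: lerD.
    rewrite -mulrA -[leRHS]mulrA ler_wpM2l// ler_pdivrMr// -mulrA mulrCA.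
    by rewrite -expr2 (le_trans (ler_norm _) kap).
  apply: lerD.
    have k1 : - dot (x - y) (b s x - b s y) <= L * r ^+ 2.
      by rewrite (le_trans _ kap)// -normrN ler_norm.
    rewrite -mulrN; apply: (@le_trans _ _ (2 * c2 * (L * r ^+ 2))).
      by rewrite ler_wpM2l// mulr_ge0// ltW.
    have -> : 2 * c2 * (L * r ^+ 2) = 2 * (c2 * r ^+ 2) * L by ring.
    by rewrite ler_pM2r// mulrC -ler_pdivlMr.
  rewrite (mulrC 2 del) -mulrA ler_pM2l//.
  have aux z : 2 * dot z (b s z) <= ka * sqnorm z + B / ka.
    apply: le_trans (ler_wpM2l _ (ler_norm _)) _ => //.
    apply: le_trans (dot_AMGM _ _ ka0) _; rewrite lerD2l ler_pM2r ?invr_gt0//.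
    exact: b_bound.
  have -> : ka * (sqnorm x + sqnorm y) + 2 * (B / ka) =
    (ka * sqnorm x + B / ka) + (ka * sqnorm y + B / ka) by ring.
  by rewrite mulrDr; apply: lerD; exact: aux.
have penk : del * (ka * (sqnorm x + sqnorm y)) <= M / 4.
  have -> : M / 4 = ka * W by rewrite /ka; field; rewrite gt_eqF.
  by rewrite mulrCA ler_pM2l// ltW.
have csb : 2 * M * (3 + L ^+ 2 * T + 4 * L * T) <= c2 * sb.
  rewrite /c2 -[leRHS]mulrA ler_pM2l ?mulr_gt0//.
  by rewrite [leRHS]mulrC ler_pdivlMr// mulrC.
have Dvs := Dv s x y sr.
have c1L : c1 s * (L ^+ 2 * r) <= 4 * M * T * L ^+ 2.
  by rewrite mulrCA mulrC ler_wpM2r ?sqr_ge0.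
have c1L' : c1 s * r * L <= 4 * M * T * L by rewrite ler_pM2r.
have E : (tau - s) * ('D_1 (v ^~ x) s - 'D_1 (v ^~ y) s) =
   - (2^-1 * ((tau - s) * (\sum_k dir2 (v s) x (col k (sigma s x))
      - \sum_k dir2 (v s) y (col k Q)))
   + (tau - s) * (dir1 (v s) x (b s x) - dir1 (v s) y (b s y))).
  have -> : 'D_1 (v ^~ x) s = - (2^-1 * \sum_k dir2 (v s) x (col k (sigma s x))
    + dir1 (v s) x (b s x)) by apply/eqP; rewrite -addr_eq0 addrA Ex.
  have -> : 'D_1 (v ^~ y) s = - (2^-1 * \sum_k dir2 (v s) y (col k Q)
    + dir1 (v s) y (b s y)) by apply/eqP; rewrite -addr_eq0 addrA Ey.
  exact: generator_difference.
rewrite E in time.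
have e1 : del * (ka * (sqnorm x + sqnorm y) + 2 * (B / ka)) =
  del * (ka * (sqnorm x + sqnorm y)) + 2 * (del * (B / ka)) by ring.
have e2 : del * d2 = 4 * (del * B) + 4 * (del * (B / ka)) by rewrite /d2; ring.
have e3 : 2 * del * (2 * B) = 4 * (del * B) by ring.
have e4 : 2 * M * (3 + L ^+ 2 * T + 4 * L * T) =
  6 * M + 2 * (M * T * L ^+ 2) + 8 * (M * T * L) by ring.
have e5 : 4 * M * T * L ^+ 2 = 4 * (M * T * L ^+ 2) by ring.
have e6 : 4 * M * T * L = 4 * (M * T * L) by ring.
have e7 : 2 * c2 * sb = 2 * (c2 * sb) by ring.
rewrite e1 in first'; rewrite e2 in del2; rewrite e3 e7 in second.
rewrite e4 in csb; rewrite e5 in c1L; rewrite e6 in c1L'.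
have e8 := mulr_ge0 (ltW del0) (ltW B_gt0).
exact: (lip_arith time second first' penk csb Dvs c1L c1L' del2 M0 e8).
Unshelve. all: by end_near.
Qed.

(** Pairs within [l sqrt (tau - s)] of each other are covered by [lip_aux], divided by
    [sqrt (tau - s)]; for distant pairs the trivial bound [2 M] already has the required form. *)
Lemma lipschitz_estimate : 0 < T -> exists2 K : R, 0 < K &
  forall tau h v M, 0 < tau <= T -> cauchy_solution b sigma tau zero_source h v ->
  (forall x, `|h x| <= M) -> forall s x y, 0 <= s < tau ->
  `|v s x - v s y| <= K * M * `|x - y| / Num.sqrt (tau - s).
Proof.
move=> T0; pose D := 3 + L ^+ 2 * T + 4 * L * T.
have D0 : 0 < D by rewrite !addr_gt0// ?mulr_gt0// exprn_gt0.
pose l := Num.sqrt (sb / D).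
have l0 : 0 < l by rewrite sqrtr_gt0 divr_gt0.
have lD : l ^+ 2 * D <= sb 
  by rewrite sqr_sqrtr ?divr_ge0 ?(ltW sb_gt0) ?(ltW D0)// divfK ?lexx// gt_eqF.
(* [lip_aux] measures distances by the Euclidean norm and the statement by the maximum norm, whence
   the root of [n]; adding 1 keeps [K] positive even for [n = 0]. *)
pose K := 4 / l * (Num.sqrt n%:R + 1).
have K0 : 0 < K by rewrite mulr_gt0 ?divr_gt0// ltr_wpDl ?sqrtr_ge0.
exists K => // tau h v M tauT sv hM.
have vM := max_principle tauT sv hM.
have [tau0 tT] := andP tauT.
have M0 : 0 <= M by rewrite (le_trans _ (hM 0)).
have root (z : 'cV[R]_n) : Num.sqrt (sqnorm z) <= (Num.sqrt n%:R + 1) * `|z|.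
  apply: (@le_trans _ _ (Num.sqrt n%:R * `|z|)); last by rewrite ler_wpM2r// lerDl.
  have zE : `|z| = Num.sqrt (`|z| ^+ 2) by rewrite sqrtr_sqr normr_id.
  by rewrite zE -sqrtrM// ler_wsqrtr// sqnorm_le_norm.
have pos (s : R) (x y : 'cV[R]_n) : 0 < s <= tau ->
    (v s x - v s y) * Num.sqrt (tau - s) <= K * M * `|x - y|.
  move=> /andP[s0 st]; have th0 : 0 <= tau - s by rewrite subr_ge0.
  have sr : 0 <= s <= tau by rewrite ltW.
  move: M0; rewrite le_eqVlt => /predU1P[M0|M0].
    have v0 z : v s z = 0 by apply/eqP; rewrite -normr_le0 M0 vM.
    by rewrite !v0 subrr mul0r -M0 mulr0 mul0r.
  apply: (@le_trans _ _ (4 * M / l * Num.sqrt (sqnorm (x - y)))); last first.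
    rewrite /K (_ : 4 / l * _ * M * _ = 4 * M / l * ((Num.sqrt n%:R + 1) * `|x - y|)).
      by rewrite ler_wpM2l// divr_ge0// ?mulr_ge0// ltW.
    by ring.
  have [near|far] := leP (sqnorm (x - y)) (l ^+ 2 * (tau - s)).
    have := lip_aux tauT sv M0 vM l0 lD (s := s) (x := x) (y := y).
    rewrite s0 st => /(_ isT near).
    move: th0; rewrite le_eqVlt => /predU1P[<- _|th0].
      by rewrite sqrtr0 mulr0 mulr_ge0 ?sqrtr_ge0// divr_ge0 ?mulr_ge0// ltW.
    have q0 : 0 < Num.sqrt (tau - s) by rewrite sqrtr_gt0.
    rewrite -{1}(sqr_sqrtr (ltW th0)) -(ler_pM2l q0 (_ * Num.sqrt (tau - s))).
    by congr (_ <= _); ring.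
  have Dv : v s x - v s y <= 2 * M.
    rewrite mulr_natl mulr2n; apply: lerD; first exact: le_trans (ler_norm _) (vM _ _ sr).
    by rewrite (le_trans (ler_norm _))// normrN vM.
  apply: (@le_trans _ _ (2 * M * Num.sqrt (tau - s))); first by rewrite ler_wpM2r ?sqrtr_ge0.
  have : l * Num.sqrt (tau - s) <= Num.sqrt (sqnorm (x - y)).
    by have := ler_wsqrtr (ltW far); rewrite sqrtrM ?sqr_ge0// sqrtr_sqr gtr0_norm.
  rewrite -ler_pdivlMl// => h1.
  apply: (@le_trans _ _ (2 * M * (l^-1 * Num.sqrt (sqnorm (x - y))))).
    by rewrite ler_pM2l// mulr_gt0.
  rewrite mulrA ler_wpM2r ?sqrtr_ge0// ler_pM2r ?invr_gt0// ler_pM2r// ler_nat.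
  by [].
have all (s : R) (x y : 'cV[R]_n) : 0 <= s <= tau ->
    (v s x - v s y) * Num.sqrt (tau - s) <= K * M * `|x - y|.
  move=> /andP[]; rewrite le_eqVlt => /predU1P[<- _|s0 st]; last by apply: pos; rewrite s0.
  have [_ vc _ _ _] := sv.
  apply: (@strip_bottom tau (fun s => (v s x - v s y) * Num.sqrt (tau - s))) => //.
    have vc' z := closed_strip_continuous (x := z) vc.
    move=> p; apply: cvgM; first by apply: cvgB; exact: vc'.
    apply: (continuous_subspaceT (f := fun r : R => Num.sqrt (tau - r))) => {}p.
    apply: (@continuous_comp _ _ _ (fun r : R => tau - r)); last exact: sqrt_continuous.
    by apply: cvgB; [exact: cvg_cst|exact: cvg_id].
  by move=> r; exact: pos.
move=> s x y /andP[s0 st].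
have sr : 0 <= s <= tau by rewrite s0 ltW.
rewrite ler_pdivlMr ?sqrtr_gt0 ?subr_gt0// -[X in _ * X]ger0_norm ?sqrtr_ge0//.
rewrite -normrM ler_norml all// andbT lerNl -mulNr opprB distrC.
exact: all.
Qed.

End gradient_estimate.

(** * Lipschitz constants from bounded derivatives *)

Section Cb_lipschitz.
Context (R : realType).

(* A bounded derivative along the image of a linear map [iota] makes [f]
   Lipschitz along that image; coordinates of the target are treated by the mean
   value theorem. *)
Lemma Cb_bounded k (V W : normedModType R) (D : set V) (f : V -> W) :
  Cb k D f -> exists2 M : R, 0 < M & forall x, D x -> `|f x| <= M.
Proof.
case: k => [|k] [_ [M HM] _]; exists (`|M| + 1); rewrite ?ltr_wpDl// => x Dx;
  by rewrite (le_trans (HM x Dx))// (le_trans (ler_norm M))// lerDl.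
Qed.

Lemma Cb_continuous k (V W : normedModType R) (D : set V) (f : V -> W) :
  Cb k D f -> {within D, continuous f}.
Proof. by case: k => [|k] []. Qed.

Lemma Cb_lipschitz (V : normedModType R) (a b p q : nat) (D : set V)
    (f : V -> 'M[R]_(p, q)) (iota : {linear 'M[R]_(a, b) -> V}) :
  Cb 1 D f -> exists2 C : R, 0 < C &
  forall x A, (forall t : R, 0 <= t <= 1 -> D (x + t *: iota A)) ->
    `|f (x + iota A) - f x| <= C * `|A|.
Proof.
move=> [_ _ [df [dfE dfC]]].
(* [Cb] bounds the derivative one direction at a time. Bounds in the finitely many directions
   [iota (delta_mx i j)] add up to one on the whole image of [iota]. *)
have /choice[M HM] : forall ij : 'I_a * 'I_b, exists M : R,
    0 < M /\ forall x, D x -> `|df x (iota (delta_mx ij.1 ij.2))| <= M.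
  move=> ij; have [M M0 H] := @Cb_bounded 0 _ _ _ _ (dfC (iota (delta_mx ij.1 ij.2))).
  by exists M.
pose C := \sum_ij M ij + 1.
have C0 : 0 < C by rewrite ltr_wpDl// sumr_ge0// => ij _; rewrite ltW// (HM ij).1.
have dfb x A : D x -> `|df x (iota A)| <= C * `|A|.
  move=> Dx; rewrite [A in iota A]matrix_sum_delta pair_big/= !linear_sum/=.
  rewrite (le_trans (ler_norm_sum _ _ _))//.
  apply: (@le_trans _ _ (\sum_ij M ij * `|A|)); last first.
    by rewrite -mulr_suml ler_wpM2r// lerDl.
  apply: ler_sum => ij _; rewrite !linearZ/= normrZ mulrC.
  by rewrite ler_pM// ?mx_norm_entry// (HM ij).2.
exists C => // x A DA.
apply: mx_norm_le => [|i j]; first by rewrite mulr_ge0// ltW.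
rewrite !mxE.
pose y (t : R) := x + t *: iota A.
have yD t s : y t - y s = (t - s) *: iota A.
  by rewrite /y opprD addrACA subrr add0r scalerBl.
pose phi (t : R) : R := f (y t) i j.
(* The derivative is relative to [D], so along the segment the expansion holds within [[0, 1]]:
   two-sided at interior points, and one-sided at the ends, where it still gives the continuity that
   the mean value theorem asks for. *)
have nearphi (t : R) : 0 <= t <= 1 -> forall e : R, 0 < e ->
    \forall s \near t, 0 <= s <= 1 ->
      `|phi s - phi t - (s - t) * (df (y t) (iota A)) i j| <= e * `|s - t|.
  move=> t01 e e0.
  have A1 : 0 < `|iota A| + 1 by rewrite ltr_wpDl.
  have e1 : 0 < e / (`|iota A| + 1) by rewrite divr_gt0.
  have := dfE (y t) (DA t t01) _ e1.
  rewrite /within/= => /nbhs_ballP[r /= r0 Hr].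
  apply/nbhs_ballP; exists (r / (`|iota A| + 1)) => /=; first by rewrite divr_gt0.
  move=> s; rewrite -ball_normE/= ltr_pdivlMr// => ts s01.
  have := Hr (y s); rewrite -ball_normE/= yD normrZ => H.
  have {}H : `|f (y s) - f (y t) - df (y t) (y s - y t)| <=
      e / (`|iota A| + 1) * `|y s - y t|.
    apply: H; last exact: DA.
    by rewrite (le_lt_trans _ ts)// ler_wpM2l// lerDl.
  have := le_trans (mx_norm_entry _ i j) H.
  rewrite yD linearZ/= !mxE => /le_trans; apply.
  rewrite normrZ (_ : _ / _ * (_ * _) = e * `|s - t| * (`|iota A| / (`|iota A| + 1))).
    by rewrite ler_piMr ?mulr_ge0 ?(ltW e0)// ler_pdivrMr// mul1r lerDl.
  by ring.
have dphi (t : R) : t \in `]0, 1[%R -> is_derive t 1 phi ((df (y t) (iota A)) i j).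
  rewrite in_itv/= => /andP[t0 t1]; set d := (df _ _) i j.
  have : (fun h : R => h^-1 *: ((phi \o shift t) (h *: 1) - phi t)) @ 0^' --> d.
    apply/cvgrPdist_le => e e0.
    have t01 : 0 <= t <= 1 by rewrite !ltW.
    have /nbhs_ballP[r /= r0 Hr] := nearphi t t01 e e0.
    apply/nbhs_ballP; exists (Num.min r (Num.min t (1 - t))) => /=.
      by rewrite !lt_min r0 t0 subr_gt0.
    move=> h; rewrite -ball_normE/= sub0r normrN !lt_min => /and3P[hr ht h1] h0.
    have := Hr (h + t); rewrite -ball_normE/= opprD addrCA subrr addr0 normrN addrK.
    move=> /(_ hr); move: ht h1; rewrite !ltr_norml => /andP[? ?] /andP[? ?].
    have -> : 0 <= h + t <= 1 by apply/andP; split; lra.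
    move=> /(_ isT) Hh; rewrite [h *: 1]mulr1.
    have hn : 0 < `|h| by rewrite normr_gt0.
    rewrite distrC -(ler_pM2r hn) -normrM; apply: le_trans Hh.
    rewrite -[_ *: (_ - _)]/(_ * (_ - _)) mulrBl mulrAC mulVf// mul1r.
    by rewrite /d (mulrC h).
  move=> H; split; first by apply/cvg_ex; exists d.
  exact: cvg_lim.
have cphi : {within `[0, 1], continuous phi}.
  apply/subspace_continuousP => t; rewrite /= in_itv/= => t01.
  apply/cvgrPdist_le => e e0.
  set d := (df (y t) (iota A)) i j.
  have d1 : 0 < `|d| + 1 by rewrite ltr_wpDl.
  have /nbhs_ballP[r /= r0 Hr] := nearphi t t01 1 ltr01.
  apply/nbhs_ballP; exists (Num.min r (e / (`|d| + 1))) => /=.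
    by rewrite lt_min r0 divr_gt0.
  move=> s; rewrite -ball_normE/= lt_min => /andP[sr se] s01.
  have := Hr s; rewrite -ball_normE/= => /(_ sr).
  rewrite in_itv/= in s01; move=> /(_ s01); rewrite mul1r => H.
  have -> : phi t - phi s = - (phi s - phi t - (s - t) * d) - (s - t) * d by ring.
  rewrite (le_trans (ler_normB _ _))// normrN.
  rewrite (le_trans (lerD H (lexx _)))// normrM -{1}[`|s - t|]mulr1 -mulrDr [1 + _]addrC.
  by rewrite distrC -ler_pdivlMr// ltW.
have [c c01] := MVT (@ltr01 R) dphi cphi.
rewrite subr0 mulr1 /phi /y scale1r scale0r addr0 => ->.
have c01' : 0 <= c <= 1 by move: c01; rewrite in_itv/= => /andP[? ?]; rewrite !ltW.
by rewrite (le_trans (mx_norm_entry _ _ _))// dfb//; exact: DA.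
Qed.

End Cb_lipschitz.

(** * Borel maps into finite products *)

Section borel.
Context (R : realType).

(* Measurability of maps into a finite product of spaces with a countable base:
   the library only has Borel sigma-algebras on R and products of those. *)
Definition borel_fun d (X : measurableType d) (V : topologicalType) (phi : X -> V) :=
  forall O, open O -> measurable (phi @^-1` O).

Definition base_of (V : topologicalType) (I : countType) (B : I -> set V) :=
  (forall i, open (B i)) /\
  forall O x, open O -> O x -> exists i, B i x /\ B i `<=` O.

Lemma borel_base d (X : measurableType d) (V : topologicalType) (I : countType)
    (B : I -> set V) (phi : X -> V) :
  base_of B -> (forall i, measurable (phi @^-1` B i)) -> borel_fun phi.
Proof.
move=> [oB bB] mB O oO.
have -> : phi @^-1` O = \bigcup_i (if `[< B i `<=` O >] then phi @^-1` B i else set0).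
  apply/seteqP; split => x /=.
    move=> Ox; have [i [Bi BO]] := bB O _ oO Ox.
    by exists i => //; rewrite asboolT.
  by move=> [i _]; case: asboolP => // BO; exact: BO.
apply: countable_bigcupT_measurable => // i.
by case: ifP.
Qed.

Definition real_base (p : rat * rat) : set R := `]ratr p.1, ratr p.2[%classic.

Lemma real_baseP : base_of real_base.
Proof.
split=> [p|O x oO Ox]; first exact: interval_open.
have /nbhs_ballP[e /= e0 He] : nbhs x O by exact: open_nbhs_nbhs.
have xl : x - e < x by rewrite ltrBlDr ltrDl.
have xr : x < x + e by rewrite ltrDl.
have [q1 /[!in_itv]/= /andP[q1l q1r]] := rat_in_itvoo xl.
have [q2 /[!in_itv]/= /andP[q2l q2r]] := rat_in_itvoo xr.
exists (q1, q2); split; first by rewrite /real_base/= in_itv/= q1r.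
move=> y; rewrite /real_base/= in_itv/= => /andP[y1 y2]; apply: He.
rewrite -ball_normE/= ltr_distlC; apply/andP; split; first exact: lt_trans y1.
exact: lt_trans q2r.
Qed.

Definition pair_base (V W : topologicalType) (I J : countType) (B : I -> set V)
  (C : J -> set W) (k : I * J) := B k.1 `*` C k.2.

Lemma pair_baseP (V W : topologicalType) (I J : countType) (B : I -> set V)
    (C : J -> set W) : base_of B -> base_of C -> base_of (pair_base B C).
Proof.
move=> [oB bB] [oC bC]; split=> [[i j]|O [x y] oO Oxy].
  apply: (@openI _ (fst @^-1` B i) (snd @^-1` C j)).
    by apply: open_comp => // p _; exact: cvg_fst.
  by apply: open_comp => // p _; exact: cvg_snd.
have [[/= P Q] [Px Qy] PQ] : nbhs (x, y) O by exact: open_nbhs_nbhs.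
have [i [Bi BP]] := bB P^° x (@open_interior _ _) Px.
have [j [Cj CQ]] := bC Q^° y (@open_interior _ _) Qy.
exists (i, j); split => //= -[u w] [/= Bu Cw].
by apply: PQ; split => /=; apply: interior_subset; [exact: BP|exact: CQ].
Qed.

Definition mx_base (m n : nat) (k : {ffun 'I_m * 'I_n -> rat * rat}) : set 'M[R]_(m, n) :=
  [set A | forall i j, real_base (k (i, j)) (A i j)].

Lemma mx_baseP m n : base_of (@mx_base m n).
Proof.
split=> [k|O A oO OA].
  rewrite openE => A kA; exists (fun i j => real_base (k (i, j))) => //.
  by move=> i j; apply: open_nbhs_nbhs; split; [exact: real_baseP.1|exact: kA].
have [P PA PO] : nbhs A O by exact: open_nbhs_nbhs.
have /choice[k Hk] : forall ij : 'I_m * 'I_n, exists p : rat * rat,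
    real_base p (A ij.1 ij.2) /\ real_base p `<=` P ij.1 ij.2.
  move=> [i j] /=.
  have [p [pA pP]] := real_baseP.2 (P i j)^° (A i j) (@open_interior _ _) (PA i j).
  by exists p; split => //; exact: subset_trans (@interior_subset _ _).
exists [ffun ij => k ij]; split => [i j|M kM]; first by rewrite ffunE; exact: (Hk (i, j)).1.
apply: PO => i j; apply: (Hk (i, j)).2.
by have := kM i j; rewrite ffunE.
Qed.

Lemma borel_real d (X : measurableType d) (phi : X -> R) :
  measurable_fun setT phi -> borel_fun phi.
Proof.
by move=> mphi O oO; rewrite -[X in measurable X]setTI; apply: mphi => //; exact: open_measurable.
Qed.

Lemma borel_mx d (X : measurableType d) m n (phi : X -> 'M[R]_(m, n)) :
  (forall i j, measurable_fun setT (fun x => phi x i j)) -> borel_fun phi.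
Proof.
move=> mphi; apply: borel_base (@mx_baseP m n) _ => k.
have -> : phi @^-1` mx_base k = \bigcap_(ij in [set: 'I_m * 'I_n])
    ((fun x => phi x ij.1 ij.2) @^-1` real_base (k ij)).
  by apply/seteqP; split => x /= H; [move=> [i j] _; exact: H|move=> i j; exact: (H (i, j))].
apply: fin_bigcap_measurable => // ij _.
by apply: borel_real; [exact: mphi|exact: real_baseP.1].
Qed.

Lemma borel_pair d (X : measurableType d) (V W : topologicalType) (I J : countType)
    (B : I -> set V) (C : J -> set W) (phi : X -> V) (psi : X -> W) :
  base_of B -> base_of C -> borel_fun phi -> borel_fun psi ->
  borel_fun (fun x => (phi x, psi x)).
Proof.
move=> bB bC mphi mpsi; apply: borel_base (pair_baseP bB bC) _ => k.
have -> : (fun x => (phi x, psi x)) @^-1` pair_base B C k =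
  phi @^-1` B k.1 `&` psi @^-1` C k.2 by [].
by apply: measurableI; [apply: mphi; exact: bB.1|apply: mpsi; exact: bC.1].
Qed.

(** For [f] continuous on [D], the part of [D] where [f > c] is the trace of an open set of [V], and
    [phi] pulls that open set back to a measurable one. *)
Lemma borel_comp d (X : measurableType d) (V : topologicalType) (D : set V)
    (f : V -> R) (phi : X -> V) :
  {within D, continuous f} -> borel_fun phi -> measurable (phi @^-1` D) ->
  measurable_fun (phi @^-1` D) (fun x => f (phi x)).
Proof.
move=> cf mphi mD; move=> mD0; apply: (measurability _ (RGenOInfty.measurableE R)) => // {mD0}.
move=> _ [_ [c ->] <-].
have oc : @open (subspace D) (f @^-1` [set x | c < x]).
  by apply: open_comp; [move=> x _; exact: cf|exact: open_gt].
have [U oU UE] := (open_subspaceP _ _).1 oc.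
rewrite (_ : _ `&` _ = phi @^-1` U `&` phi @^-1` D).
  by apply: measurableI => //; exact: mphi.
rewrite -preimage_setI UE; apply/seteqP; split => x /=; rewrite in_itv/= andbT => -[] //.
Qed.

End borel.

Lemma comp_continuous (U V W : topologicalType) (f : U -> V) (g : V -> W) :
  continuous f -> continuous g -> continuous (fun x => g (f x)).
Proof. by move=> cf cg x; apply: (continuous_comp (cf x)); exact: cg. Qed.

Lemma continuous_sub (R : realType) (U : topologicalType) (f g : U -> R) :
  continuous f -> continuous g -> continuous (fun x => f x - g x).
Proof. by move=> cf cg x; apply: cvgB; [exact: cf|exact: cg]. Qed.

Lemma continuous_mul (R : realType) (U : topologicalType) (f g : U -> R) :
  continuous f -> continuous g -> continuous (fun x => f x * g x).
Proof. by move=> cf cg x; apply: cvgM; [exact: cf|exact: cg]. Qed.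

Lemma lipschitz_continuous (R : realType) (V : normedModType R) (f : V -> R) (C : R) :
  (forall x y, `|f x - f y| <= C * `|x - y|) -> continuous f.
Proof.
move=> fC x; apply/cvgrPdist_le => e e0.
have C0 : 0 < `|C| + 1 by rewrite ltr_wpDl.
apply/nbhs_ballP; exists (e / (`|C| + 1)) => /=; first by rewrite divr_gt0.
move=> y; rewrite -ball_normE/= ltr_pdivlMr// mulrC => xy.
apply: le_trans (fC x y) _; apply: le_trans (ltW xy); rewrite ler_wpM2r//.
by rewrite (le_trans (ler_norm C))// lerDl.
Qed.

Lemma cvg_dnbhs_harmonic (R : realType) (f : R -> R) (l : R) :
  f @ 0^' --> l -> f k.+1%:R^-1 @[k --> \oo] --> l.
Proof.
move=> fl; apply/cvgrPdist_lt => e e0.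
move: fl => /cvgrPdist_lt/(_ e e0)/nbhs_ballP[r /= r0 Hr].
have /cvgrPdist_lt/(_ r r0) := @cvg_harmonic R; apply: filterS => k kr.
by apply: Hr; [rewrite -ball_normE|rewrite invr_eq0 pnatr_eq0].
Qed.

(** * L^1 bounds by duality and limits under the integral *)

Section duality.
Context d (X : measurableType d) (R : realType) (mu : {measure set X -> \bar R}).

Lemma cvg_squeeze_harmonic (u : nat -> R) (l : R) :
  (forall k, `|u k - l| <= k.+1%:R^-1) -> u @ \oo --> l.
Proof.
move=> ul; apply/cvgrPdist_le => e e0.
have := @cvg_harmonic R => /cvgrPdist_le/(_ e e0); apply: filterS => k.
rewrite sub0r normrN ger0_norm ?harmonic_ge0// => h; rewrite distrC.
exact: le_trans (ul k) h.
Qed.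

Lemma Rintegral_fineK (D : set X) (g : X -> R) : measurable D ->
  mu.-integrable D (EFin \o g) ->
  (\int[mu]_(x in D) g x)%:E = (\int[mu]_(x in D) (g x)%:E)%E.
Proof. by move=> mD ig; rewrite fineK//; exact: integrable_fin_num. Qed.

Lemma Rintegral0 (D : set X) : \int[mu]_(x in D) (0 : R) = 0.
Proof. by rewrite /Rintegral integral0. Qed.

Lemma Rdominated_convergence (D : set X) (f_ : nat -> X -> R) (f g : X -> R) :
  measurable D -> (forall k, measurable_fun D (f_ k)) ->
  (forall x, D x -> f_ ^~ x @ \oo --> f x) -> mu.-integrable D (EFin \o g) ->
  (forall k x, D x -> `|f_ k x| <= g x) ->
  mu.-integrable D (EFin \o f) /\
  \int[mu]_(x in D) f_ k x @[k --> \oo] --> \int[mu]_(x in D) f x.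
Proof.
move=> mD mf_ ff ig fg.
have mf : measurable_fun D f by exact: measurable_fun_cvg mf_ ff.
have mef k : measurable_fun D (fun x => (f_ k x)%:E) by exact/measurable_EFinP.
have mEf : measurable_fun D (fun x => (f x)%:E) by exact/measurable_EFinP.
have ae1 : {ae mu, forall x, D x -> (f_ k x)%:E @[k --> \oo] --> (f x)%:E}.
  by apply: aeW => x Dx; apply: cvg_EFin; [exact: nearW|exact: ff].
have ae2 : {ae mu, forall x k, D x -> (`|(f_ k x)%:E| <= (g x)%:E)%E}.
  by apply: aeW => x k Dx; rewrite lee_fin; exact: fg.
have [] := dominated_convergence mD mef mEf ae1 ig ae2.
move=> if_ _ H; split=> //; apply: fine_cvg; rewrite -/(Rintegral _ _ _).
by rewrite (Rintegral_fineK mD if_).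
Qed.

(* [g / (|g| + eps)] is an admissible continuous substitute for the sign of [g]. *)
Lemma L1_duality (g : X -> R) (c : R) : mu.-integrable setT (EFin \o g) ->
  (forall k : nat, \int[mu]_x (g x * (g x / (`|g x| + k.+1%:R^-1))) <= c) ->
  (\int[mu]_x `|g x|%:E <= c%:E)%E.
Proof.
move=> ig gc; have mg : measurable_fun setT g by apply/measurable_EFinP; exact: (measurable_int mu ig).
pose f k x := g x * (g x / (`|g x| + k.+1%:R^-1)).
have den (k : nat) x : 0 < `|g x| + k.+1%:R^-1 by rewrite ltr_wpDl.
have fg k x : `|f k x| <= `|g x|.
  rewrite /f normrM ler_piMr// normrM normfV (ger0_norm (ltW (den _ _))).
  by rewrite ler_pdivrMr// mul1r lerDl.
have mf k : measurable_fun setT (f k).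
  have ch : continuous (fun t : R => t * (t / (`|t| + k.+1%:R^-1))).
    move=> t; apply: cvgM; first exact: cvg_id.
    apply: cvgM; first exact: cvg_id.
    apply: cvgV; first by rewrite gt_eqF// ltr_wpDl.
    by apply: cvgD; [exact: norm_continuous|exact: cvg_cst].
  exact: (measurableT_comp (continuous_measurable_fun ch) mg).
have ign : mu.-integrable setT (fun x => `|g x|%:E).
  by apply: eq_integrable (integrable_abse ig).
have [|ig' H] := @Rdominated_convergence setT f (fun x => `|g x|) (fun x => `|g x|)
    measurableT mf _ ign (fun k x _ => fg k x).
  move=> x _; apply: cvg_squeeze_harmonic => k.
  rewrite /f mulrA -expr2 -real_normK ?num_real//; set a := `|g x|.
  have a0 : 0 <= a by exact: normr_ge0.
  have e0 : 0 < k.+1%:R^-1 :> R by rewrite invr_gt0.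
  have -> : a ^+ 2 / (a + k.+1%:R^-1) - a = - (k.+1%:R^-1 * (a / (a + k.+1%:R^-1))).
    by move: e0; set e := _^-1 => e0; field; rewrite gt_eqF// ltr_wpDl.
  rewrite normrN ger0_norm; last by rewrite mulr_ge0 ?divr_ge0 ?addr_ge0// ltW.
  by rewrite ler_piMr ?(ltW e0)// ler_pdivrMr ?ltr_wpDl// mul1r lerDl ltW.
rewrite -(Rintegral_fineK measurableT ign) lee_fin.
by apply: (cvgr_to_le H); apply: nearW => k; exact: gc.
Qed.

(** Meant for difference quotients: a uniform L^1 bound on them passes to the derivative of the
    kernel. *)
Lemma fatou_L1 (q : nat -> X -> R) (g : X -> R) (c : R) :
  (forall k, measurable_fun setT (q k)) ->
  (forall x, q ^~ x @ \oo --> g x) ->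
  (forall k, \int[mu]_x `|q k x|%:E <= c%:E)%E ->
  measurable_fun setT g /\ (\int[mu]_x `|g x|%:E <= c%:E)%E.
Proof.
move=> mq qg qc.
have mg : measurable_fun setT g by apply: (measurable_fun_cvg mq) => x _; exact: qg.
split=> //.
have maq k : measurable_fun setT (fun x => `|q k x|%:E).
  by apply/measurable_EFinP; apply: measurableT_comp.
have maq' k : measurable_fun setT (fun x => (`|q k x|)%:E) by [].
have := @fatou _ _ _ mu _ measurableT _ maq' (fun k x _ => normr_ge0 (q k x)).
have -> : (fun x => limn_einf (fun k => (`|q k x|)%:E)) = (fun x => (`|g x|)%:E).
  apply/funext => x; apply: (cvg_limn_einf_sup _).1.
  by apply: cvg_EFin; [exact: nearW|apply: cvg_norm; exact: qg].
move=> /le_trans; apply; rewrite limn_einf_lim.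
apply: lime_le; first exact: is_cvg_einfs.
apply: nearW => k; apply: le_trans (qc k).
by apply: ereal_inf_lbound; exists k => /=.
Qed.

Lemma integrable_bounded (g h : X -> R) (c : R) :
  mu.-integrable setT (EFin \o g) -> measurable_fun setT h ->
  (forall x, `|h x| <= c) -> mu.-integrable setT (EFin \o (fun x => g x * h x)).
Proof.
move=> ig mh hc; have mg : measurable_fun setT g.
  by apply/measurable_EFinP; exact: (measurable_int mu ig).
have igc : mu.-integrable setT (fun x => (c * g x)%:E).
  by under eq_fun do rewrite EFinM; exact: integrableZl.
apply: le_integrable igc => //.
  by apply/measurable_EFinP; exact: measurable_funM.
move=> x _; rewrite /= lee_fin normrM mulrC normrM ler_wpM2r//.
by rewrite (le_trans (hc x))// ler_norm.
Qed.

Lemma integrable_sub (D : set X) (f g : X -> R) : measurable D ->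
  mu.-integrable D (EFin \o f) -> mu.-integrable D (EFin \o g) ->
  mu.-integrable D (EFin \o (fun x => f x - g x)).
Proof.
move=> mD fi gi; have := integrableB mD fi gi; exact: eq_integrable.
Qed.

Lemma integrable_scale (D : set X) (a : R) (f : X -> R) : measurable D ->
  mu.-integrable D (EFin \o f) -> mu.-integrable D (EFin \o (fun x => a * f x)).
Proof.
move=> mD fi; have := integrableZl mD a fi; exact: eq_integrable.
Qed.

Lemma L1_integrable (g : X -> R) (c : R) : measurable_fun setT g ->
  (\int[mu]_x `|g x|%:E <= c%:E)%E -> mu.-integrable setT (EFin \o g).
Proof.
move=> mg gc; apply/integrableP; split; first exact/measurable_EFinP.
by apply: le_lt_trans (ltry c); apply: le_trans gc; rewrite le_eqVlt eqxx.
Qed.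

Lemma RintegralM_le (g h : X -> R) (c e : R) :
  measurable_fun setT g -> (\int[mu]_x `|g x|%:E <= c%:E)%E ->
  mu.-integrable setT (EFin \o (fun x => g x * h x)) ->
  (forall x, `|h x| <= e) -> `|\int[mu]_x (g x * h x)| <= c * e.
Proof.
move=> mg gc igh he.
have ig := L1_integrable mg gc.
have iag : mu.-integrable setT (EFin \o (fun x => `|g x|)) := integrable_abse ig.
apply: le_trans (le_normr_Rintegral measurableT igh) _.
have iagh : mu.-integrable setT (EFin \o (fun x => `|g x * h x|)) := integrable_abse igh.
have iage : mu.-integrable setT (EFin \o (fun x => `|g x| * e)).
  by apply: (@integrable_bounded _ (fun=> e) `|e|) => //.
apply: (@le_trans _ _ (\int[mu]_x (`|g x| * e))).
  by apply: le_Rintegral => // x _; rewrite normrM ler_wpM2l.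
rewrite RintegralZr// ler_wpM2r//.
  by apply: le_trans (he point).
by rewrite -lee_fin Rintegral_fineK.
Qed.

End duality.

(** * Bounds for the fundamental solution *)

(** The interface between the Cauchy problem and the kernel: all bounds on [G] are derived from
    these two, both proportional to the size of the terminal data. *)
Definition gradient_estimate (R : realType) (n d : nat)
    (b : R -> 'cV[R]_n -> 'cV[R]_n) (sigma : R -> 'cV[R]_n -> 'M[R]_(n, d)) (T K : R) :=
  forall tau h v M, 0 < tau <= T ->
  cauchy_solution b sigma tau (fun _ _ => 0) h v -> (forall x, `|h x| <= M) ->
  (forall s x, 0 <= s <= tau -> `|v s x| <= M) /\
  forall s x y, 0 <= s < tau -> `|v s x - v s y| <= K * M * `|x - y| / Num.sqrt (tau - s).

Section kernel_bounds.
Context (R : realType) (n d : nat).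
Variables (b : R -> 'cV[R]_n -> 'cV[R]_n) (sigma : R -> 'cV[R]_n -> 'M[R]_(n, d)).
Variables (T K : R) (G : R -> 'cV[R]_n -> R -> 'cV[R]_n -> R).
Hypothesis K_gt0 : 0 < K.
Hypothesis fund : fundamental_solution b sigma T G.
Hypothesis estimate : gradient_estimate b sigma T K.

Local Notation E := (Rtuple R n).
Local Notation lambda := (lebesgueN R n).

Lemma tcol_borel : borel_fun (@tcol R n).
Proof.
apply: borel_mx => i j.
have -> : (fun y : E => tcol y i j) = (fun y : E => tnth y i).
  by apply/funext => y; rewrite mxE.
exact: measurable_tnth.
Qed.

Lemma measurable_tcol (h : 'cV[R]_n -> R) : continuous h ->
  measurable_fun setT (fun y : E => h (tcol y)).
Proof.
move=> ch; rewrite -(preimage_setT (@tcol R n)).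
apply: borel_comp; first exact: continuous_subspaceT.
  exact: tcol_borel.
by rewrite preimage_setT.
Qed.

Lemma G_continuous s x tau : 0 <= s < tau -> tau <= T -> continuous (G s x tau).
Proof.
move=> st tT; have [cG _ _ _ _] := fund.
apply: (within_comp_continuous (phi := fun eta => (s, x, tau, eta)) cG) => //.
exact: pairr_continuous.
Qed.

Lemma G_integrable s x tau : 0 <= s < tau -> tau <= T ->
  lambda.-integrable setT (EFin \o (fun y => G s x tau (tcol y))).
Proof. by move=> st tT; have [_ _ iG _ _] := fund; exact: iG. Qed.

Lemma zero_source_data tau : @source_data R n tau (fun _ _ => 0).
Proof.
split.
- by apply: continuous_subspaceT => p; exact: cvg_cst.
- by exists 0 => s x _; rewrite normr0.
- exists 1, 0; rewrite ltr01 lexx; split => // s x y _.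
  by rewrite subrr normr0 mul0r.
Qed.

Lemma solution_represents tau h v s x : 0 < tau <= T -> terminal_data h ->
  cauchy_solution b sigma tau (fun _ _ => 0) h v -> 0 <= s < tau ->
  v s x = \int[lambda]_y (G s x tau (tcol y) * h (tcol y)).
Proof.
move=> tauT th sv st; have [_ _ _ _ rep] := fund.
have [_ ->//] := rep tau _ h tauT (zero_source_data tau) th.
rewrite [X in _ + X](_ : _ = 0) ?addr0//.
under eq_Rintegral => r _.
  under eq_Rintegral do rewrite mulr0.
  rewrite Rintegral0.
  over.
by rewrite Rintegral0.
Qed.

Lemma G_represents tau h : 0 < tau <= T -> terminal_data h ->
  exists2 v, cauchy_solution b sigma tau (fun _ _ => 0) h v &
    forall s x, 0 <= s < tau -> v s x = \int[lambda]_y (G s x tau (tcol y) * h (tcol y)).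
Proof.
move=> tauT th; have [_ _ _ _ rep] := fund.
have [[v sv] _] := rep tau _ h tauT (zero_source_data tau) th.
by exists v => // s x; exact: solution_represents.
Qed.

Lemma sign_data (F : 'cV[R]_n -> R) (k : nat) : continuous F ->
  let h := fun eta => F eta / (`|F eta| + k.+1%:R^-1) in
  terminal_data h /\ forall x, `|h x| <= 1.
Proof.
move=> cF h.
have den x : 0 < `|F x| + k.+1%:R^-1 by rewrite ltr_wpDl.
have h1 x : `|h x| <= 1.
  rewrite /h normrM normfV (ger0_norm (ltW (den _))) ler_pdivrMr// mul1r.
  by rewrite lerDl.
split=> //; split; last by exists 1.
have cphi : continuous (fun t : R => t / (`|t| + k.+1%:R^-1)).
  move=> t; apply: cvgM; first exact: cvg_id.
  apply: cvgV; first by rewrite gt_eqF// ltr_wpDl.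
  by apply: cvgD; [exact: norm_continuous|exact: cvg_cst].
exact: (comp_continuous cF cphi).
Qed.

(** Paired with data close to its sign, the kernel gives the value at [(s, x)] of a solution with
    terminal data at most 1, which the maximum principle bounds by 1. *)
Lemma kernel_L1 s x tau : 0 <= s < tau -> tau <= T ->
  (\int[lambda]_y `|G s x tau (tcol y)|%:E <= 1%:E)%E.
Proof.
move=> st tT; apply: L1_duality; first exact: G_integrable.
move=> k; have [th h1] := sign_data k (G_continuous (x := x) st tT).
have tauT : 0 < tau <= T by case/andP: st => s0 /(le_lt_trans s0) ->.
have [v sv vE] := G_represents tauT th.
have [vM _] := estimate tauT sv h1.
apply: (@le_trans _ _ (v s x)); first by rewrite vE.
apply: le_trans (ler_norm _) _; apply: vM.
by case/andP: st => -> /ltW.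
Qed.

(** The same duality for the difference of two kernels: its pairing with [h] is [v s x - v s y], to
    which the gradient estimate applies with [M = 1]. *)
Lemma kernel_lipschitz s x y tau : 0 <= s < tau -> tau <= T ->
  (\int[lambda]_z `|G s x tau (tcol z) - G s y tau (tcol z)|%:E <=
   (K * `|x - y| / Num.sqrt (tau - s))%:E)%E.
Proof.
move=> st tT.
have ix := G_integrable x st tT; have iy := G_integrable y st tT.
pose F eta := G s x tau eta - G s y tau eta.
have cF : continuous F.
  exact: (continuous_sub (G_continuous (x := x) st tT) (G_continuous (x := y) st tT)).
have iF : lambda.-integrable setT (EFin \o (fun z => F (tcol z))).
  have := integrableB measurableT ix iy.
  by apply: eq_integrable.
apply: (L1_duality iF) => k.
have [th h1] := sign_data k cF.
set h := fun eta => F eta / (`|F eta| + k.+1%:R^-1) in th h1.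
have tauT : 0 < tau <= T by case/andP: st => s0 /(le_lt_trans s0) ->.
have [v sv vE] := G_represents tauT th.
have [_ vl] := estimate tauT sv h1.
have mh : measurable_fun setT (fun z => h (tcol z)) by apply: measurable_tcol; exact: th.1.
have ixh := integrable_bounded ix mh (fun z => h1 (tcol z)).
have iyh := integrable_bounded iy mh (fun z => h1 (tcol z)).
have -> : \int[lambda]_z (F (tcol z) * (F (tcol z) / (`|F (tcol z)| + k.+1%:R^-1))) =
    v s x - v s y.
  rewrite !vE// -RintegralB//; apply: eq_Rintegral => z _.
  by rewrite -mulrBl.
rewrite -[K]mulr1; apply: le_trans (ler_norm _) _.
exact: vl.
Qed.

Lemma G_C12 tau eta : 0 < tau <= T -> C12 tau (fun s x => G s x tau eta).
Proof. by move=> tauT; have [_ /(_ tau eta tauT)[]] := fund. Qed.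

(** The difference quotients of step [1 / (k + 1)] satisfy the bound by [kernel_lipschitz], and
    Fatou's lemma transmits it to their limit. *)
Lemma kernel_grad s x tau j : 0 <= s < tau -> tau <= T ->
  let g := fun y => 'D_(unitv R j) (fun z => G s z tau (tcol y)) x in
  measurable_fun setT g /\
  (\int[lambda]_y `|g y|%:E <= (K / Num.sqrt (tau - s))%:E)%E.
Proof.
move=> st tT g.
have tauT : 0 < tau <= T by case/andP: st => s0 /(le_lt_trans s0) ->.
pose q k y := k.+1%:R *
  (G s (k.+1%:R^-1 *: unitv R j + x) tau (tcol y) - G s x tau (tcol y)).
apply: (@fatou_L1 _ _ _ _ q).
- move=> k; apply: measurable_funM => //; apply: measurable_funB;
    by apply: measurable_tcol; exact: G_continuous.
- move=> y; have [+ _ _ _] := C12_C2 (G_C12 (tcol y) tauT) st.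
  move=> /(_ x j) D.
  have : (fun h : R => h^-1 *: (((fun z => G s z tau (tcol y)) \o shift x) (h *: unitv R j)
      - G s x tau (tcol y))) @ 0^' --> g y by exact: D.
  move=> /cvg_dnbhs_harmonic; apply: cvg_trans; apply: near_eq_cvg.
  by apply: nearW => k; rewrite /q /= invrK.
- move=> k.
  have mq : measurable_fun setT (fun y : E => `|G s (k.+1%:R^-1 *: unitv R j + x) tau (tcol y)
      - G s x tau (tcol y)|%:E).
    apply/measurable_EFinP; apply: measurableT_comp => //; apply: measurable_funB;
      by apply: measurable_tcol; exact: G_continuous.
  have -> : (\int[lambda]_y `|q k y|%:E = k.+1%:R%:E * \int[lambda]_y
      `|G s (k.+1%:R^-1 *: unitv R j + x) tau (tcol y) - G s x tau (tcol y)|%:E)%E.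
    rewrite -ge0_integralZl_EFin//; apply: eq_integral => y _.
    by rewrite /q normrM ger0_norm.
  apply: (@le_trans _ _ (k.+1%:R%:E * (K * `|k.+1%:R^-1 *: unitv R j + x - x|
      / Num.sqrt (tau - s))%:E)%E).
    by rewrite lee_pmul2l// kernel_lipschitz.
  rewrite -EFinM lee_fin addrK normrZ normfV [`|k.+1%:R|]ger0_norm//.
  rewrite [leLHS](_ : _ = K / Num.sqrt (tau - s) * `|unitv R j|).
    rewrite ler_piMr ?divr_ge0 ?sqrtr_ge0 ?(ltW K_gt0)//.
    apply: mx_norm_le => // i1 i2; rewrite mxE.
    by case: (_ && _); rewrite ?normr1 ?normr0.
  have : k.+1%:R != 0 :> R by rewrite pnatr_eq0.
  by move: (k.+1%:R) (Num.sqrt _)^-1 => N a N0; field.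
Qed.

End kernel_bounds.

(** * Action of the kernel on bounded Borel functions *)

Section smoothing.
Context (R : realType) (n d : nat).
Variables (b : R -> 'cV[R]_n -> 'cV[R]_n) (sigma : R -> 'cV[R]_n -> 'M[R]_(n, d)).
Variables (T K : R) (G : R -> 'cV[R]_n -> R -> 'cV[R]_n -> R).
Hypothesis K_gt0 : 0 < K.
Hypothesis fund : fundamental_solution b sigma T G.
Hypothesis estimate : gradient_estimate b sigma T K.

Local Notation E := (Rtuple R n).
Local Notation lambda := (lebesgueN R n).

Definition act (s tau : R) (x : 'cV[R]_n) (F : E -> R) : R :=
  \int[lambda]_y (G s x tau (tcol y) * F y).

Definition bounded_measurable (M : R) (F : E -> R) :=
  measurable_fun setT F /\ forall y, `|F y| <= M.

Lemma act_integrable s tau x M F : 0 <= s < tau -> tau <= T -> bounded_measurable M F ->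
  lambda.-integrable setT (EFin \o (fun y => G s x tau (tcol y) * F y)).
Proof.
by move=> st tT [mF FM]; apply: integrable_bounded mF FM; exact: (G_integrable fund).
Qed.

Lemma act_bound s tau x M F : 0 <= s < tau -> tau <= T -> bounded_measurable M F ->
  `|act s tau x F| <= M.
Proof.
move=> st tT bF; rewrite -[leRHS]mul1r; apply: RintegralM_le.
- by apply: measurable_tcol; exact: (G_continuous fund).
- exact: (kernel_L1 fund estimate).
- exact: act_integrable bF.
- exact: bF.2.
Qed.

Lemma act_lipschitz s tau x y M F : 0 <= s < tau -> tau <= T -> bounded_measurable M F ->
  `|act s tau x F - act s tau y F| <= K * `|x - y| / Num.sqrt (tau - s) * M.
Proof.
move=> st tT bF.
have ix := act_integrable x st tT bF; have iy := act_integrable y st tT bF.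
have -> : act s tau x F - act s tau y F =
    \int[lambda]_z ((G s x tau (tcol z) - G s y tau (tcol z)) * F z).
  rewrite /act -RintegralB//; apply: eq_Rintegral => z _.
  by rewrite mulrBl.
apply: RintegralM_le.
- by apply: measurable_funB; apply: measurable_tcol; exact: (G_continuous fund).
- exact: (kernel_lipschitz fund estimate).
- have := integrable_sub measurableT ix iy; apply: eq_integrable => // z _.
  by rewrite /= mulrBl.
- exact: bF.2.
Qed.

Lemma act_continuous s tau M F : 0 <= s < tau -> tau <= T -> bounded_measurable M F ->
  continuous (fun x => act s tau x F).
Proof.
move=> st tT bF.
apply: (lipschitz_continuous (C := K / Num.sqrt (tau - s) * M)) => x y.
apply: le_trans (act_lipschitz x y st tT bF) _.
by rewrite le_eqVlt; apply/orP; left; apply/eqP; ring.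
Qed.

Lemma act_measurable s tau M F : 0 <= s < tau -> tau <= T -> bounded_measurable M F ->
  bounded_measurable M (fun z => act s tau (tcol z) F).
Proof.
move=> st tT bF; split; last by move=> z; exact: act_bound.
exact: (measurable_tcol (act_continuous st tT bF)).
Qed.

Lemma actD s tau x a M F M' F' : 0 <= s < tau -> tau <= T ->
  bounded_measurable M F -> bounded_measurable M' F' ->
  act s tau x (fun y => a * F y + F' y) = a * act s tau x F + act s tau x F'.
Proof.
move=> st tT bF bF'; have i1 := act_integrable x st tT bF.
have i2 := act_integrable x st tT bF'.
rewrite /act -RintegralZl// -RintegralD//; last first.
  exact: integrable_scale.
by apply: eq_Rintegral => y _; rewrite mulrDr mulrCA.
Qed.

Lemma act_cvg s tau x M (F_ : nat -> E -> R) F : 0 <= s < tau -> tau <= T ->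
  (forall k, bounded_measurable M (F_ k)) -> (forall y, F_ ^~ y @ \oo --> F y) ->
  act s tau x (F_ k) @[k --> \oo] --> act s tau x F.
Proof.
move=> st tT bF FF; apply: (@Rdominated_convergence _ _ _ _ _ _ _
    (fun y => `|G s x tau (tcol y)| * M) measurableT _ _ _ _).2.
- by move=> k; apply/measurable_EFinP; exact: (measurable_int _ (act_integrable x st tT (bF k))).
- by move=> y _; apply: cvgMr; exact: FF.
- apply: (@integrable_bounded _ _ _ _ _ (fun=> M) `|M|) => //.
  exact: integrable_abse (G_integrable fund x st tT).
- by move=> k y _; rewrite normrM ler_wpM2l// (bF k).2.
Qed.

Definition chapman_kolmogorov s r tau x F :=
  act s tau x F = act s r x (fun z => act r tau (tcol z) F).

Lemma cauchy_solution_restrict r tau h v : 0 < r <= tau ->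
  cauchy_solution b sigma tau (fun _ _ => 0) h v ->
  cauchy_solution b sigma r (fun _ _ => 0) (v r) v.
Proof.
move=> /andP[r0 rt] [[c0 c1 c2 c3] vc [M vM] vL vh].
have str (s a : R) : a <= s < r -> a <= s < tau.
  by move=> /andP[-> /lt_le_trans]; exact.
have sto (s : R) : 0 < s < r -> 0 < s < tau.
  by move=> /andP[-> /lt_le_trans]; exact.
have stc (s : R) : 0 <= s <= r -> 0 <= s <= tau.
  by move=> /andP[-> /le_trans]; exact.
have sub1 : strip r `<=` strip (n := n) tau by move=> p; exact: str.
have sub2 : open_strip r `<=` open_strip (n := n) tau by move=> p; exact: sto.
have sub3 : closed_strip r `<=` closed_strip (n := n) tau by move=> p; exact: stc.
split.
- split; first exact: continuous_subspaceW c0.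
  + split; last exact: continuous_subspaceW c1.2.
    by move=> s x /sto; exact: c1.1.
  + move=> i; split; last exact: continuous_subspaceW (c2 i).2.
    by move=> s x /str; exact: (c2 i).1.
  + move=> i j; split; last exact: continuous_subspaceW (c3 i j).2.
    by move=> s x /str; exact: (c3 i j).1.
- exact: continuous_subspaceW vc.
- by exists M => s x /stc; exact: vM.
- by move=> s x /sto; exact: vL.
- by [].
Qed.

Lemma solution_terminal_data r tau h v : 0 <= r <= tau ->
  cauchy_solution b sigma tau (fun _ _ => 0) h v -> terminal_data (v r).
Proof.
move=> rt [_ vc [M vM] _ _]; split; last by exists M => x; exact: vM.
apply: (within_comp_continuous (phi := fun x => (r, x)) vc) => //.
exact: pairr_continuous.
Qed.

Lemma terminal_cst (c : R) : @terminal_data R n (fun=> c).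
Proof. by split; [exact: cst_continuous|exists `|c|]. Qed.

(** The solution with data [h] at time [tau], restricted to [[0, r]], solves the problem with data
    [v r] at time [r]. The two sides represent its value at [(s, x)] from the data at [tau] and from
    those at [r]. *)
Lemma chapman_kolmogorov_continuous s r tau x h : 0 <= s < r -> r < tau -> tau <= T ->
  terminal_data h -> chapman_kolmogorov s r tau x (fun y => h (tcol y)).
Proof.
move=> /andP[s0 sr] rt tT th.
have r0 : 0 < r by exact: le_lt_trans sr.
have tauT : 0 < tau <= T by rewrite (lt_trans r0).
have [v sv vE] := G_represents fund tauT th.
have tv := solution_terminal_data (r := r) _ sv.
have {}tv : terminal_data (v r) by apply: tv; rewrite !ltW.
have rT : 0 < r <= T by rewrite r0 (le_trans (ltW rt)).
have sr' : cauchy_solution b sigma r (fun _ _ => 0) (v r) v.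
  by apply: cauchy_solution_restrict sv; rewrite r0 ltW.
rewrite /chapman_kolmogorov /act -vE; last by rewrite s0 (lt_trans sr).
under [RHS]eq_Rintegral => z _ do rewrite -vE ?(ltW r0)//.
by apply: (solution_represents fund) => //; rewrite s0.
Qed.

(** Dominated convergence in the inner and in the outer integral; the uniform bound [M] passes
    through the inner one because the kernel has mass at most 1. *)
Lemma chapman_kolmogorov_cvg s r tau x M (F_ : nat -> E -> R) F :
  0 <= s < r -> r < tau -> tau <= T ->
  (forall k, bounded_measurable M (F_ k)) -> (forall y, F_ ^~ y @ \oo --> F y) ->
  (forall k, chapman_kolmogorov s r tau x (F_ k)) -> chapman_kolmogorov s r tau x F.
Proof.
move=> sr rt tT bF FF ckF; have [s0 sr'] := andP sr.
have st : 0 <= s < tau by rewrite s0 (lt_trans sr').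
have rt' : 0 <= r < tau by rewrite (le_trans s0 (ltW sr')).
have rT : r <= T by rewrite (le_trans (ltW rt)).
have c1 := act_cvg (x := x) st tT bF FF.
have c2 := act_cvg (x := x) sr rT (fun k => act_measurable rt' tT (bF k))
  (fun z => act_cvg (x := tcol z) rt' tT bF FF).
have ckE : (fun k => act s tau x (F_ k)) =
    (fun k => act s r x (fun z => act r tau (tcol z) (F_ k))).
  by apply/funext => k; exact: ckF.
by rewrite ckE in c1; exact: cvg_unique c1 c2.
Qed.

Lemma bounded_measurableD a M F M' F' :
  bounded_measurable M F -> bounded_measurable M' F' ->
  bounded_measurable (`|a| * M + M') (fun y => a * F y + F' y).
Proof.
move=> [mF FM] [mF' FM']; split.
  by apply: measurable_funD => //; exact: measurable_funM.
move=> y; rewrite (le_trans (ler_normD _ _))// lerD// normrM ler_wpM2l//.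
Qed.

Lemma chapman_kolmogorovD s r tau x a M F M' F' :
  0 <= s < r -> r < tau -> tau <= T ->
  bounded_measurable M F -> bounded_measurable M' F' ->
  chapman_kolmogorov s r tau x F -> chapman_kolmogorov s r tau x F' ->
  chapman_kolmogorov s r tau x (fun y => a * F y + F' y).
Proof.
move=> sr rt tT bF bF' ckF ckF'; have [s0 sr'] := andP sr.
have st : 0 <= s < tau by rewrite s0 (lt_trans sr').
have rt' : 0 <= r < tau by rewrite (le_trans s0 (ltW sr')).
have rT : r <= T by rewrite (le_trans (ltW rt)).
rewrite /chapman_kolmogorov (actD x a st tT bF bF') ckF ckF'.
rewrite -(actD x a sr rT (act_measurable rt' tT bF) (act_measurable rt' tT bF')).
by apply: eq_Rintegral => z _; rewrite (actD (tcol z) a rt' tT bF bF').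
Qed.

(* The sets [{h > 0}], [h] continuous, form a pi-system generating the Borel sets. *)
Definition positivity_sets : set (set E) :=
  [set A | exists h : 'cV[R]_n -> R,
    [/\ continuous h, forall x, 0 <= h x & A = [set y | 0 < h (tcol y)]]].

Lemma positivity_sets_setI : setI_closed positivity_sets.
Proof.
move=> _ _ [h [ch h0 ->]] [k [ck k0 ->]]; exists (fun x => h x * k x); split.
- exact: continuous_mul.
- by move=> x; rewrite mulr_ge0.
- apply/seteqP; split => y /=; first by move=> [hy ky]; rewrite mulr_gt0.
  rewrite !lt_neqAle !h0 !k0 mulr_ge0// !andbT eq_sym mulf_eq0 negb_or => /andP[].
  by rewrite ![_ == 0]eq_sym => -> ->.
Qed.

Lemma measurable_positivity_sets : @measurable _ E = <<s positivity_sets >>.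
Proof.
apply/seteqP; split; last first.
  apply: smallest_sub; first exact: sigma_algebra_measurable.
  move=> _ [h [ch h0 ->]]; rewrite -[X in measurable X]setTI.
  have := measurable_tcol ch measurableT (measurable_itv `]0, +oo[).
  by congr (measurable _); apply/seteqP; split => y /=; rewrite in_itv/= andbT.
pose S := g_sigma_algebraType positivity_sets.
have mid : measurable_fun setT (id : S -> E).
  apply/measurable_fun_tnthP => i.
  apply: (measurability _ (RGenOInfty.measurableE R)) => // _ [_ [c ->] <-].
  rewrite setTI; apply: sub_sigma_algebra.
  (* [|t| + t] is positive exactly when [t] is, so this function exhibits the half-space where the
     i-th coordinate exceeds [c]. *)
  exists (fun x : 'cV[R]_n => `|x i 0 - c| + (x i 0 - c)); split.
  - have cphi : continuous (fun t : R => `|t - c| + (t - c)).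
      move=> t; have ct : (fun t : R => t - c) @ t --> t - c.
        by apply: cvgB; [exact: cvg_id|exact: cvg_cst].
      by apply: cvgD => //; exact: cvg_norm.
    exact: (comp_continuous (@coord_continuous _ _ _ i 0) cphi).
  - by move=> x; rewrite -lerBlDr sub0r -normrN ler_norm.
  - apply/seteqP; split => y /=; rewrite in_itv/= andbT mxE -subr_gt0.
      by move=> yc; rewrite addr_gt0// normr_gt0 gt_eqF.
    apply: contraTT; rewrite -!leNgt => yc.
    by rewrite subr0 ler0_norm ?subr_le0// addNr.
by move=> A mA; have := mid measurableT A mA; rewrite setTI preimage_id.
Qed.

Lemma bounded_measurable_indic (A : set E) :
  measurable A -> bounded_measurable 1 (\1_A : E -> R).
Proof.
move=> mA; split; first exact: measurable_indic.
by move=> y; rewrite indicE; case: (_ \in _); rewrite ?normr1 ?normr0.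
Qed.

(** Dynkin's lemma: the identity passes to complements and to countable disjoint unions, and it
    holds on the generating pi-system because [h / (|h| + 1 / (k + 1))] increases to the indicator
    of the set where [h > 0]. *)
Lemma chapman_kolmogorov_indic s r tau x (A : set E) :
  0 <= s < r -> r < tau -> tau <= T -> measurable A ->
  chapman_kolmogorov s r tau x (\1_A : E -> R).
Proof.
move=> sr rt tT mA.
have ck1 : chapman_kolmogorov s r tau x (fun=> 1).
  exact: (chapman_kolmogorov_continuous x sr rt tT (terminal_cst 1)).
have b1 : bounded_measurable 1 (fun=> 1).
  by split; [exact: measurable_cst|move=> y; rewrite normr1].
have ckD a F F' : bounded_measurable 1 F -> bounded_measurable 1 F' ->
    chapman_kolmogorov s r tau x F -> chapman_kolmogorov s r tau x F' ->
    chapman_kolmogorov s r tau x (fun y => a * F y + F' y).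
  exact: chapman_kolmogorovD.
pose P (B : set E) := chapman_kolmogorov s r tau x (\1_B : E -> R).
apply: (dynkin_induction (P := P) measurable_positivity_sets positivity_sets_setI).
- by rewrite /P indicT.
- move=> B [h [ch h0 BE]]; rewrite /P.
  pose F_ (k : nat) (y : E) := h (tcol y) / (`|h (tcol y)| + k.+1%:R^-1).
  apply: (chapman_kolmogorov_cvg (M := 1) (F_ := F_) sr rt tT) => [k|y|k].
  + have [[cF _] F1] := sign_data k ch.
    by split; [exact: (measurable_tcol cF)|move=> y; exact: F1].
  + rewrite indicE BE; have [hy|hy] := eqVneq (h (tcol y)) 0.
      rewrite memNset/= ?hy ?ltxx//.
      have -> : F_ ^~ y = fun=> 0 by apply/funext => k; rewrite /F_ hy mul0r.
      exact: cvg_cst.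
    have hy0 : 0 < h (tcol y) by rewrite lt_neqAle eq_sym hy h0.
    rewrite mem_set//= (_ : 1%:R = h (tcol y) / (`|h (tcol y)| + 0)).
      apply: cvgMr; apply: cvgV; first by rewrite addr0 normr_eq0.
      by apply: cvgD; [exact: cvg_cst|exact: cvg_harmonic].
    by rewrite addr0 gtr0_norm// divff.
  + by have [th _] := sign_data k ch; exact: (chapman_kolmogorov_continuous x sr rt tT th).
- move=> B mB ckB; rewrite /P (_ : \1_(~` B) = fun y => -1 * \1_B y + 1).
    exact: (ckD _ _ _ (bounded_measurable_indic mB) b1 ckB ck1).
  apply/funext => y; rewrite !indicE in_setC.
  by case: (_ \in _); rewrite /= ?mulr1 ?mulr0 ?addNr ?add0r.
- move=> B mB tB ckB; rewrite /P.
  pose U N := \big[setU/set0]_(k < N) B k.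
  have mU N : measurable (U N) by exact: bigsetU_measurable.
  have US N : U N.+1 = U N `|` B N by rewrite /U big_ord_recr.
  have UB N : U N `&` B N = set0.
    apply/seteqP; split => // y [Uy By].
    move: Uy; rewrite /U -bigcup_mkord => -[k /= kN Bky].
    have kE : k = N by apply: (tB k N) => //; exists y.
    by rewrite kE ltnn in kN.
  apply: (chapman_kolmogorov_cvg (M := 1) (F_ := fun N => \1_(U N) : E -> R) sr rt tT).
  + by move=> N; exact: bounded_measurable_indic.
  + move=> y; rewrite indicE; case: (boolP (y \in \bigcup_k B k)) => [|yB].
      rewrite inE => -[k _ Bky]; apply/cvgrPdist_le => e e0.
      exists k.+1 => // N /= kN.
      rewrite indicE mem_set ?subrr ?normr0 ?ltW//.
      by rewrite /U -bigcup_mkord; exists k.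
    have -> : (fun N => \1_(U N) y : R) = fun=> 0.
      apply/funext => N; rewrite indicE memNset// => Uy; move: yB; rewrite notin_setE; apply.
      by move: Uy; rewrite /U -bigcup_mkord => -[k _ Bky]; exists k.
    exact: cvg_cst.
  + elim=> [|N IH].
      rewrite /U big_ord0 (_ : \1_set0 = fun y => -1 * 1 + 1); first exact: (ckD _ _ _ b1 b1 ck1 ck1).
      by apply/funext => y; rewrite indicE in_set0 mulr1 addNr.
    rewrite (_ : \1_(U N.+1) = fun y => 1 * \1_(U N) y + \1_(B N) y).
      exact: (ckD _ _ _ (bounded_measurable_indic (mU N)) (bounded_measurable_indic (mB N)) IH (ckB N)).
    apply/funext => y; rewrite US !indicE in_setU mul1r.
    have [yU|] := boolP (y \in U N); rewrite /= ?add0r//.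
    rewrite memNset ?addr0//= => By.
    have : (U N `&` B N) y by split => //; rewrite -inE.
    by rewrite UB.
- by rewrite -measurable_positivity_sets.
Qed.

(** The sum counts the levels [1, ..., N] that [t] reaches, so it is the integer part of [t]. *)
Lemma layer_cake (N : nat) (t : R) : 0 <= t <= N%:R ->
  `|\sum_(j < N) (j.+1%:R <= t)%R%:R - t| <= 1.
Proof.
elim: N => [|N IH] /andP[t0 tN].
  by rewrite big_ord0 (_ : t = 0) ?subrr ?normr0//; apply/eqP; rewrite eq_le tN.
rewrite big_ord_recr/=; have [tN'|Nt] := leP t N%:R.
  rewrite (_ : N.+1%:R <= t = false) ?addr0 ?IH ?t0//.
  by apply/negbTE; rewrite -ltNge (le_lt_trans tN')// ltr_nat.
rewrite (eq_bigr (fun=> 1)); last first.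
  by move=> j _; rewrite (le_trans _ (ltW Nt))// ler_nat.
rewrite sumr_const card_ord.
have [h|h] := leP N.+1%:R t.
  have -> : t = N.+1%:R by apply/eqP; rewrite eq_le tN.
  by rewrite natr1 subrr normr0.
rewrite addr0 ltr0_norm ?subr_lt0// opprB lerBlDr -natr1 in tN *.
by rewrite addrC.
Qed.

(** With its values moved to [[0, 1]], the function is within [1 / (k + 1)] of an average of [k + 1]
    indicators of superlevel sets; linear combinations and bounded limits preserve the identity. *)
Lemma chapman_kolmogorov_bounded s r tau x M F :
  0 <= s < r -> r < tau -> tau <= T -> bounded_measurable M F ->
  chapman_kolmogorov s r tau x F.
Proof.
move=> sr rt tT [mF FM].
pose M' := `|M| + 1; have M0 : 0 < M' by rewrite ltr_wpDl.
pose F' y := (F y + M') / (2 * M').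
have F'01 y : 0 <= F' y <= 1.
  have : `|F y| <= M' by rewrite (le_trans (FM y))// (le_trans (ler_norm M))// lerDl.
  rewrite ler_norml => /andP[h1 h2].
  rewrite /F' divr_ge0 ?mulr_ge0 ?(ltW M0)//=; last by rewrite -lerBlDr sub0r.
  by rewrite ler_pdivrMr ?mulr_gt0// mul1r mulr_natl mulr2n lerD2r.
have mF' : measurable_fun setT F'.
  apply: measurable_funM => //; exact: measurable_funD.
have bF' : bounded_measurable 1 F'.
  by split => // y; have /andP[h1 h2] := F'01 y; rewrite ger0_norm.
have ckc (c : R) : bounded_measurable `|c| (fun=> c) /\
    chapman_kolmogorov s r tau x (fun=> c).
  split; first by split => //; exact: measurable_cst.
  exact: (chapman_kolmogorov_continuous x sr rt tT (terminal_cst c)).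
pose A k j := [set y : E | j.+1%:R <= k.+1%:R * F' y].
have mA k j : measurable (A k j).
  have := @measurable_funM _ _ _ setT (cst k.+1%:R) F' (measurable_cst _) mF'.
  move=> /(_ measurableT _ (measurable_itv `[j.+1%:R, +oo[)); rewrite setTI.
  by congr (measurable _); apply/seteqP; split => y /=; rewrite in_itv/= andbT.
pose S k m y : R := \sum_(j < m) \1_(A k j) y.
have ckS k m : bounded_measurable m%:R (S k m) /\ chapman_kolmogorov s r tau x (S k m).
  elim: m => [|m [bS ckS]].
    have -> : S k 0%N = fun=> 0 by apply/funext => y; rewrite /S big_ord0.
    by have := ckc 0; rewrite normr0.
  have -> : S k m.+1 = fun y => 1 * \1_(A k m) y + S k m y.
    by apply/funext => y; rewrite /S big_ord_recr/= mul1r addrC.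
  have bI := bounded_measurable_indic (mA k m).
  split.
    by have := bounded_measurableD 1 bI bS; rewrite normr1 mul1r -natr1 addrC.
  exact: (chapman_kolmogorovD 1 sr rt tT bI bS (chapman_kolmogorov_indic x sr rt tT (mA k m)) ckS).
pose F_ k y := k.+1%:R^-1 * S k k.+1 y + 0.
have F_F k y : `|F_ k y - F' y| <= k.+1%:R^-1.
  have k0 : 0 < k.+1%:R :> R by [].
  have := @layer_cake k.+1 (k.+1%:R * F' y).
  have /andP[h1 h2] := F'01 y.
  rewrite mulr_ge0//= ler_piMr// => /(_ isT) H.
  have -> : F_ k y - F' y = k.+1%:R^-1 * (S k k.+1 y - k.+1%:R * F' y).
    by rewrite /F_ addr0 mulrBr mulKf// gt_eqF.
  rewrite normrM gtr0_norm ?invr_gt0// ler_piMr ?invr_ge0//.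
  apply: le_trans H; rewrite le_eqVlt; apply/orP; left; apply/eqP; congr (`|_ - _|).
  apply: eq_bigr => j _; rewrite indicE.
  suff -> : (y \in A k j) = (j.+1%:R <= k.+1%:R * F' y) by [].
  by apply/idP/idP; rewrite inE.
have ckF' : chapman_kolmogorov s r tau x F'.
  apply: (chapman_kolmogorov_cvg (M := 2) (F_ := F_) sr rt tT).
  - move=> k; split.
      have [[mS _] _] := ckS k k.+1.
      by apply: measurable_funD => //; exact: measurable_funM.
    move=> y; rewrite -[F_ k y](subrK (F' y)) (le_trans (ler_normD _ _))//.
    rewrite -[2]/(1 + 1 : R) lerD//; last by have := bF'.2 y.
    by rewrite (le_trans (F_F k y))// invf_le1// ler1n.
  - by move=> y; apply: cvg_squeeze_harmonic => k; exact: F_F.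
  - move=> k; have [bS cS] := ckS k k.+1; have [b0 c0] := ckc 0.
    exact: (chapman_kolmogorovD _ sr rt tT bS b0 cS c0).
have [bc cc] := ckc (- M').
have -> : F = fun y => (2 * M') * F' y + - M'.
  by apply/funext => y; rewrite /F'; field; rewrite gt_eqF.
exact: (chapman_kolmogorovD _ sr rt tT bF' bc ckF' cc).
Qed.

(* Splitting [s, tau] at its midpoint [r], [act s tau x F] is the solution at time [s]
   of the Cauchy problem with continuous data [act r tau _ F], hence is C^2. *)
Lemma act_differentiable s tau M F : 0 <= s < tau -> tau <= T -> bounded_measurable M F ->
  forall x, differentiable (fun x => act s tau x F) x.
Proof.
move=> st tT bF x; have [s0 st'] := andP st.
pose r := (s + tau) / 2.
have sr : s < r by rewrite /r midf_lt.
have rt : r < tau by rewrite /r midf_lt.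
have r0 : 0 < r by exact: le_lt_trans sr.
have rt' : 0 <= r < tau by rewrite ltW.
have rT : 0 < r <= T by rewrite r0 (le_trans (ltW rt)).
have tu : terminal_data (fun z => act r tau z F).
  by split; [exact: (act_continuous rt' tT bF)|exists M => z; exact: act_bound].
have [v [vC _ _ _ _] vE] := G_represents fund rT tu.
have -> : (fun x => act s tau x F) = v s.
  apply/funext => y; rewrite vE ?s0//.
  by apply: (chapman_kolmogorov_bounded y (r := r)) bF; rewrite ?s0.
have [d1 d2 _ _] : C2 (v s) by apply: C12_C2 vC _; rewrite s0.
by have [] := differentiable_partials d1 (fun i => d2 i x).
Qed.

End smoothing.

(* The weight [2 a^2 / (q (q + a)^2)], [q = sqrt (tau - s)], dominates
   [exp (- q^2 / a^2) / q] and has the bounded primitive [4 a q / (q + a)]. *)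
Lemma gaussian_le_rational (R : realType) (a q : R) : 0 < a -> 0 < q ->
  expR (- (q ^+ 2 / a ^+ 2)) / q <= 2 * a ^+ 2 / (q * (q + a) ^+ 2).
Proof.
move=> a0 q0; have qa0 : 0 < q + a by rewrite addr_gt0.
have e1 : expR (- (q ^+ 2 / a ^+ 2)) <= a ^+ 2 / (a ^+ 2 + q ^+ 2).
  rewrite expRN invf_ple ?posrE ?expR_gt0 ?divr_gt0 ?addr_gt0 ?exprn_gt0//.
  apply: le_trans (expR_ge1Dx _); rewrite invf_div le_eqVlt; apply/orP; left.
  by apply/eqP; field; rewrite gt_eqF.
apply: (@le_trans _ _ (a ^+ 2 / (a ^+ 2 + q ^+ 2) / q)).
  by rewrite ler_pM2r ?invr_gt0.
rewrite -subr_ge0 [leRHS](_ : _ = a ^+ 2 * (q - a) ^+ 2 /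
    ((a ^+ 2 + q ^+ 2) * (q * (q + a) ^+ 2))).
  apply: divr_ge0; first by rewrite mulr_ge0 ?sqr_ge0.
  by rewrite mulr_ge0// ?addr_ge0 ?sqr_ge0// mulr_ge0 ?sqr_ge0 ?(ltW q0).
by field; rewrite !gt_eqF//= addr_gt0 ?exprn_gt0.
Qed.

Lemma derive_bounded_primitive (R : realType) (s a t : R) : 0 < a -> s < t ->
  is_derive t 1 (fun t => 4 * a * (1 - a / (Num.sqrt (t - s) + a)))
    (2 * a ^+ 2 / (Num.sqrt (t - s) * (Num.sqrt (t - s) + a) ^+ 2)).
Proof.
move=> a0 st; have ts : 0 < t - s by rewrite subr_gt0.
have q0 : 0 < Num.sqrt (t - s) by rewrite sqrtr_gt0.
have qa0 : Num.sqrt (t - s) + a != 0 by rewrite gt_eqF// addr_gt0.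
have dsh : is_derive t 1 (fun t : R => t - s) 1.
  by apply: is_derive_eq; rewrite oppr0 addr0.
have dq : is_derive t 1 (fun t => Num.sqrt (t - s)) (2 * Num.sqrt (t - s))^-1.
  have h := is_derive1_sqrt ts.
  have := @is_derive1_comp R Num.sqrt (fun t : R => t - s) t _ _ h dsh.
  by rewrite mulr1.
have dqa : is_derive t 1 (fun t => Num.sqrt (t - s) + a) (2 * Num.sqrt (t - s))^-1.
  by have := is_deriveD dq (is_derive_cst a t 1); rewrite addr0.
have dV := @is_deriveV R (fun t => Num.sqrt (t - s) + a) t _ 1 qa0 dqa.
have d1 : is_derive t 1 (fun _ : R => 1 : R) 0 by exact: is_derive_cst.
have := is_deriveZ (4 * a) (is_deriveB d1 (is_deriveZ a dV)).
move=> [ex val]; split; first exact: ex.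
apply: etrans val _; rewrite /GRing.scale/=.
by move: q0 qa0; move: (Num.sqrt _) => q q0 qa0; field; rewrite qa0 gt_eqF.
Qed.

(** The integrand is singular at [s]. On intervals bounded away from [s] the fundamental theorem of
    calculus evaluates the integral of the rational majorant, with a value at most [4 * a], and
    monotone convergence restores the full interval. *)
Lemma weak_singular_integral (R : realType) (s T a : R) : s < T -> 0 < a ->
  let f tau := expR (- ((tau - s) / a ^+ 2)) / Num.sqrt (tau - s) in
  measurable_fun `]s, T] f /\
  (\int[@lebesgue_measure R]_(tau in `]s, T]) (f tau)%:E <= (4 * a)%:E)%E.
Proof.
move=> sT a0 f; set mu := lebesgue_measure.
(* With [k.+2] the interval is nondegenerate already for [k = 0]. *)
pose F k := [set` `[s + (T - s) / k.+2%:R, T]].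
have Ts : 0 < T - s by rewrite subr_gt0.
have kp k : 0 < (T - s) / k.+2%:R by rewrite divr_gt0.
have csq t : (fun t : R => Num.sqrt (t - s)) @ t --> Num.sqrt (t - s).
  apply: (@continuous_comp _ _ _ (fun t => t - s) Num.sqrt); last exact: sqrt_continuous.
  by apply: cvgB; [exact: cvg_id|exact: cvg_cst].
have mfT : measurable_fun `]s, T] f.
  apply: subspace_continuous_measurable_fun => //.
  apply: continuous_in_subspaceT => t; rewrite inE/= in_itv/= => /andP[st tT].
  have c1 : (fun t => expR (- ((t - s) / a ^+ 2))) @ t --> expR (- ((t - s) / a ^+ 2)).
    apply: (@continuous_comp _ _ _ (fun t => - ((t - s) / a ^+ 2)) expR); last exact: continuous_expR.
    by apply: cvgN; apply: cvgMr_tmp; apply: cvgB; [exact: cvg_id|exact: cvg_cst].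
  by apply: cvgM c1 (cvgV _ (csq t)); rewrite gt_eqF// sqrtr_gt0 subr_gt0.
split=> //.
have FU : \bigcup_k F k = `]s, T]%classic.
  apply/seteqP; split => t /=; rewrite in_itv/=.
    move=> [k _]; rewrite /F/= in_itv/= => /andP[+ ->]; rewrite andbT.
    by apply: lt_le_trans; rewrite ltrDl.
  move=> /andP[st tT].
  have e0 : 0 < (t - s) / (T - s) by rewrite divr_gt0// subr_gt0.
  have /cvgrPdist_lt/(_ _ e0)[k _ Hk] := @cvg_harmonic R.
  exists k => //; rewrite /F/= in_itv/= tT andbT -lerBrDl mulrC -ler_pdivlMr//.
  have := Hk k.+1 (leqnSn k); rewrite sub0r normrN ger0_norm ?harmonic_ge0//.
  exact: ltW.
have Fsub k : F k `<=` `]s, T]%classic by move=> t Ft; rewrite -FU; exists k.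
have mf k : measurable_fun (F k) f by exact: measurable_funS (Fsub k) mfT.
rewrite -FU.
have mF k : measurable (F k : set (measurableTypeR R)) by exact: measurable_itv.
have cv := @ge0_nondecreasing_set_cvg_integral _ (measurableTypeR R) R F (EFin \o f) lebesgue_measure.
apply: (cvge_to_le (cv _ _ _ _)) => //.
- apply/nondecreasing_seqP => k; rewrite subsetEset => t.
  rewrite /F/= !in_itv/= => /andP[h ->]; rewrite andbT; apply: le_trans h.
  by rewrite lerD2l ler_wpM2l ?(ltW Ts)// lef_pV2 ?posrE// ler_nat.
- by move=> k; apply/measurable_EFinP; exact: mf.
- by move=> k t _; rewrite lee_fin divr_ge0 ?expR_ge0 ?sqrtr_ge0.
apply: nearW => k.
set H := fun t => 4 * a * (1 - a / (Num.sqrt (t - s) + a)).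
set h := fun t => 2 * a ^+ 2 / (Num.sqrt (t - s) * (Num.sqrt (t - s) + a) ^+ 2).
have Fpos t : F k t -> s < t.
  by rewrite /F/= in_itv/= => /andP[+ _]; apply: lt_le_trans; rewrite ltrDl.
have dH t : s < t -> is_derive t 1 H (h t) by exact: derive_bounded_primitive.
have cH t : s < t -> H @ t --> H t.
  move=> /dH[ex _]; apply: differentiable_continuous; exact/derivable1_diffP.
have ch0 (t : R) : s < t -> h @ t --> h t.
  move=> st; have q0 : 0 < Num.sqrt (t - s) by rewrite sqrtr_gt0 subr_gt0.
  have c1 : (fun t => Num.sqrt (t - s) + a) @ t --> Num.sqrt (t - s) + a.
    by apply: cvgD; [exact: csq|exact: cvg_cst].
  apply: cvgM; first exact: cvg_cst.
  apply: cvgV; first by rewrite gt_eqF// mulr_gt0// exprn_gt0// addr_gt0.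
  by apply: cvgM; [exact: csq|exact: cvgM].
have ch : {within F k, continuous h}.
  by apply: continuous_in_subspaceT => t; rewrite inE => /Fpos; exact: ch0.
have lt1 : s + (T - s) / k.+2%:R < T.
  by rewrite -ltrBrDl ltr_pdivrMr// ltr_pMr// ltr1n.
have s1 : s < s + (T - s) / k.+2%:R by rewrite ltrDl.
apply: (@le_trans _ _ (\int[mu]_(t in F k) (h t)%:E)%E).
  apply: ge0_le_integral => //.
  - by move=> t _; rewrite lee_fin divr_ge0 ?expR_ge0 ?sqrtr_ge0.
  - by apply/measurable_EFinP; exact: mf.
  - by apply/measurable_EFinP; apply: subspace_continuous_measurable_fun; [exact: mF|exact: ch].
  - move=> t /Fpos st; rewrite lee_fin.
    have ts : 0 < t - s by rewrite subr_gt0.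
    have q0 : 0 < Num.sqrt (t - s) by rewrite sqrtr_gt0.
    by have := gaussian_le_rational a0 q0; rewrite sqr_sqrtr// ltW.
rewrite (continuous_FTC2 lt1 ch (F := H)).
- have sT0 t : 0 <= a / (Num.sqrt (t - s) + a) by rewrite divr_ge0 ?addr_ge0 ?sqrtr_ge0 ?(ltW a0).
  rewrite -EFinB lee_fin /H -mulrBr ler_piMr ?mulr_ge0 ?(ltW a0)//.
  have B1 t : a / (Num.sqrt (t - s) + a) <= 1.
    by rewrite ler_pdivrMr ?mul1r ?lerDr ?sqrtr_ge0// ltr_wpDl ?sqrtr_ge0.
  rewrite opprB addrC addrA subrK lerBlDr (le_trans (B1 _))//.
  by rewrite lerDl.
- split.
  + by move=> t; rewrite in_itv/= => /andP[/(lt_trans s1)/dH[]].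
  + by apply: cvg_at_right_filter; exact: cH.
  + by apply: cvg_at_left_filter; exact: cH.
- move=> t; rewrite in_itv/= => /andP[/(lt_trans s1)/dH[_ dv] _].
  by rewrite derive1E.
Qed.

(** * Integrals depending on a parameter *)

Section parameters.
Context d1 d2 (X : measurableType d1) (Y : measurableType d2) (R : realType).

(** Tonelli's theorem for the positive and the negative part, then [fine]; parameters at which the
    integral diverges are thereby covered. *)
Lemma measurable_Rintegral (mu : {sigma_finite_measure set Y -> \bar R}) (h : X * Y -> R) :
  measurable_fun setT h -> measurable_fun setT (fun x => \int[mu]_y h (x, y)).
Proof.
move=> mh; apply: measurableT_comp => //.
have mh' : measurable_fun setT (EFin \o h) by exact/measurable_EFinP.
rewrite (_ : (fun x => _) = (fun x => \int[mu]_y (EFin \o h)^\+ (x, y)) \-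
    (fun x => \int[mu]_y (EFin \o h)^\- (x, y)))%E; last first.
  apply/funext => x; rewrite [LHS]integralE.
  have fE : (fun y => (h (x, y))%:E) = (EFin \o h) \o pair x by [].
  by rewrite fE; congr (_ - _)%E; apply: eq_integral => y _; rewrite (funepos_comp, funeneg_comp).
apply: emeasurable_funB.
  apply: (measurable_fun_fubini_tonelli_F (m2 := mu)) => //; exact: measurable_funepos.
apply: (measurable_fun_fubini_tonelli_F (m2 := mu)) => //; exact: measurable_funeneg.
Qed.

Definition shift_tuple n (v : 'cV[R]_n) (y : Rtuple R n) : Rtuple R n :=
  [tuple v i 0 + tnth y i | i < n].

Lemma tcol_shift n (v : 'cV[R]_n) y : tcol (shift_tuple v y) = v + tcol y.
Proof. by apply/matrixP => i j; rewrite !mxE tnth_mktuple (ord1 j). Qed.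

Lemma measurable_shift_tuple n (v : 'cV[R]_n) : measurable_fun setT (shift_tuple v).
Proof.
apply/measurable_fun_tnthP => i.
rewrite (_ : _ \o _ = fun y => v i 0 + tnth y i).
  by apply: measurable_funD => //; exact: measurable_tnth.
by apply/funext => y /=; rewrite tnth_mktuple.
Qed.

(** A pointwise limit of difference quotients; [shift_tuple] carries out the translation among
    tuples, on which the sigma-algebra lives. *)
Lemma measurable_derive n (f : X -> 'cV[R]_n -> R) (v : 'cV[R]_n) :
  measurable_fun setT (fun p : X * Rtuple R n => f p.1 (tcol p.2)) ->
  (forall x z, derivable (f x) z v) ->
  measurable_fun setT (fun p : X * Rtuple R n => 'D_v (f p.1) (tcol p.2)).
Proof.
move=> mf df.
pose q k (p : X * Rtuple R n) := k.+1%:R *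
  (f p.1 (k.+1%:R^-1 *: v + tcol p.2) - f p.1 (tcol p.2)).
apply: (measurable_fun_cvg (h := q)).
  move=> k; apply: measurable_funM => //; apply: measurable_funB => //.
  have ms : measurable_fun setT
      (fun p : X * Rtuple R n => (p.1, shift_tuple (k.+1%:R^-1 *: v) p.2)).
    apply/measurable_fun_pairP; split; first exact: measurable_fst.
    exact: (measurableT_comp (measurable_shift_tuple _) measurable_snd).
  have := measurableT_comp mf ms; apply: eq_measurable_fun => p _ /=.
  by rewrite tcol_shift.
move=> p _; have D := df p.1 (tcol p.2).
have : (fun h : R => h^-1 *: ((f p.1 \o shift (tcol p.2)) (h *: v) - f p.1 (tcol p.2)))
    @ 0^' --> 'D_v (f p.1) (tcol p.2) by exact: D.
move=> /cvg_dnbhs_harmonic; apply: cvg_trans; apply: near_eq_cvg.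
by apply: nearW => k; rewrite /q /= invrK.
Qed.

End parameters.

Lemma derive_lipschitz (R : realType) (V : normedModType R) (f : V -> R) (C : R) x v :
  (forall y z, `|f y - f z| <= C * `|y - z|) -> derivable f x v -> `|'D_v f x| <= C * `|v|.
Proof.
move=> fC D; apply: (cvgr_to_le (cvg_norm D)); near=> h.
have h0 : h != 0 by near: h; exact: nbhs_dnbhs_neq.
rewrite /= normrZ normfV ler_pdivrMl ?normr_gt0// (le_trans (fC _ _))//.
by rewrite addrK normrZ mulrCA.
Unshelve. all: by end_near. Qed.

Lemma norm_unitv (R : realType) n (i : 'I_n) : `|unitv R i| = 1.
Proof.
apply/eqP; rewrite eq_le; apply/andP; split.
  by apply: mx_norm_le => // i1 i2; rewrite mxE; case: (_ && _); rewrite ?normr1 ?normr0.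
by have := mx_norm_entry (unitv R i) i 0; rewrite mxE !eqxx normr1.
Qed.

Section differentiation_under_the_integral.
Context d (Y : measurableType d) (R : realType) (mu : {measure set Y -> \bar R}).
Variables (A : set Y) (n : nat).
Hypothesis mA : measurable A.

Lemma Rintegral_sum (I : Type) (r : seq I) (h : I -> Y -> R) :
  (forall i, mu.-integrable A (EFin \o h i)) ->
  mu.-integrable A (EFin \o (fun y => \sum_(i <- r) h i y)) /\
  \int[mu]_(y in A) (\sum_(i <- r) h i y) = \sum_(i <- r) \int[mu]_(y in A) h i y.
Proof.
move=> ih; elim: r => [|i r [IH1 IH2]].
  under eq_fun do rewrite big_nil.
  rewrite big_nil; split; last exact: Rintegral0.
  exact: integrable0.
have sE : (fun y => \sum_(j <- i :: r) h j y) = (fun y => h i y + \sum_(j <- r) h j y).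
  by apply/funext => y; rewrite big_cons.
rewrite sE big_cons; split; last by rewrite RintegralD// IH2.
by have := integrableD mA (ih i) IH1; apply: eq_integrable.
Qed.

Lemma diff_dot (f : 'cV[R]_n -> R) x h : differentiable f x ->
  'd f x h = dot (\col_i 'D_(unitv R i) f x) h.
Proof.
move=> df; have hE : h = \sum_i h i 0 *: unitv R i.
  apply/matrixP => i j; rewrite summxE (bigD1 i)//= !mxE eqxx (ord1 j) mulr1.
  by rewrite big1 ?addr0// => k ki; rewrite !mxE eq_sym (negbTE ki) mulr0.
rewrite {1}hE linear_sum /dot; apply: eq_bigr => i _.
by rewrite linearZ/= -deriveE// mxE mulrC.
Qed.

(** The candidate differential integrates the partial derivatives. If the remainder were not [o(h)],
    it would exceed [e |h|] along a sequence tending to 0; but the integrands divided by [|h|] tend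
    to 0 pointwise and are dominated by [(1 + n) kap]. *)
Lemma differentiable_Rintegral (f : Y -> 'cV[R]_n -> R) (kap : Y -> R) x0 :
  (forall x, mu.-integrable A (EFin \o (f ^~ x))) ->
  (forall y, A y -> differentiable (f y) x0) ->
  (forall y x x', A y -> `|f y x - f y x'| <= kap y * `|x - x'|) ->
  mu.-integrable A (EFin \o kap) ->
  differentiable (fun x => \int[mu]_(y in A) f y x) x0.
Proof.
move=> fi df fkap ikap.
pose D y : 'cV[R]_n := \col_i 'D_(unitv R i) (f y) x0.
have derf y i : A y -> derivable (f y) x0 (unitv R i).
  by move=> Ay; apply: diff_derivable; exact: df.
have Dk y i : A y -> `|D y i 0| <= kap y.
  move=> Ay; rewrite mxE; have := derive_lipschitz (fun x x' => fkap y x x' Ay) (derf y i Ay).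
  by rewrite norm_unitv mulr1.
have iD i : mu.-integrable A (EFin \o (fun y => D y i 0)).
  apply: le_integrable ikap => //; last first.
    by move=> y Ay; rewrite /= lee_fin (le_trans (Dk y i Ay))// ler_norm.
  apply/measurable_EFinP.
  pose q k y := k.+1%:R * (f y (k.+1%:R^-1 *: unitv R i + x0) - f y x0).
  apply: (measurable_fun_cvg (h := q)).
    move=> k; apply: measurable_funM => //; apply: measurable_funB;
      by apply/measurable_EFinP; exact: (measurable_int _ (fi _)).
  move=> y Ay; rewrite mxE; have := derf y i Ay.
  move=> /cvg_dnbhs_harmonic; apply: cvg_trans; apply: near_eq_cvg.
  by apply: nearW => k; rewrite /q /= invrK.
pose c : 'cV[R]_n := \col_i \int[mu]_(y in A) D y i 0.
have idot h : mu.-integrable A (EFin \o (fun y => dot (D y) h)) /\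
    \int[mu]_(y in A) dot (D y) h = dot c h.
  have ih i : mu.-integrable A (EFin \o (fun y => D y i 0 * h i 0)).
    have := integrable_scale (h i 0) mA (iD i).
    by apply: eq_integrable => // y _; rewrite /= mulrC.
  have [H1 H2] := Rintegral_sum (index_enum 'I_n) ih; split; first exact: H1.
  rewrite /dot; apply: etrans H2 _; apply: eq_bigr => i _.
  by rewrite RintegralZr// mxE.
apply: (@differentiable_eps _ _ _ (fun x => \int[mu]_(y in A) f y x) (dot c) x0
  (@dot_continuous _ _ c) _).1.
move=> e e0; apply: contrapT => nH.
have /choice[h Hh] : forall k : nat, exists h : 'cV[R]_n, `|h| < k.+1%:R^-1 /\
    e * `|h| < `|\int[mu]_(y in A) f y (h + x0) - \int[mu]_(y in A) f y x0 - dot c h|.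
  move=> k; apply: contrapT => nh; apply: nH; apply/nbhs_ballP.
  exists k.+1%:R^-1 => //= h; rewrite -ball_normE/= sub0r normrN => hk.
  by rewrite leNgt; apply/negP => hh; apply: nh; exists h.
have h0 k : 0 < `|h k|.
  rewrite normr_gt0; apply/eqP => hk; have [_] := Hh k.
  by rewrite hk add0r subrr linear0 subrr !normr0 mulr0 ltxx.
pose r k y := `|h k|^-1 * (f y (h k + x0) - f y x0 - dot (D y) (h k)).
have dotk y k : A y -> `|dot (D y) (h k)| <= n%:R * kap y * `|h k|.
  move=> Ay; rewrite /dot (le_trans (ler_norm_sum _ _ _))//.
  apply: (@le_trans _ _ (\sum_(i < n) kap y * `|h k|)).
    by apply: ler_sum => i _; rewrite normrM ler_pM// ?Dk// mx_norm_entry.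
  by rewrite sumr_const card_ord -mulrA mulr_natl.
have fk k : mu.-integrable A (EFin \o (fun y => f y (h k + x0) - f y x0)).
  exact: integrable_sub.
have ik k : mu.-integrable A (EFin \o (fun y => f y (h k + x0) - f y x0 - dot (D y) (h k))).
  by apply: integrable_sub => //; exact: (idot (h k)).1.
have [||||_] := @Rdominated_convergence _ _ _ mu A r (fun=> 0) (fun y => (1 + n%:R) * kap y) mA.
- move=> k; apply: measurable_funM => //.
  by apply/measurable_EFinP; exact: (measurable_int _ (ik k)).
- move=> y Ay; apply/cvgrPdist_le => e1 e10.
  have /diff_locallyP[_ /eqaddoP/(_ e1 e10)/nbhs_ballP[dl /= dl0 Hdl]] := df y Ay.
  have /cvgrPdist_lt/(_ dl dl0) := @cvg_harmonic R; apply: filterS => k.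
  rewrite sub0r normrN ger0_norm ?harmonic_ge0// => kdl.
  have hdl : ball 0 dl (h k).
    by rewrite -ball_normE/= sub0r normrN (lt_trans (Hh k).1).
  have := Hdl _ hdl; rewrite /= sub0r normrN /r normrM normfV normr_id ler_pdivrMl//.
  by rewrite -(diff_dot _ (df y Ay)) mulrC -addrA -opprD.
- exact: integrable_scale.
- move=> k y Ay; rewrite /r normrM normfV normr_id ler_pdivrMl// mulrDl mul1r mulrDr.
  rewrite (le_trans (ler_normB _ _))// lerD//.
    by rewrite (le_trans (fkap _ _ _ Ay))// addrK mulrC.
  by rewrite mulrC dotk.
rewrite Rintegral0 => /cvgrPdist_lt/(_ e e0)[k _ /(_ k (leqnn k))].
rewrite sub0r normrN (RintegralZl _ mA (ik k)) RintegralB//; last exact: (idot (h k)).1.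
rewrite RintegralB// (idot (h k)).2 normrM normfV normr_id ltr_pdivrMl// => H.
by have [_] := Hh k; rewrite mulrC ltNge ltW.
Qed.

End differentiation_under_the_integral.

Definition untcol (R : realType) (n : nat) (x : 'cV[R]_n) : Rtuple R n :=
  [tuple x i 0 | i < n].

Lemma untcolK (R : realType) (n : nat) : cancel (@untcol R n) (@tcol R n).
Proof. by move=> x; apply/matrixP => i j; rewrite !mxE tnth_mktuple (ord1 j). Qed.

Lemma tcolK (R : realType) (n : nat) : cancel (@tcol R n) (@untcol R n).
Proof. by move=> y; apply: eq_from_tnth => i; rewrite tnth_mktuple mxE. Qed.

Section measurable_order.
Context d (X : measurableType d) (R : realType).
Implicit Types f g : X -> R.

Lemma measurable_le_set f g : measurable_fun setT f -> measurable_fun setT g ->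
  measurable [set x | f x <= g x].
Proof.
move=> mf mg; have := measurable_funB mg mf measurableT (measurable_itv `[0, +oo[).
by congr (measurable _); apply/seteqP; split => x /=; rewrite in_itv/= andbT subr_ge0; tauto.
Qed.

Lemma measurable_lt_set f g : measurable_fun setT f -> measurable_fun setT g ->
  measurable [set x | f x < g x].
Proof.
move=> mf mg; have := measurable_funB mg mf measurableT (measurable_itv `]0, +oo[).
by congr (measurable _); apply/seteqP; split => x /=; rewrite in_itv/= andbT subr_gt0; tauto.
Qed.

Lemma borel_tcol n (x : X -> Rtuple R n) : measurable_fun setT x ->
  borel_fun (fun p => tcol (x p)).
Proof.
move=> mx; apply: borel_mx => i j.
rewrite (_ : (fun p => _) = (fun p => tnth (x p) i)); last first.
  by apply/funext => p; rewrite mxE.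
exact: (measurableT_comp (measurable_tnth i) mx).
Qed.

End measurable_order.

Section conditional_measurability.
Context d (X : measurableType d) (R : realType).

Lemma measurable_if0 (b : X -> bool) (h : X -> R) : measurable [set p | b p] ->
  measurable_fun [set p | b p] h -> measurable_fun setT (fun p => if b p then h p else 0).
Proof.
move=> mb mh; have := (measurable_restrictT h mb).1 mh.
congr measurable_fun; apply/funext => p; rewrite patchE.
case: ifPn => [|/negP bp]; first by rewrite inE => ->.
by case: ifPn => // b'; case: bp; rewrite inE.
Qed.

Lemma measurable_if_within (V : topologicalType) (D : set V) (f : V -> R) (phi : X -> V)
    (b : X -> bool) : {within D, continuous f} -> borel_fun phi ->
  measurable [set p | b p] -> (forall p, b p <-> D (phi p)) ->
  measurable_fun setT (fun p => if b p then f (phi p) else 0).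
Proof.
move=> cf bphi mb bD; have DE : phi @^-1` D = [set p | b p].
  by apply/seteqP; split => p /= /bD.
apply: measurable_if0 => //.
by rewrite -DE; apply: borel_comp => //; rewrite DE.
Qed.

Lemma measurable_quad n (t s : X -> measurableTypeR R) (xi x : X -> Rtuple R n) :
  measurable_fun setT t -> measurable_fun setT s ->
  measurable_fun setT xi -> measurable_fun setT x ->
  measurable_fun setT (fun p => (t p, s p, xi p, x p)).
Proof.
move=> mt ms mxi mx.
by apply: measurable_fun_pair => //; apply: measurable_fun_pair => //; exact: measurable_fun_pair.
Qed.

Lemma measurable_time_lt (T : R) (t s : X -> R) : measurable_fun setT t -> measurable_fun setT s ->
  measurable [set p | (0 <= t p < s p) && (s p <= T)].
Proof.
move=> mt ms; rewrite (_ : [set p | _] =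
    [set p | 0 <= t p] `&` [set p | t p < s p] `&` [set p | s p <= T]).
  apply: measurableI; first apply: measurableI.
  - exact: measurable_le_set.
  - exact: measurable_lt_set.
  - exact: measurable_le_set.
by apply/seteqP; split => p /=; [move=> /andP[/andP[]]|move=> [[-> ->] ->]].
Qed.

Lemma measurable_time_le (T : R) (t s : X -> R) : measurable_fun setT t -> measurable_fun setT s ->
  measurable [set p | (0 <= t p <= s p) && (s p <= T)].
Proof.
move=> mt ms; rewrite (_ : [set p | _] =
    [set p | 0 <= t p] `&` [set p | t p <= s p] `&` [set p | s p <= T]).
  by apply: measurableI; first apply: measurableI; exact: measurable_le_set.
by apply/seteqP; split => p /=; [move=> /andP[/andP[]]|move=> [[-> ->] ->]].
Qed.

End conditional_measurability.

Definition exp_weight (R : realType) (a r : R) : R := expR (- (r / a ^+ 2)).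

Lemma weak_singular_Rintegral (R : realType) (s T a : R) : 0 < a ->
  let w tau := exp_weight a (tau - s) / Num.sqrt (tau - s) in
  (@lebesgue_measure R).-integrable `]s, T] (EFin \o w) /\
  \int[@lebesgue_measure R]_(tau in `]s, T]) w tau <= 4 * a.
Proof.
move=> a0 w; have [sT|Ts] := ltP s T; last first.
  have -> : `]s, T]%classic = set0 :> set R.
    apply/seteqP; split => // t /=; rewrite in_itv/= => /andP[/lt_le_trans h /h].
    by rewrite ltNge Ts.
  split; first by apply/integrableP; split; [exact: measurable_fun_set0|rewrite integral_set0].
  by rewrite Rintegral_set0 mulr_ge0// ltW.
have [mw wa] := weak_singular_integral sT a0.
have w0 tau : 0 <= w tau by rewrite divr_ge0 ?expR_ge0 ?sqrtr_ge0.
have iw : (@lebesgue_measure R).-integrable `]s, T] (EFin \o w).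
  apply/integrableP; split; first exact/measurable_EFinP.
  apply: le_lt_trans (ltry (4 * a)); apply: le_trans wa; rewrite le_eqVlt; apply/orP; left.
  by apply/eqP; apply: eq_integral => t _; rewrite /= ger0_norm.
by split => //; rewrite -lee_fin Rintegral_fineK.
Qed.

Lemma le_norm_Rintegral d (Y : measurableType d) (R : realType)
    (mu : {measure set Y -> \bar R}) (D : set Y) (f h : Y -> R) : measurable D ->
  measurable_fun D f -> mu.-integrable D (EFin \o h) -> (forall y, D y -> `|f y| <= h y) ->
  mu.-integrable D (EFin \o f) /\ `|\int[mu]_(y in D) f y| <= \int[mu]_(y in D) h y.
Proof.
move=> mD mf ih fh; have iF : mu.-integrable D (EFin \o f).
  apply: le_integrable ih => //; first exact/measurable_EFinP.
  by move=> y Dy; rewrite /= lee_fin (le_trans (fh y Dy))// ler_norm.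
split => //; apply: le_trans (le_normr_Rintegral mD iF) _.
by apply: le_Rintegral => //; exact: integrable_abse iF.
Qed.

(** * Space-time potentials of bounded sources *)

Section potentials.
Context (R : realType) (n d : nat).
Variables (b : R -> 'cV[R]_n -> 'cV[R]_n) (sigma : R -> 'cV[R]_n -> 'M[R]_(n, d)).
Variables (T K : R) (G : R -> 'cV[R]_n -> R -> 'cV[R]_n -> R).
Hypothesis K_gt0 : 0 < K.
Hypothesis fund : fundamental_solution b sigma T G.
Hypothesis estimate : gradient_estimate b sigma T K.

Local Notation E := (Rtuple R n).
Local Notation mR := (measurableTypeR R).
Local Notation lambda := (lebesgueN R n).
Local Notation leb := (@lebesgue_measure R).

(* Extended by zero so as to be jointly measurable on the whole space. *)
Definition kern (s : R) (x : 'cV[R]_n) (tau : R) (eta : 'cV[R]_n) : R :=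
  if (0 <= s < tau) && (tau <= T) then G s x tau eta else 0.

Lemma measurable_kern d' (X : measurableType d') (s tau : X -> mR) (x eta : X -> E) :
  measurable_fun setT s -> measurable_fun setT x ->
  measurable_fun setT tau -> measurable_fun setT eta ->
  measurable_fun setT (fun p => kern (s p) (tcol (x p)) (tau p) (tcol (eta p))).
Proof.
move=> ms mx mtau meta; have [cG _ _ _ _] := fund.
pose phi p : R * 'cV[R]_n * R * 'cV[R]_n := (s p, tcol (x p), tau p, tcol (eta p)).
have bphi : borel_fun phi.
  apply: (borel_pair (pair_baseP (pair_baseP (@real_baseP R) (@mx_baseP R n 1)) (@real_baseP R))
    (@mx_baseP R n 1)); last exact: borel_tcol.
  apply: (borel_pair (pair_baseP (@real_baseP R) (@mx_baseP R n 1)) (@real_baseP R));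
    last exact: borel_real.
  by apply: (borel_pair (@real_baseP R) (@mx_baseP R n 1)); [exact: borel_real|exact: borel_tcol].
have := measurable_if_within cG bphi (measurable_time_lt T ms mtau); apply=> p.
by split => [/andP|[]] //; move=> h1 h2; apply/andP.
Qed.

Lemma kern_derivable s x tau eta j : derivable (fun z => kern s z tau eta) x (unitv R j).
Proof.
rewrite /kern; have [/andP[st tT]|_] := boolP ((0 <= s < tau) && (tau <= T)); last exact: derivable_cst.
have tauT : 0 < tau <= T by case/andP: st => s0 /(le_lt_trans s0) ->.
by have [/(_ x j)] := C12_C2 (G_C12 fund eta tauT) st.
Qed.

Definition dkern j s x tau eta := 'D_(unitv R j) (fun z => kern s z tau eta) x.

Lemma dkernE j s x tau eta : 0 <= s < tau -> tau <= T ->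
  dkern j s x tau eta = 'D_(unitv R j) (fun z => G s z tau eta) x.
Proof. by move=> st tT; rewrite /dkern /kern st tT. Qed.

Lemma measurable_dkern d' (X : measurableType d') (s tau : X -> mR) (x eta : X -> E) j :
  measurable_fun setT s -> measurable_fun setT x ->
  measurable_fun setT tau -> measurable_fun setT eta ->
  measurable_fun setT (fun p => dkern j (s p) (tcol (x p)) (tau p) (tcol (eta p))).
Proof.
move=> ms mx mtau meta.
have mk : measurable_fun setT (fun p : (mR * (mR * E)) * E =>
    kern p.1.1 (tcol p.2) p.1.2.1 (tcol p.1.2.2)).
  apply: measurable_kern.
  - exact: (measurableT_comp measurable_fst measurable_fst).
  - exact: measurable_snd.
  - exact: (measurableT_comp measurable_fst (measurableT_comp measurable_snd measurable_fst)).
  - exact: (measurableT_comp measurable_snd (measurableT_comp measurable_snd measurable_fst)).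
have H := measurable_derive mk (fun p z => @kern_derivable p.1 z p.2.1 (tcol p.2.2) j).
have mq : measurable_fun setT (fun p => ((s p, (tau p, eta p)), x p)).
  by apply: measurable_fun_pair => //; apply: measurable_fun_pair => //; exact: measurable_fun_pair.
exact: (measurableT_comp H mq).
Qed.

(** Integration over all [tau], cut down to []s, T]] by [kern]: the domain does not move with [s],
    so that joint measurability in [(s, x)] falls under [measurable_Rintegral]. *)
Definition potential (s : R) (x : 'cV[R]_n) (f : R -> E -> R) : R :=
  \int[leb]_tau \int[lambda]_y (kern s x tau (tcol y) * f tau y).

Definition source (M : R) (f : R -> E -> R) :=
  measurable_fun setT (fun p : mR * E => f p.1 p.2) /\ forall tau y, `|f tau y| <= M.

Lemma potentialE s x f : 0 <= s ->
  potential s x f = \int[leb]_(tau in `]s, T]) act G s tau x (f tau).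
Proof.
move=> s0; rewrite [RHS]Rintegral_mkcond; apply: eq_Rintegral => tau _.
rewrite patchE mem_setE in_itv/=; case: ifPn => [/andP[st tT]|H].
  by apply: eq_Rintegral => y _; rewrite /kern s0 st tT.
rewrite -[RHS](Rintegral0 lambda setT); apply: eq_Rintegral => y _.
by rewrite /kern s0/= (negbTE H) mul0r.
Qed.

Lemma source_bounded M f tau : source M f -> bounded_measurable M (f tau).
Proof.
move=> [mf fM]; split=> [|y]; last exact: fM.
exact: (measurableT_comp mf (measurable_pair1 tau)).
Qed.

Lemma act_measurable_time s x M f : 0 <= s -> source M f ->
  measurable_fun `]s, T] (fun tau => act G s tau x (f tau)).
Proof.
move=> s0 [mf _].
have mk : measurable_fun setT (fun p : mR * E => kern s x p.1 (tcol p.2) * f p.1 p.2).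
  apply: measurable_funM => //.
  rewrite (_ : (fun p : mR * E => _) =
      fun p => kern (cst s p) (tcol (cst (untcol x) p)) p.1 (tcol p.2)).
    exact: (measurable_kern (measurable_cst _) (measurable_cst _) measurable_fst measurable_snd).
  by apply/funext => p /=; rewrite untcolK.
have := measurable_Rintegral lambda mk.
move=> /(measurable_funTS (D := `]s, T]%classic)); apply: eq_measurable_fun => tau.
rewrite inE/= in_itv/= => /andP[st tT].
by apply: eq_Rintegral => y _; rewrite /kern s0 st tT.
Qed.

Lemma act_integrable_time s x M f : 0 <= s -> source M f ->
  leb.-integrable `]s, T] (EFin \o (fun tau => act G s tau x (f tau))).
Proof.
move=> s0 sf; have mact := act_measurable_time x s0 sf.
have ic : leb.-integrable `]s, T] (EFin \o (fun=> M)).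
  apply: measurable_bounded_integrable => //.
    have := @lebesgue_measure_itv R `]s, T] => mu; apply: (eq_ind_r (fun v => v < +oo)%E _ mu).
    by case: ifP => _; rewrite ?ltry// -EFinB ltry.
  exists `|M|; split; first exact: num_real.
  by move=> e Me t _; exact: ltW.
apply: (@le_norm_Rintegral _ mR R leb _ _ _ (measurable_itv _) mact ic _).1 => tau /=.
rewrite in_itv/= => /andP[st tT].
by apply: (act_bound fund estimate) => //; [rewrite s0|exact: source_bounded].
Qed.

Lemma potentialB s x M f M' f' : 0 <= s -> source M f -> source M' f' ->
  potential s x f - potential s x f' = potential s x (fun tau y => f tau y - f' tau y).
Proof.
move=> s0 sf sf'; rewrite !potentialE// -RintegralB//; last 2 first.
  - exact: (act_integrable_time x s0 sf).
  - exact: (act_integrable_time x s0 sf').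
apply: eq_Rintegral => tau; rewrite inE/= in_itv/= => /andP[st tT].
have st' : 0 <= s < tau by rewrite s0.
have bf := source_bounded tau sf; have bf' := source_bounded tau sf'.
have -> : (fun y => f tau y - f' tau y) = fun y => -1 * f' tau y + f tau y.
  by apply/funext => y; rewrite mulN1r addrC.
by rewrite (actD fund x (-1) st' tT bf' bf) mulN1r addrC.
Qed.

(** For a source that is itself singular at [s], as the difference of two drivers may be when
    [s = t]. The kernel has mass at most 1, so the weakly singular integral is spent on the
    source. *)
Lemma potential_bound s x a c M f : 0 <= s -> 0 < a -> 0 <= c -> source M f ->
  (forall tau y, s < tau <= T ->
    `|f tau y| <= c * (exp_weight a (tau - s) / Num.sqrt (tau - s))) ->
  `|potential s x f| <= c * (4 * a).
Proof.
move=> s0 a0 c0 sf fc; rewrite potentialE//.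
have [iw wa] := weak_singular_Rintegral s T a0.
have mact := act_measurable_time x s0 sf.
apply: le_trans (@le_norm_Rintegral _ mR R leb _ _ _ (measurable_itv _) mact
  (integrable_scale c _ iw) _).2 _ => //.
  move=> tau /=; rewrite in_itv/= => stT; have /andP[st tT] := stT.
  apply: (act_bound fund estimate) => //; first by rewrite s0.
  by split; [exact: (source_bounded tau sf).1|move=> y; exact: fc].
by rewrite RintegralZl// ler_wpM2l.
Qed.

(** Here the source is regular at [s], and the same weakly singular integral is spent on the factor
    [1 / sqrt (tau - s)] of [act_lipschitz]. *)
Lemma potential_lipschitz s x x' a c M f : 0 <= s -> 0 < a -> 0 <= c -> source M f ->
  (forall tau y, s < tau <= T -> `|f tau y| <= c * exp_weight a (tau - s)) ->
  `|potential s x f - potential s x' f| <= K * c * (4 * a) * `|x - x'|.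
Proof.
move=> s0 a0 c0 sf fc; rewrite !potentialE//.
have [iw wa] := weak_singular_Rintegral s T a0.
have mact := measurable_funB (act_measurable_time x s0 sf) (act_measurable_time x' s0 sf).
rewrite -RintegralB//; last 2 first.
  - exact: (act_integrable_time x s0 sf).
  - exact: (act_integrable_time x' s0 sf).
apply: le_trans (@le_norm_Rintegral _ mR R leb _ _ _ (measurable_itv _) mact
  (integrable_scale (K * c * `|x - x'|) _ iw) _).2 _ => //.
  move=> tau /=; rewrite in_itv/= => stT; have /andP[st tT] := stT.
  have bf : bounded_measurable (c * exp_weight a (tau - s)) (f tau).
    by split; [exact: (source_bounded tau sf).1|move=> y; exact: fc].
  have st' : 0 <= s < tau by rewrite s0.
  apply: le_trans (act_lipschitz fund estimate x x' st' tT bf) _.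
  by rewrite le_eqVlt; apply/orP; left; apply/eqP; ring.
rewrite RintegralZl// [leRHS](_ : _ = K * c * `|x - x'| * (4 * a)); last by ring.
by rewrite ler_wpM2l// !mulr_ge0// ltW.
Qed.

Let exp_weight1 s tau : 0 <= s -> s < tau <= T -> 1 <= expR T * exp_weight 1 (tau - s).
Proof.
move=> s0 /andP[_ tT]; rewrite /exp_weight expr1n divr1 -expRD -[leLHS]expR0 ler_expR.
by rewrite opprB addrCA addr_ge0// subr_ge0.
Qed.

Lemma potential_sup s x M f : 0 <= s -> source M f ->
  `|potential s x f| <= M * (expR T * Num.sqrt T) * 4.
Proof.
move=> s0 sf; have M0 : 0 <= M by apply: le_trans (sf.2 point point).
(* The case [a = 1]: on [[0, T]] the weight is at least [exp (- T)], and [sqrt T / sqrt (tau - s)]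
   is at least 1, so a bounded source satisfies the weighted bound. *)
rewrite -[4]mulr1; apply: (potential_bound _ s0 _ _ sf) => //.
  by rewrite !mulr_ge0 ?expR_ge0 ?sqrtr_ge0.
move=> tau y stT; have /andP[st tT] := stT; apply: le_trans (sf.2 _ _) _.
have ts : 0 < Num.sqrt (tau - s) by rewrite sqrtr_gt0 subr_gt0.
rewrite [leRHS](_ : _ = M * ((expR T * exp_weight 1 (tau - s)) *
  (Num.sqrt T / Num.sqrt (tau - s)))); last by ring.
rewrite ler_peMr// -[leLHS]mulr1 ler_pM// ?exp_weight1//.
by rewrite ler_pdivlMr// mul1r ler_wsqrtr// lerBlDr (le_trans tT)// lerDl.
Qed.

Lemma potential_lipschitz_sup s x x' M f : 0 <= s -> source M f ->
  `|potential s x f - potential s x' f| <= K * (M * expR T) * 4 * `|x - x'|.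
Proof.
move=> s0 sf; have M0 : 0 <= M by apply: le_trans (sf.2 point point).
rewrite -[4]mulr1; apply: (potential_lipschitz _ _ s0 _ _ sf) => //.
  by rewrite !mulr_ge0 ?expR_ge0.
move=> tau y stT; apply: le_trans (sf.2 _ _) _.
by rewrite -mulrA ler_peMr// exp_weight1.
Qed.

(** Each time slice is differentiable by [act_differentiable], with a Lipschitz constant of order
    [1 / sqrt (tau - s)], which is integrable in [tau]. *)
Lemma potential_differentiable s x M f : 0 <= s -> source M f ->
  differentiable (fun x => potential s x f) x.
Proof.
move=> s0 sf; rewrite (_ : (fun x => _) =
    fun x => \int[leb]_(tau in `]s, T]) act G s tau x (f tau)); last first.
  by apply/funext => z; exact: potentialE.
have [iw _] := weak_singular_Rintegral s T (@ltr01 R).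
apply: (@differentiable_Rintegral _ mR R leb _ n (measurable_itv _)
    (fun tau z => act G s tau z (f tau)) (fun tau => K * M * expR T * (exp_weight 1 (tau - s) / Num.sqrt (tau - s)))) => //.
- by move=> z; exact: act_integrable_time sf.
- move=> tau /=; rewrite in_itv/= => /andP[st tT].
  by apply: (act_differentiable fund estimate _ tT (source_bounded tau sf)); rewrite s0.
- move=> tau z z' /=; rewrite in_itv/= => /andP[st tT].
  have st' : 0 <= s < tau by rewrite s0.
  apply: le_trans (act_lipschitz fund estimate z z' st' tT (source_bounded tau sf)) _.
  have M0 : 0 <= M by apply: le_trans (sf.2 tau point).
  have e1 : 1 <= expR T * exp_weight 1 (tau - s) by rewrite exp_weight1 ?st.
  rewrite [leRHS](_ : _ = K * `|z - z'| / Num.sqrt (tau - s) * M *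
     (expR T * exp_weight 1 (tau - s))); last by ring.
  by rewrite ler_peMr// !mulr_ge0// ?invr_ge0 ?sqrtr_ge0 ?(ltW K_gt0).
- exact: (@integrable_scale _ mR R leb _ _ _ (measurable_itv _) iw).
Qed.

End potentials.

(** * Fixed points for a weighted distance *)

Section picard.
Context (R : realType) (J : Type) (w : J -> R).
Hypothesis w_gt0 : forall j, 0 < w j.

(** A bound instead of a supremum, which could be infinite. The weights may come arbitrarily close
    to 0, so closeness in this sense yields pointwise convergence only; [S_cvg] asks for closedness
    under pointwise limits accordingly. *)
Definition wdist (c : R) (u v : J -> R) := forall j, w j * `|u j - v j| <= c.

Variables (S : (J -> R) -> Prop) (Phi : (J -> R) -> J -> R).
Hypothesis S_cvg : forall (u_ : nat -> J -> R) u,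
  (forall k, S (u_ k)) -> (forall j, u_ ^~ j @ \oo --> u j) -> S u.
Hypothesis S_Phi : forall u, S u -> S (Phi u).
Hypothesis Phi_half : forall c u v, S u -> S v -> wdist c u v -> wdist (c / 2) (Phi u) (Phi v).

Lemma wdist_triangle c c' u v z : wdist c u v -> wdist c' v z -> wdist (c + c') u z.
Proof.
move=> uv vz j; rewrite -(subrKA (v j)) (le_trans (ler_wpM2l (ltW (w_gt0 j)) (ler_normD _ _)))//.
by rewrite mulrDr lerD.
Qed.

Lemma wdist_sym c u v : wdist c u v -> wdist c v u.
Proof. by move=> uv j; rewrite distrC. Qed.

Lemma wdist_cvg c u v_ v : (forall j, v_ ^~ j @ \oo --> v j) ->
  (\forall k \near \oo, wdist c u (v_ k)) -> wdist c u v.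
Proof.
move=> vv H j; have cv : (fun k => w j * `|u j - v_ k j|) @ \oo --> w j * `|u j - v j|.
  by apply: cvgMl_tmp; apply: cvg_norm; apply: cvgB; [exact: cvg_cst|exact: vv].
by apply: (cvgr_to_le cv); apply: filterS H => k; exact.
Qed.

Lemma wdist_eq u v c : (forall k : nat, wdist (c / 2 ^+ k) u v) -> u = v.
Proof.
move=> H; apply/funext => j; apply/eqP; rewrite -subr_eq0 -normr_le0.
rewrite -(pmulr_rle0 _ (w_gt0 j)).
have cv : geometric c 2^-1 @ \oo --> 0.
  by apply: cvg_geometric; rewrite ger0_norm// invf_lt1// ltr1n.
apply: (cvgr_to_ge cv); apply: nearW => k; rewrite /geometric/= exprVn; exact: H.
Qed.

Lemma picard_unique u v c : S u -> S v -> Phi u = u -> Phi v = v -> wdist c u v -> u = v.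
Proof.
move=> Su Sv fu fv uv; apply: (@wdist_eq _ _ c) => k.
elim: k => [|k IH]; first by rewrite expr0 divr1.
by rewrite exprSr invfM mulrA -fu -fv; exact: Phi_half.
Qed.

Lemma picard_exists u0 c : S u0 -> wdist c u0 (Phi u0) -> exists2 u, S u & Phi u = u.
Proof.
move=> Su0 d0; pose U k := iter k Phi u0.
have SU k : S (U k) by elim: k => //= k; exact: S_Phi.
have dU k : wdist (c / 2 ^+ k) (U k) (U k.+1).
  elim: k => [|k IH]; first by rewrite expr0 divr1.
  rewrite exprSr invfM mulrA; exact: (Phi_half (SU k) (SU k.+1) IH).
(* The exact value of the geometric sum [c / 2^k + ... + c / 2^(k + N - 1)]. *)
have dUN k N : wdist (2 * c / 2 ^+ k - 2 * c / 2 ^+ (k + N)) (U k) (U (k + N)%N).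
  elim: N => [|N IH].
    by move=> j; rewrite addn0 !subrr normr0 mulr0.
  have := wdist_triangle IH (dU (k + N)%N); rewrite addnS; congr wdist.
  by rewrite exprS; field; rewrite !expf_neq0.
(* The sign of [c] is read off an index; over an empty index set all functions are equal. *)
have [j0|nJ] := pselect (exists j : J, True); last first.
  exists u0 => //; apply/funext => j; case: nJ; by exists j.
have c0 : 0 <= c.
  case: j0 => j _; exact: le_trans (mulr_ge0 (ltW (w_gt0 j)) (normr_ge0 _)) (d0 j).
have {}dUN k l : (k <= l)%N -> wdist (2 * c / 2 ^+ k) (U k) (U l).
  move=> /subnKC <- j; apply: le_trans (dUN _ _ j) _.
  by rewrite gerBl divr_ge0 ?mulr_ge0// exprn_ge0.
have Ucvg j : cvgn (U ^~ j).
  apply: cauchy_cvg; apply: cauchy_exP => e e0.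
  have cv : geometric (2 * c) 2^-1 @ \oo --> 0.
    by apply: cvg_geometric; rewrite ger0_norm// invf_lt1// ltr1n.
  have ew : 0 < w j * e by rewrite mulr_gt0.
  have /cvgrPdist_lt/(_ _ ew)[k _ /(_ k (leqnn k))] := cv.
  rewrite sub0r normrN /geometric/= exprVn => Hk.
  exists (U k j); exists k => // l kl.
  rewrite -ball_normE/= -(ltr_pM2l (w_gt0 j)).
  apply: le_lt_trans (dUN k l kl j) _; exact: le_lt_trans (ler_norm _) Hk.
pose u j := limn (U ^~ j).
have Uu j : U ^~ j @ \oo --> u j by exact: Ucvg.
have Su : S u by exact: S_cvg Uu.
have dist k : wdist (2 * c / 2 ^+ k) (U k) u.
  by apply: wdist_cvg Uu _; exists k => // l; exact: dUN.
(* [Phi u] and [u] are each within [c / 2^(k + 1)] of the iterate [U k.+2]. *)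
exists u => //; apply: (@wdist_eq _ _ c) => k.
have := wdist_triangle (Phi_half Su (SU k.+1) (wdist_sym (dist k.+1))) (dist k.+2).
by congr wdist; rewrite !exprS; field; rewrite expf_neq0.
Qed.

End picard.

Lemma within_entry (R : realType) (V : topologicalType) a b (D : set V)
    (f : V -> 'M[R]_(a, b)) i j :
  {within D, continuous f} -> {within D, continuous (fun x => f x i j)}.
Proof.
by move=> cf; exact: (@comp_continuous (subspace D) _ _ f _ cf (@coord_continuous _ _ _ i j)).
Qed.

(** * The integral equation as a contraction *)

Section coordinates.
Context (R : realType) (n : nat).
Local Notation E := (Rtuple R n).
Local Notation mR := (measurableTypeR R).
Local Notation X4 := (mR * mR * E * E)%type.

Lemma measurable_coord1 : measurable_fun setT (fun p : X4 => p.1.1.1).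
Proof. by do 2 apply: (measurableT_comp measurable_fst); exact: measurable_fst. Qed.

Lemma measurable_coord2 : measurable_fun setT (fun p : X4 => p.1.1.2).
Proof.
exact: (measurableT_comp measurable_snd (measurableT_comp measurable_fst measurable_fst)).
Qed.

Lemma measurable_coord3 : measurable_fun setT (fun p : X4 => p.1.2).
Proof. exact: (measurableT_comp measurable_snd measurable_fst). Qed.

End coordinates.

Lemma differentiable_col (R : realType) (V : normedModType R) m (f : V -> 'cV[R]_m) x :
  (forall i, differentiable (fun y => f y i 0) x) -> differentiable f x.
Proof.
move=> df; rewrite (_ : f = \sum_(i < m) (fun y => f y i 0 *: unitv R i)).
  by apply: differentiable_sum => i; exact: (differentiableZl (unitv R i) (df i)).
apply/funext => y; rewrite fct_sumE; apply/matrixP => i j; rewrite (ord1 j) summxE.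
rewrite (bigD1 i)//= !mxE !eqxx mulr1 big1 ?addr0// => k ki.
by rewrite !mxE eq_sym (negbTE ki) mulr0.
Qed.

Lemma jacE (R : realType) n m (f : 'cV[R]_n -> 'cV[R]_m) x i j : differentiable f x ->
  jac f x i j = 'D_(unitv R j) (fun y => f y i 0) x.
Proof. by move=> df; rewrite mxE derive_mx ?mxE//; exact: diff_derivable. Qed.

Section operator.
Context (R : realType) (n m d : nat).
Variables (b : R -> 'cV[R]_n -> 'cV[R]_n) (sigma : R -> 'cV[R]_n -> 'M[R]_(n, d)).
Variables (T K : R) (G : R -> 'cV[R]_n -> R -> 'cV[R]_n -> R).
Variable g : R -> R -> 'cV[R]_n -> 'cV[R]_n ->
  'cV[R]_m -> 'M[R]_(m, d) -> 'M[R]_(m, d) -> 'cV[R]_m.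
Hypothesis K_gt0 : 0 < K.
Hypothesis fund : fundamental_solution b sigma T G.
Hypothesis estimate : gradient_estimate b sigma T K.

Variables (Mg Lg Ms : R).
Hypotheses (Mg_gt0 : 0 < Mg) (Lg_gt0 : 0 < Lg) (Ms_gt0 : 0 < Ms).
Hypothesis sigma_continuous :
  {within [set p : R * 'cV[R]_n | 0 <= p.1 <= T], continuous (fun p => sigma p.1 p.2)}.
Hypothesis sigma_bounded : forall s x, 0 <= s <= T -> `|sigma s x| <= Ms.
Hypothesis g_continuous : {within
  [set q : R * R * 'cV[R]_n * 'cV[R]_n * 'cV[R]_m * 'M[R]_(m, d) * 'M[R]_(m, d) |
    let: (t, s, _, _, _, _, _) := q in 0 <= t <= s /\ s <= T],
  continuous (fun q => let: (t, s, xi, x, y, z, w) := q in g t s xi x y z w)}.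
Hypothesis g_bounded : forall t s xi x y z w, 0 <= t <= s -> s <= T ->
  `|g t s xi x y z w| <= Mg.
Hypothesis g_lipschitz : forall t s xi x y z w y' z' w', 0 <= t <= s -> s <= T ->
  `|g t s xi x y z w - g t s xi x y' z' w'| <= Lg * (`|y - y'| + `|z - z'| + `|w - w'|).

Local Notation E := (Rtuple R n).
Local Notation mR := (measurableTypeR R).
Local Notation X4 := (mR * mR * E * E)%type.
Local Notation lambda := (lebesgueN R n).
Local Notation leb := (@lebesgue_measure R).

(* The unknown: [None] indexes Theta(t, s, xi, x), [Some j] its j-th partial
   derivative in x. The value of Theta at (tau, tau, eta, eta) only involves [None]. *)
Let state := X4 -> 'I_m -> option 'I_n -> R.
Implicit Type u : state.

Definition diag_mx4 u (tau : R) (eta : E) : 'cV[R]_m :=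
  \col_i u (tau, tau, eta, eta) i None.

Definition Gamma_grad u (t tau : R) (xi : E) : 'M[R]_(m, n) :=
  \matrix_(i, j) \int[lambda]_y
    (dkern T G j t (tcol xi) tau (tcol y) * u (tau, tau, y, y) i None).

(** The value 0 outside the time domain makes the driver bounded and measurable on the whole space,
    although [g] is controlled on its domain only. *)
Definition driver u (t tau : R) (xi eta : E) : 'cV[R]_m :=
  if (0 <= t < tau) && (tau <= T) then
    g t tau (tcol xi) (tcol eta) (diag_mx4 u tau eta)
      ((\matrix_(i, j) u (t, tau, xi, eta) i (Some j)) *m sigma tau (tcol eta))
      (Gamma_grad u t tau xi *m sigma tau (tcol eta))
  else 0.

Definition measurable_state u :=
  forall i o, measurable_fun setT (fun p => u p i o).

Lemma measurable_Gamma_grad u i j : measurable_state u ->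
  measurable_fun setT (fun p : X4 => Gamma_grad u p.1.1.1 p.1.1.2 p.1.2 i j).
Proof.
move=> mu; rewrite (_ : (fun p => _) = (fun p : X4 => \int[lambda]_y
    (dkern T G j p.1.1.1 (tcol p.1.2) p.1.1.2 (tcol y) * u (p.1.1.2, p.1.1.2, y, y) i None)));
  last by apply/funext => p; rewrite mxE.
have m0 : measurable_fun setT (fun p : X4 * E => p.1) by exact: measurable_fst.
have m1 := measurableT_comp (@measurable_coord1 R n) m0.
have m2 := measurableT_comp (@measurable_coord2 R n) m0.
have m3 := measurableT_comp (@measurable_coord3 R n) m0.
have m4 : measurable_fun setT (fun p : X4 * E => p.2) by exact: measurable_snd.
apply: (measurable_Rintegral lambda (h := fun p : X4 * E =>
  dkern T G j p.1.1.1.1 (tcol p.1.1.2) p.1.1.1.2 (tcol p.2) *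
  u (p.1.1.1.2, p.1.1.1.2, p.2, p.2) i None)).
apply: measurable_funM; first exact: (measurable_dkern fund).
exact: (measurableT_comp (mu i None) (measurable_quad m2 m2 m4 m4)).
Qed.

Let sigma0 (tau : R) (eta : E) : 'M[R]_(n, d) :=
  if 0 <= tau <= T then sigma tau (tcol eta) else 0.

Lemma measurable_sigma0 k j : measurable_fun setT (fun p : X4 => sigma0 p.1.1.2 p.2 k j).
Proof.
have m2 := @measurable_coord2 R n.
have m4 : measurable_fun setT (fun p : X4 => p.2) by exact: measurable_snd.
have cs : {within [set p : R * 'cV[R]_n | 0 <= p.1 <= T], continuous (fun p => sigma p.1 p.2 k j)}.
  exact: (within_entry sigma_continuous).
rewrite (_ : (fun p => _) = fun p : X4 =>
    if 0 <= p.1.1.2 <= T then sigma p.1.1.2 (tcol p.2) k j else 0); last first.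
  by apply/funext => p; rewrite /sigma0; case: ifP => // _; rewrite mxE.
apply: (measurable_if_within (phi := fun p : X4 => (p.1.1.2 : R, tcol p.2)) cs) => //.
  by apply: (borel_pair (@real_baseP R) (@mx_baseP R n 1)); [exact: borel_real|exact: borel_tcol].
rewrite (_ : [set p | _] = [set p : X4 | 0 <= p.1.1.2] `&` [set p : X4 | p.1.1.2 <= T]).
  by apply: measurableI; apply: measurable_le_set => //; exact: measurable_cst.
by apply/seteqP; split => p /=; [move=> /andP[]|move=> [-> ->]].
Qed.

Let measurable_mul_sigma0 (A : X4 -> 'M[R]_(m, n)) i j :
  (forall i j, measurable_fun setT (fun p => A p i j)) ->
  measurable_fun setT (fun p => (A p *m sigma0 p.1.1.2 p.2) i j).
Proof.
move=> mA; rewrite (_ : (fun p => _) = fun p => \sum_k A p i k * sigma0 p.1.1.2 p.2 k j).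
  by apply: measurable_sum => k; apply: measurable_funM => //; exact: measurable_sigma0.
by apply/funext => p; rewrite mxE.
Qed.

(** [g] is continuous relative to its domain, so [borel_comp] applies once the seven arguments are
    known to form a Borel map, which [borel_pair] builds factor by factor. *)
Lemma measurable_driver u i : measurable_state u ->
  measurable_fun setT (fun p : X4 => driver u p.1.1.1 p.1.1.2 p.1.2 p.2 i 0).
Proof.
move=> mu.
have m1 := @measurable_coord1 R n.
have m2 := @measurable_coord2 R n.
have m3 := @measurable_coord3 R n.
have m4 : measurable_fun setT (fun p : X4 => p.2) by exact: measurable_snd.
pose phi (p : X4) : R * R * 'cV[R]_n * 'cV[R]_n * 'cV[R]_m * 'M[R]_(m, d) * 'M[R]_(m, d) :=
  (p.1.1.1, p.1.1.2, tcol p.1.2, tcol p.2, diag_mx4 u p.1.1.2 p.2,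
   (\matrix_(i, j) u p i (Some j)) *m sigma0 p.1.1.2 p.2,
   Gamma_grad u p.1.1.1 p.1.1.2 p.1.2 *m sigma0 p.1.1.2 p.2).
have b2 := pair_baseP (@real_baseP R) (@real_baseP R).
have b3 := pair_baseP b2 (@mx_baseP R n 1).
have b4 := pair_baseP b3 (@mx_baseP R n 1).
have b5 := pair_baseP b4 (@mx_baseP R m 1).
have b6 := pair_baseP b5 (@mx_baseP R m d).
have bphi : borel_fun phi.
  apply: (borel_pair b6 (@mx_baseP R m d)); last first.
    by apply: borel_mx => i' j; apply: measurable_mul_sigma0 => *; exact: measurable_Gamma_grad.
  apply: (borel_pair b5 (@mx_baseP R m d)); last first.
    apply: borel_mx => i' j; apply: measurable_mul_sigma0 => i1 i2.
    by rewrite (_ : (fun p => _) = fun p => u p i1 (Some i2))//; apply/funext => p; rewrite mxE.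
  apply: (borel_pair b4 (@mx_baseP R m 1)); last first.
    apply: borel_mx => i' j.
    rewrite (_ : (fun p => _) = fun p : X4 => u (p.1.1.2, p.1.1.2, p.2, p.2) i' None).
      exact: (measurableT_comp (mu i' None) (measurable_quad m2 m2 m4 m4)).
    by apply/funext => p; rewrite mxE.
  apply: (borel_pair b3 (@mx_baseP R n 1)); last exact: borel_tcol.
  apply: (borel_pair b2 (@mx_baseP R n 1)); last exact: borel_tcol.
  by apply: (borel_pair (@real_baseP R) (@real_baseP R)); exact: borel_real.
pose gq (q : R * R * 'cV[R]_n * 'cV[R]_n * 'cV[R]_m * 'M[R]_(m, d) * 'M[R]_(m, d)) : R :=
  (let: (t, s, xi, x, y, z, w) := q in g t s xi x y z w) i 0.
pose D := [set q : R * R * 'cV[R]_n * 'cV[R]_n * 'cV[R]_m * 'M[R]_(m, d) * 'M[R]_(m, d) |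
    let: (t, s, _, _, _, _, _) := q in (0 <= t < s) && (s <= T)].
have cg : {within D, continuous gq}.
  apply: continuous_subspaceW (@within_entry _ _ _ _ _ _ i 0 g_continuous).
  by move=> [[[[[[t s] ?] ?] ?] ?] ?] /= /andP[/andP[t0 ts] sT]; rewrite t0 (ltW ts).
have := measurable_if_within cg bphi (measurable_time_lt T m1 m2) (fun p => iff_refl _).
congr measurable_fun; apply/funext => p; rewrite /driver.
case: ifP => [/andP[/andP[t0 ts] sT]|_]; last by rewrite mxE.
rewrite /gq /phi /sigma0 (le_trans t0 (ltW ts)) sT/=.
by case: p {t0 ts sT} => [[[? ?] ?] ?].
Qed.

Definition driver_source u (t : R) (xi : E) (i : 'I_m) : R -> E -> R :=
  fun tau eta => driver u t tau xi eta i 0.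

Lemma source_driver u t xi i : measurable_state u -> source Mg (driver_source u t xi i).
Proof.
move=> mu; split.
  apply: (measurableT_comp (measurable_driver i mu) (g := fun p : mR * E => (t, p.1, xi, p.2))).
  apply: measurable_quad; [exact: measurable_cst|exact: measurable_fst|exact: measurable_cst|].
  exact: measurable_snd.
move=> tau y; apply: le_trans (mx_norm_entry _ _ _) _; rewrite /driver.
case: ifP => [/andP[/andP[t0 ts] sT]|_]; last by rewrite normr0 ltW.
by apply: g_bounded => //; rewrite t0 ltW.
Qed.

Definition Theta_potential u (t s : R) (xi : E) (i : 'I_m) (x : 'cV[R]_n) : R :=
  potential T G s x (driver_source u t xi i).

(** The derivative components are set to 0 at [t = s], where the factor [sqrt (s - t)] of their
    weight would vanish. Nothing is lost: the driver reads derivatives at [(t, tau)] with [t < tau]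
    only. *)
Definition Phi u : state := fun p i o =>
  match o with
  | None => if (0 <= p.1.1.1 <= p.1.1.2) && (p.1.1.2 <= T)
            then Theta_potential u p.1.1.1 p.1.1.2 p.1.2 i (tcol p.2) else 0
  | Some j => if (0 <= p.1.1.1 < p.1.1.2) && (p.1.1.2 <= T)
              then 'D_(unitv R j) (Theta_potential u p.1.1.1 p.1.1.2 p.1.2 i) (tcol p.2) else 0
  end.

Lemma differentiable_Theta_potential u t s xi i x : 0 <= s -> measurable_state u ->
  differentiable (Theta_potential u t s xi i) x.
Proof.
move=> s0 mu; exact: (potential_differentiable K_gt0 fund estimate _ s0 (source_driver t xi i mu)).
Qed.

Lemma measurable_Theta_potential u i : measurable_state u ->
  measurable_fun setT (fun p : X4 => Theta_potential u p.1.1.1 p.1.1.2 p.1.2 i (tcol p.2)).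
Proof.
move=> mu; rewrite /Theta_potential /potential.
have c0 : measurable_fun setT (fun q : X4 * mR => q.1) by exact: measurable_fst.
have c1 := measurableT_comp (@measurable_coord1 R n) c0.
have c2 := measurableT_comp (@measurable_coord2 R n) c0.
have c3 := measurableT_comp (@measurable_coord3 R n) c0.
have c4 : measurable_fun setT (fun q : X4 * mR => q.1.2).
  exact: (measurableT_comp measurable_snd c0).
have c5 : measurable_fun setT (fun q : X4 * mR => q.2) by exact: measurable_snd.
have f1 : measurable_fun setT (fun q : (X4 * mR) * E => q.1) by exact: measurable_fst.
apply: (measurable_Rintegral leb (h := fun q : X4 * mR => \int[lambda]_y
  (kern T G q.1.1.1.2 (tcol q.1.2) q.2 (tcol y) *
   driver_source u q.1.1.1.1 q.1.1.2 i q.2 y))).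
apply: (measurable_Rintegral lambda (h := fun q : (X4 * mR) * E =>
  (kern T G q.1.1.1.1.2 (tcol q.1.1.2) q.1.2 (tcol q.2) *
   driver_source u q.1.1.1.1.1 q.1.1.1.2 i q.1.2 q.2))).
have d1 := measurableT_comp c1 f1; have d2 := measurableT_comp c2 f1.
have d3 := measurableT_comp c3 f1; have d4 := measurableT_comp c4 f1.
have d5 := measurableT_comp c5 f1.
have d6 : measurable_fun setT (fun q : (X4 * mR) * E => q.2) by exact: measurable_snd.
apply: measurable_funM; first exact: (measurable_kern fund d2 d4 d5 d6).
exact: (measurableT_comp (measurable_driver i mu) (measurable_quad d1 d5 d3 d6)).
Qed.

Lemma measurable_Phi u : measurable_state u -> measurable_state (Phi u).
Proof.
move=> mu i [j|].
- pose f (q : mR * mR * E) (z : 'cV[R]_n) : R :=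
    if (0 <= q.1.1 < q.1.2) && (q.1.2 <= T) then Theta_potential u q.1.1 q.1.2 q.2 i z else 0.
  have mf : measurable_fun setT (fun p : (mR * mR * E) * E => f p.1 (tcol p.2)).
    apply: measurable_if0; last first.
      exact: measurable_funS (@subsetT _ _) (measurable_Theta_potential i mu).
    exact: (measurable_time_lt T (@measurable_coord1 R n) (@measurable_coord2 R n)).
  have df q z : derivable (f q) z (unitv R j).
    rewrite /f; have [/andP[/andP[t0 ts] sT]|_] := boolP ((0 <= q.1.1 < q.1.2) && (q.1.2 <= T));
      last exact: derivable_cst.
    by apply: diff_derivable; apply: differentiable_Theta_potential => //; rewrite (le_trans t0)// ltW.
  have := measurable_derive mf df; congr measurable_fun; apply/funext => p.
  by rewrite /Phi /f; case: ifP => // _; rewrite derive_cst.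
- apply: measurable_if0; last first.
    exact: measurable_funS (@subsetT _ _) (measurable_Theta_potential i mu).
  exact: (measurable_time_le T (@measurable_coord1 R n) (@measurable_coord2 R n)).
Qed.

Let B0 := Mg * (expR T * Num.sqrt T) * 4.
Let B1 := K * (Mg * expR T) * 4.

(** The bounds do not depend on the size of [u], because [g] is bounded; a measurable fixed point is
    therefore admissible. *)
Lemma Phi_bounded u p i o : measurable_state u ->
  `|Phi u p i o| <= if o is Some _ then B1 else B0.
Proof.
move=> mu; have b0 : 0 <= B0 by rewrite !mulr_ge0 ?expR_ge0 ?sqrtr_ge0 ?(ltW Mg_gt0).
have b1 : 0 <= B1 by rewrite !mulr_ge0 ?expR_ge0 ?(ltW Mg_gt0) ?(ltW K_gt0).
case: o => [j|] /=; case: ifP => [/andP[/andP[t0 ts] sT]|_]; rewrite ?normr0//; last first.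
  by apply: (potential_sup fund estimate) (source_driver _ _ _ mu); rewrite (le_trans t0).
have s0 : 0 <= p.1.1.2 by rewrite (le_trans t0)// ltW.
rewrite -[leRHS]mulr1 -(norm_unitv R j); apply: derive_lipschitz.
  move=> y z; exact: (potential_lipschitz_sup K_gt0 fund estimate y z s0 (source_driver _ _ _ mu)).
by apply: diff_derivable; exact: differentiable_Theta_potential.
Qed.

Lemma dkern_L1 t xi tau j : 0 <= t < tau -> tau <= T ->
  measurable_fun setT (fun y : E => dkern T G j t xi tau (tcol y)) /\
  (\int[lambda]_y `|dkern T G j t xi tau (tcol y)|%:E <= (K / Num.sqrt (tau - t))%:E)%E.
Proof.
move=> tt tT; have [m1 m2] := kernel_grad K_gt0 fund estimate xi j tt tT.
have E0 (y : E) : dkern T G j t xi tau (tcol y) = 'D_(unitv R j) (fun z => G t z tau (tcol y)) xi.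
  exact: dkernE.
split; first by under eq_fun do rewrite E0.
by under eq_integral do rewrite E0.
Qed.

Definition admissible u :=
  measurable_state u /\ forall p i o, `|u p i o| <= if o is Some _ then B1 else B0.

Lemma Gamma_grad_integrable u t tau xi i j : 0 <= t < tau -> tau <= T ->
  measurable_state u -> (forall p i, `|u p i None| <= B0) ->
  lambda.-integrable setT (EFin \o (fun y : E =>
    dkern T G j t xi tau (tcol y) * u (tau, tau, y, y) i None)).
Proof.
move=> tt tT mu uB; have [md dK] := dkern_L1 xi j tt tT.
apply: (integrable_bounded (L1_integrable md dK) (c := B0)) => //.
apply: (measurableT_comp (mu i None)).
by apply: measurable_quad => //; exact: measurable_cst.
Qed.

(* The time scale of the exponential weight: [Phi] is a contraction for small [a]. *)
Variable a : R.
Hypothesis a_gt0 : 0 < a.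

(** The exponential is smallest far from the terminal time, where errors have accumulated. Outside
    the time domains [Phi] vanishes, and the value 1 serves to keep the weight positive. *)
Definition weight (p : X4) (o : option 'I_n) : R :=
  match o with
  | None => if (0 <= p.1.1.1 <= p.1.1.2) && (p.1.1.2 <= T)
            then exp_weight a (T - p.1.1.2) else 1
  | Some _ => if (0 <= p.1.1.1 < p.1.1.2) && (p.1.1.2 <= T)
              then exp_weight a (T - p.1.1.2) * Num.sqrt (p.1.1.2 - p.1.1.1) else 1
  end.

Lemma exp_weight_gt0 r : 0 < exp_weight a r.
Proof. exact: expR_gt0. Qed.

Lemma weight_gt0 p o : 0 < weight p o.
Proof.
case: o => [j|] /=; case: ifP => // /andP[/andP[_ ts] _]; last exact: exp_weight_gt0.
by rewrite mulr_gt0 ?exp_weight_gt0// sqrtr_gt0 subr_gt0.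
Qed.

Definition state_dist (c : R) u u' := forall p i o, weight p o * `|u p i o - u' p i o| <= c.

(** One term for each argument of [g] that depends on the state. [Theta] has no singular weight, so
    [sqrt T] bounds the factor [sqrt (tau - t)] put in front of it; [n Ms] is the cost in maximum
    norms of multiplying by [sigma]; [Gamma_xi] adds the gradient bound [K] of the kernel. *)
Definition contraction_constant := Lg * (Num.sqrt T + n%:R * Ms + n%:R * Ms * K).

Local Notation C1 := contraction_constant.

Lemma mulmx_norm m1 m2 m3 (A : 'M[R]_(m1, m2)) (C : 'M[R]_(m2, m3)) :
  `|A *m C| <= m2%:R * `|A| * `|C|.
Proof.
apply: mx_norm_le => [|i j]; first by rewrite !mulr_ge0.
rewrite mxE (le_trans (ler_norm_sum _ _ _))//.
apply: (@le_trans _ _ (\sum_(k < m2) `|A| * `|C|)).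
  by apply: ler_sum => k _; rewrite normrM ler_pM// mx_norm_entry.
by rewrite sumr_const card_ord -mulrA mulr_natl.
Qed.

Lemma driver_lipschitz c u u' t tau xi eta : 0 <= c -> admissible u -> admissible u' ->
  state_dist c u u' -> 0 <= t < tau -> tau <= T ->
  `|driver u t tau xi eta - driver u' t tau xi eta| <=
    C1 * c / (exp_weight a (T - tau) * Num.sqrt (tau - t)).
Proof.
move=> c0 [mu uB] [mu' uB'] uu' tt tT; have [t0 tlt] := andP tt.
set e := exp_weight a (T - tau); set r := Num.sqrt (tau - t).
have e0 : 0 < e by exact: exp_weight_gt0.
have r0 : 0 < r by rewrite sqrtr_gt0 subr_gt0.
have tau0 : 0 <= tau by rewrite (le_trans t0)// ltW.
have Y y i : `|u (tau, tau, y, y) i None - u' (tau, tau, y, y) i None| <= c / e.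
  have := uu' (tau, tau, y, y) i None; rewrite /weight/= tau0 lexx tT/= -/e.
  by rewrite ler_pdivlMr// mulrC.
rewrite /driver tt tT/=.
apply: le_trans (g_lipschitz _ _ _ _ _ _ _ _ _ _) _ => //; first by rewrite t0 ltW.
have sM : `|sigma tau (tcol eta)| <= Ms by apply: sigma_bounded; rewrite tau0.
have HY : `|diag_mx4 u tau eta - diag_mx4 u' tau eta| <= c / e.
  by apply: mx_norm_le => [|i j]; rewrite ?divr_ge0 ?(ltW e0)// !mxE.
have HZ : `|\matrix_(i, j) u (t, tau, xi, eta) i (Some j) -
    \matrix_(i, j) u' (t, tau, xi, eta) i (Some j)| <= c / (e * r).
  apply: mx_norm_le => [|i j]; first by rewrite divr_ge0 ?mulr_ge0 ?(ltW e0) ?(ltW r0).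
  rewrite !mxE ler_pdivlMr ?mulr_gt0// mulrC.
  by have := uu' (t, tau, xi, eta) i (Some j); rewrite /weight/= tt tT.
(* The diagonal values have a weight without singular factor, so their difference is at most
   [c / e]; integration against the gradient of the kernel multiplies it by the L^1 norm [K / r]. *)
have HW : `|Gamma_grad u t tau xi - Gamma_grad u' t tau xi| <= K / r * (c / e).
  apply: mx_norm_le => [|i j].
    by rewrite mulr_ge0 ?divr_ge0 ?(ltW e0) ?(ltW r0) ?(ltW K_gt0).
  have iu := Gamma_grad_integrable (tcol xi) i j tt tT mu (fun p i => uB p i None).
  have iu' := Gamma_grad_integrable (tcol xi) i j tt tT mu' (fun p i => uB' p i None).
  rewrite !mxE -RintegralB//.
  have [md dK] := dkern_L1 (tcol xi) j tt tT.
  rewrite (_ : \int[lambda]_y _ = \int[lambda]_y (dkern T G j t (tcol xi) tau (tcol y) *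
     (u (tau, tau, y, y) i None - u' (tau, tau, y, y) i None))); last first.
    by apply: eq_Rintegral => y _; rewrite mulrBr.
  apply: (RintegralM_le md dK) => [|y]; last exact: Y.
  have := integrable_sub measurableT iu iu'; apply: eq_integrable => // y _.
  by rewrite /= mulrBr.
rewrite -!mulmxBl.
have H1 := le_trans (mulmx_norm _ _) (ler_pM (mulr_ge0 (ler0n _ _) (normr_ge0 _)) (normr_ge0 _)
  (ler_wpM2l (ler0n _ n) HZ) sM).
have H2 := le_trans (mulmx_norm _ _) (ler_pM (mulr_ge0 (ler0n _ _) (normr_ge0 _)) (normr_ge0 _)
  (ler_wpM2l (ler0n _ n) HW) sM).
apply: (@le_trans _ _ (Lg * (c / e + n%:R * (c / (e * r)) * Ms + n%:R * (K / r * (c / e)) * Ms))).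
  by rewrite ler_wpM2l ?(ltW Lg_gt0)// !lerD.
have rT : r <= Num.sqrt T by rewrite ler_wsqrtr// lerBlDr (le_trans tT)// lerDl.
apply: (@le_trans _ _ (Lg * (r + n%:R * Ms + n%:R * Ms * K) * c / (e * r))).
  rewrite le_eqVlt; apply/orP; left; apply/eqP; field.
  by rewrite !gt_eqF.
rewrite ler_wpM2r ?invr_ge0 ?mulr_ge0 ?(ltW e0) ?(ltW r0)// ler_wpM2r// ler_wpM2l ?(ltW Lg_gt0)//.
by rewrite !lerD2r.
Qed.

Lemma exp_weightD r r' : exp_weight a (r + r') = exp_weight a r * exp_weight a r'.
Proof. by rewrite /exp_weight mulrDl opprD expRD. Qed.

Lemma contraction_constant_ge0 : 0 <= C1.
Proof. by rewrite mulr_ge0 ?addr_ge0 ?mulr_ge0 ?sqrtr_ge0 ?(ltW Lg_gt0) ?(ltW Ms_gt0) ?(ltW K_gt0). Qed.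

Lemma Phi_contraction c u u' : C1 * (1 + K) * (4 * a) <= 2^-1 ->
  admissible u -> admissible u' -> state_dist c u u' -> state_dist (c / 2) (Phi u) (Phi u').
Proof.
move=> a_small au au' uu' p i o.
have c0 : 0 <= c.
  by apply: le_trans (uu' p i o); rewrite mulr_ge0// ltW// weight_gt0.
have K0 := ltW K_gt0; have C0 := contraction_constant_ge0.
have small1 : C1 * (4 * a) <= 2^-1.
  apply: le_trans a_small; rewrite ler_pM2r ?mulr_gt0//.
  by rewrite ler_peMr// lerDl.
have small2 : K * C1 * (4 * a) <= 2^-1.
  apply: le_trans a_small; rewrite ler_pM2r ?mulr_gt0// mulrC.
  by rewrite ler_wpM2l// lerDr.
have [mu _] := au; have [mu' _] := au'.
pose t := p.1.1.1 : R; pose s := p.1.1.2 : R.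
pose f := driver_source u t p.1.2 i; pose f' := driver_source u' t p.1.2 i.
have sf : source Mg f := source_driver t p.1.2 i mu.
have sf' : source Mg f' := source_driver t p.1.2 i mu'.
have sd : source (Mg + Mg) (fun tau y => f tau y - f' tau y).
  split; first exact: measurable_funB sf.1 sf'.1.
  by move=> tau y; rewrite (le_trans (ler_normB _ _))// lerD// (sf.2, sf'.2).
have ew0 := exp_weight_gt0.
set q := C1 * c / exp_weight a (T - s).
have q0 : 0 <= q := divr_ge0 (mulr_ge0 C0 c0) (ltW (ew0 _)).
have fD tau y : 0 <= t -> s < tau <= T -> t <= s -> `|f tau y - f' tau y| <=
    q * (exp_weight a (tau - s) / Num.sqrt (tau - t)).
  move=> t0 /andP[st tT] ts; have ttau : 0 <= t < tau by rewrite t0 (le_lt_trans ts).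
  have := driver_lipschitz p.1.2 y c0 au au' uu' ttau tT.
  move=> /(le_trans (mx_norm_entry _ i 0)); rewrite !mxE => /le_trans; apply; rewrite /q.
  have -> : exp_weight a (T - s) = exp_weight a (T - tau) * exp_weight a (tau - s).
    by rewrite -exp_weightD addrA subrK.
  have e1 := ew0 (T - tau); have e2 := ew0 (tau - s).
  have r0 : 0 < Num.sqrt (tau - t) by rewrite sqrtr_gt0 subr_gt0; case/andP: ttau.
  rewrite le_eqVlt; apply/orP; left; apply/eqP; field.
  by rewrite !gt_eqF.
case: o => [j|].
- rewrite /weight /Phi -/t -/s; have [/andP[/andP[t0 ts] sT]|_] := boolP ((0 <= t < s) && (s <= T));
    last by rewrite subrr normr0 mulr0 divr_ge0.
  have s0 : 0 <= s by rewrite (le_trans t0)// ltW.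
  have dP v : measurable_state v -> derivable (Theta_potential v t s p.1.2 i) (tcol p.2) (unitv R j).
    by move=> mv; apply: diff_derivable; exact: differentiable_Theta_potential.
  rewrite -(deriveB (dP u mu) (dP u' mu')).
  have PE : Theta_potential u t s p.1.2 i - Theta_potential u' t s p.1.2 i =
      (fun x => potential T G s x (fun tau y => f tau y - f' tau y)).
    by apply/funext => x; rewrite -(potentialB fund estimate x s0 sf sf').
  have st0 : 0 < Num.sqrt (s - t) by rewrite sqrtr_gt0 subr_gt0.
  (* As [sqrt (tau - t) >= sqrt (s - t)], the singularity of the driver becomes a constant in [tau]
     that the weight of the derivative cancels; the kernel supplies the integrable one. *)
  set cc := q / Num.sqrt (s - t).
  have cc0 : 0 <= cc := divr_ge0 q0 (ltW st0).
  have fcc tau y : s < tau <= T -> `|f tau y - f' tau y| <= cc * exp_weight a (tau - s).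
    move=> stT; apply: le_trans (fD tau y t0 stT (ltW ts)) _.
    rewrite /cc -[leRHS]mulrA ler_wpM2l//.
    rewrite mulrC ler_wpM2r ?(ltW (ew0 _))//.
    rewrite lef_pV2 ?posrE ?sqrtr_gt0 ?subr_gt0//; last first.
      by case/andP: stT => /(lt_trans ts).
    by rewrite ler_wsqrtr// lerB// ltW//; case/andP: stT.
  have dB : derivable (Theta_potential u t s p.1.2 i - Theta_potential u' t s p.1.2 i)
      (tcol p.2) (unitv R j) by apply: derivableB; exact: dP.
  rewrite PE in dB *.
  have := derive_lipschitz (fun x y => potential_lipschitz K_gt0 fund estimate x y s0 a_gt0 cc0 sd fcc) dB.
  rewrite norm_unitv mulr1 => H.
  apply: le_trans (ler_wpM2l _ H) _; first by rewrite mulr_ge0 ?(ltW (ew0 _)) ?(ltW st0).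
  rewrite /cc /q [leLHS](_ : _ = c * (K * C1 * (4 * a))); first by rewrite ler_wpM2l.
  by have e1 := ew0 (T - s); field; rewrite !gt_eqF.
- rewrite /weight /Phi -/t -/s; have [/andP[/andP[t0 ts] sT]|_] := boolP ((0 <= t <= s) && (s <= T));
    last by rewrite subrr normr0 mulr0 divr_ge0.
  have s0 : 0 <= s by rewrite (le_trans t0).
  rewrite (potentialB fund estimate _ s0 sf sf').
  (* For [Theta] itself the singularity stays in the source, and [sqrt (tau - t) >= sqrt (tau - s)]
     makes it integrable uniformly in [t]. *)
  have fcc tau y : s < tau <= T -> `|f tau y - f' tau y| <=
      q * (exp_weight a (tau - s) / Num.sqrt (tau - s)).
    move=> stT; apply: le_trans (fD tau y t0 stT ts) _.
    have tau0 : s < tau by case/andP: stT.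
    rewrite ler_wpM2l// ler_wpM2l ?(ltW (ew0 _))//.
    rewrite lef_pV2 ?posrE ?sqrtr_gt0 ?subr_gt0// ?(le_lt_trans ts)//.
    by rewrite ler_wsqrtr// lerB.
  have H := potential_bound fund estimate (tcol p.2) s0 a_gt0 q0 sd fcc.
  apply: le_trans (ler_wpM2l (ltW (ew0 _)) H) _.
  rewrite /q [leLHS](_ : _ = c * (C1 * (4 * a))); first by rewrite ler_wpM2l.
  by have e1 := ew0 (T - s); field; rewrite !gt_eqF.
Qed.

Hypothesis a_small : C1 * (1 + K) * (4 * a) <= 2^-1.

Lemma weight_le p o : weight p o <= 1 + Num.sqrt T.
Proof.
have ew1 r : 0 <= r -> exp_weight a r <= 1.
  by move=> r0; rewrite /exp_weight -expR0 ler_expR oppr_le0 divr_ge0 ?sqr_ge0.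
have T1 : 1 <= 1 + Num.sqrt T by rewrite lerDl sqrtr_ge0.
case: o => [j|]; rewrite /weight.
  have [/andP[/andP[t0 ts] sT]|_] := boolP ((0 <= p.1.1.1 < p.1.1.2) && (p.1.1.2 <= T));
    last exact: T1.
  rewrite (@le_trans _ _ (1 * Num.sqrt T))//; last by rewrite mul1r lerDr.
  rewrite ler_pM ?sqrtr_ge0 ?(ltW (exp_weight_gt0 _))// ?ew1 ?subr_ge0//.
  by rewrite ler_wsqrtr// lerBlDr (le_trans sT)// lerDl.
have [/andP[/andP[t0 ts] sT]|_] := boolP ((0 <= p.1.1.1 <= p.1.1.2) && (p.1.1.2 <= T));
  last exact: T1.
by apply: le_trans T1; rewrite ew1 ?subr_ge0.
Qed.

Lemma admissible_Phi u : admissible u -> admissible (Phi u).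
Proof. by move=> [mu _]; split; [exact: measurable_Phi|move=> p i o; exact: Phi_bounded]. Qed.

Lemma admissible0 : admissible (fun _ _ _ => 0).
Proof.
split=> [i o|p i o]; first exact: measurable_cst.
by case: o; rewrite normr0 !mulr_ge0 ?expR_ge0 ?sqrtr_ge0 ?(ltW Mg_gt0) ?(ltW K_gt0).
Qed.

Lemma admissible_cvg (u_ : nat -> state) u : (forall k, admissible (u_ k)) ->
  (forall p i o, (fun k => u_ k p i o) @ \oo --> u p i o) -> admissible u.
Proof.
move=> au uu; split=> [i o|p i o].
  by apply: (measurable_fun_cvg (h := fun k p => u_ k p i o)) => [k|p _]; [exact: (au k).1|exact: uu].
by apply: (cvgr_to_le (cvg_norm (uu p i o))); apply: nearW => k; exact: (au k).2.
Qed.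

Lemma admissible_dist u u' : admissible u -> admissible u' ->
  state_dist ((1 + Num.sqrt T) * (2 * (B0 + B1))) u u'.
Proof.
move=> [_ uB] [_ uB'] p i o.
have b0 : 0 <= B0 by rewrite !mulr_ge0 ?expR_ge0 ?sqrtr_ge0 ?(ltW Mg_gt0).
have b1 : 0 <= B1 by rewrite !mulr_ge0 ?expR_ge0 ?(ltW Mg_gt0) ?(ltW K_gt0).
rewrite ler_pM ?(ltW (weight_gt0 _ _))// ?weight_le// (le_trans (ler_normB _ _))//.
rewrite mulr_natl mulr2n lerD// (le_trans (uB _ _ _), le_trans (uB' _ _ _))//;
  by case: (o); rewrite ?lerDl ?lerDr.
Qed.

Let J := (X4 * 'I_m * option 'I_n)%type.
Let curry3 (v : J -> R) : state := fun p i o => v (p, i, o).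
Let weightJ (j : J) := weight j.1.1 j.2.
Let PhiJ (v : J -> R) : J -> R := fun j => Phi (curry3 v) j.1.1 j.1.2 j.2.

Let PhiJ_half c v v' : admissible (curry3 v) -> admissible (curry3 v') ->
  wdist weightJ c v v' -> wdist weightJ (c / 2) (PhiJ v) (PhiJ v').
Proof.
move=> av av' vv' j; apply: Phi_contraction => // p i o; exact: (vv' (p, i, o)).
Qed.

Lemma fixed_point_exists : exists2 u, admissible u & Phi u = u.
Proof.
have [] := @picard_exists R J weightJ _ (fun v => admissible (curry3 v)) PhiJ _ _ PhiJ_half
  (fun=> 0) ((1 + Num.sqrt T) * (2 * (B0 + B1))).
- by move=> j; exact: weight_gt0.
- by move=> v_ v av vv; apply: (admissible_cvg av) => p i o; exact: vv.
- by move=> v /admissible_Phi.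
- exact: admissible0.
- by move=> [[p i] o]; exact: (admissible_dist admissible0 (admissible_Phi admissible0) p i o).
move=> v av fv; exists (curry3 v) => //.
apply/funext => p; apply/funext => i; apply/funext => o.
by have /(congr1 (fun f => f (p, i, o))) := fv.
Qed.

Lemma fixed_point_unique u u' : admissible u -> admissible u' -> Phi u = u -> Phi u' = u' -> u = u'.
Proof.
move=> au au' fu fu'.
pose v (w : state) : J -> R := fun j => w j.1.1 j.1.2 j.2.
have : v u = v u'.
  apply: (@picard_unique R J weightJ _ (fun v => admissible (curry3 v)) PhiJ PhiJ_half _ _
     ((1 + Num.sqrt T) * (2 * (B0 + B1)))) => //.
  - by move=> j; exact: weight_gt0.
  - by apply/funext => -[[p i] o]; rewrite /PhiJ /= -[in RHS]fu.
  - by apply/funext => -[[p i] o]; rewrite /PhiJ /= -[in RHS]fu'.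
  - by move=> [[p i] o]; exact: admissible_dist.
move=> vv; apply/funext => p; apply/funext => i; apply/funext => o.
by have /(congr1 (fun f => f (p, i, o))) := vv.
Qed.

(** * Fixed points and mild solutions *)

Definition represents u (Theta : R -> R -> 'cV[R]_n -> 'cV[R]_n -> 'cV[R]_m) :=
  (forall (t s : R) (xi x : E) i, 0 <= t <= s -> s <= T ->
    u (t, s, xi, x) i None = Theta t s (tcol xi) (tcol x) i 0) /\
  (forall (t s : R) (xi x : E) i j, 0 <= t < s -> s <= T ->
    u (t, s, xi, x) i (Some j) = jac (Theta t s (tcol xi)) (tcol x) i j).

Lemma represents_Gamma_xi u Theta t tau (xi y : E) i j : represents u Theta ->
  0 <= t < tau -> tau <= T ->
  dkern T G j t (tcol xi) tau (tcol y) * u (tau, tau, y, y) i None =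
  Gamma_xi_integrand G Theta t tau (tcol xi) (tcol y) i j.
Proof.
move=> [u1 _] tt tT; have [t0 tlt] := andP tt.
rewrite /Gamma_xi_integrand mxE big_ord1 mxE mulrC dkernE//; congr (_ * _).
by rewrite u1// (le_trans t0 (ltW tlt)) lexx.
Qed.

Lemma represents_driver u Theta t tau (xi eta : E) : represents u Theta ->
  0 <= t < tau -> tau <= T ->
  driver u t tau xi eta =
  g t tau (tcol xi) (tcol eta) (Theta tau tau (tcol eta) (tcol eta))
    (jac (Theta t tau (tcol xi)) (tcol eta) *m sigma tau (tcol eta))
    (Gamma_xi G Theta t tau (tcol xi) *m sigma tau (tcol eta)).
Proof.
move=> ru tt tT; have [t0 tlt] := andP tt; have [u1 u2] := ru.
have E1 : diag_mx4 u tau eta = Theta tau tau (tcol eta) (tcol eta).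
  apply/matrixP => i j; rewrite (ord1 j) mxE u1//.
  by rewrite (le_trans t0 (ltW tlt)) lexx.
have E2 : \matrix_(i, j) u (t, tau, xi, eta) i (Some j) = jac (Theta t tau (tcol xi)) (tcol eta).
  by apply/matrixP => i j; rewrite mxE u2.
have E3 : Gamma_grad u t tau xi = Gamma_xi G Theta t tau (tcol xi).
  apply/matrixP => i j; rewrite !mxE; apply: eq_Rintegral => y _.
  exact: represents_Gamma_xi.
by rewrite /driver tt tT/= E1 E2 E3.
Qed.

Lemma represents_integrand u Theta t s (xi eta : E) x tau i : represents u Theta ->
  0 <= t <= s -> s < tau -> tau <= T ->
  Theta_integrand sigma g G Theta t s (tcol xi) x tau (tcol eta) i 0 =
  G s x tau (tcol eta) * driver_source u t xi i tau eta.
Proof.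
move=> ru /andP[t0 ts] st tT.
by rewrite /Theta_integrand mxE /driver_source (represents_driver _ _ ru)// t0 (le_lt_trans ts).
Qed.

Lemma represents_integral u Theta t s (xi : E) x i : represents u Theta ->
  0 <= t <= s -> \int[leb]_(tau in `]s, T])
    \int[lambda]_y Theta_integrand sigma g G Theta t s (tcol xi) x tau (tcol y) i 0 =
  Theta_potential u t s xi i x.
Proof.
move=> ru ts; have [t0 ts'] := andP ts.
rewrite /Theta_potential potentialE; last exact: le_trans ts'.
apply: eq_Rintegral => tau; rewrite inE/= in_itv/= => /andP[st tT].
by apply: eq_Rintegral => y _; rewrite (represents_integrand _ _ _ _ ru).
Qed.

(** Boundedness of [g] dominates the integrand by [Mg |G|], which is integrable on the product by
    the definition of a fundamental solution; for [s = T] the domain is empty. *)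
Lemma represents_integrable u Theta t s (xi : E) x i : measurable_state u ->
  represents u Theta -> 0 <= t <= s -> s <= T ->
  (leb \x lambda)%E.-integrable (`]s, T] `*` setT)
    (fun p => (Theta_integrand sigma g G Theta t s (tcol xi) x p.1 (tcol p.2) i 0)%:E).
Proof.
move=> mu ru ts sT; have [t0 ts'] := andP ts.
have s0 : 0 <= s by exact: le_trans ts'.
have mD : measurable (`]s, T]%classic `*` [set: E] : set (mR * E)) by exact: measurableX.
have [sltT|Ts] := ltP s T; last first.
  rewrite (_ : `]s, T] `*` setT = set0); first exact: integrable_set0.
  apply/seteqP; split => // -[r y] [/=]; rewrite in_itv/= => /andP[/lt_le_trans h /h].
  by rewrite ltNge Ts.
have [_ _ _ iG _] := fund.
have sT' : 0 <= s < T by rewrite s0.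
have {}iG := iG s x T sT' (lexx T).
have [mf fM] := source_driver t xi i mu.
have mG := measurable_int _ iG.
apply: (@le_integrable _ _ _ (leb \x lambda)%E _ _ _
  (fun p => (Mg%:E * (G s x p.1 (tcol p.2))%:E)%E)) => //.
- apply/measurable_EFinP.
  have mG' : measurable_fun (`]s, T]%classic `*` [set: E]) (fun p : mR * E => G s x p.1 (tcol p.2)).
    exact/measurable_EFinP.
  have := measurable_funM mG' (measurable_funTS mf); apply: eq_measurable_fun => -[tau y].
  rewrite inE => -[/=]; rewrite in_itv/= => /andP[st tT] _.
  by rewrite (represents_integrand _ _ _ _ ru).
- move=> [tau y] [/=]; rewrite in_itv/= => /andP[st tT] _.
  rewrite (represents_integrand _ _ _ _ ru)// lee_fin !normrM mulrC.
  by rewrite ler_wpM2r// (le_trans (fM _ _))// ler_norm.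
- exact: integrableZl.
Qed.

Definition Theta_of u (t s : R) (xi x : 'cV[R]_n) : 'cV[R]_m :=
  \col_i u (t, s, untcol xi, untcol x) i None.

Definition Gamma_of u (t s : R) (x : 'cV[R]_n) : 'cV[R]_m :=
  if s == t then Theta_of u t t x x
  else \col_i \int[lambda]_y (G s x t (tcol y) * Theta_of u t t (tcol y) (tcol y) i 0).

Lemma Theta_of_potential u t s xi x i : Phi u = u -> 0 <= t <= s -> s <= T ->
  Theta_of u t s xi x i 0 = Theta_potential u t s (untcol xi) i x.
Proof. by move=> fu ts sT; rewrite mxE -{1}fu /Phi/= ts sT untcolK. Qed.

Lemma Theta_of_differentiable u t s xi x : measurable_state u -> Phi u = u ->
  0 <= t <= s -> s <= T -> differentiable (Theta_of u t s xi) x.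
Proof.
move=> mu fu ts sT; apply: differentiable_col => i.
rewrite (_ : (fun y => _) = Theta_potential u t s (untcol xi) i).
  by apply: differentiable_Theta_potential => //; case/andP: ts => /le_trans; apply.
by apply/funext => y; exact: Theta_of_potential.
Qed.

Lemma represents_Theta_of u : measurable_state u -> Phi u = u -> represents u (Theta_of u).
Proof.
move=> mu fu; split=> [t s xi x i ts sT|t s xi x i j ts sT]; first by rewrite mxE !tcolK.
have ts' : 0 <= t <= s by case/andP: ts => -> /ltW.
rewrite jacE; last exact: Theta_of_differentiable.
rewrite (_ : (fun y => _) = Theta_potential u t s xi i).
  by rewrite -[in LHS]fu /Phi/= ts sT.
by apply/funext => y; have := Theta_of_potential (tcol xi) y i fu ts' sT; rewrite tcolK.
Qed.

Lemma diag_bounded_measurable u t i : admissible u ->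
  bounded_measurable B0 (fun y : E => u (t, t, y, y) i None).
Proof.
move=> [mu uB]; split; last by move=> y; exact: (uB _ i None).
apply: (measurableT_comp (mu i None)).
by apply: measurable_quad => //; exact: measurable_cst.
Qed.

Lemma mild_of_fixed_point u : admissible u -> Phi u = u ->
  mild_solution T sigma g G (Gamma_of u) (Theta_of u).
Proof.
move=> au fu; have [mu uB] := au; have ru := represents_Theta_of mu fu.
split.
- move=> i; set D := [set p | _]; have := @measurable_funTS _ _ _ _ D _ (mu i None).
  by apply: eq_measurable_fun => -[[[t s] xi] x] _; rewrite mxE !tcolK.
- by move=> t s xi x ts sT; exact: Theta_of_differentiable.
- move=> t tau xi tt tT i j.
  have := Gamma_grad_integrable xi i j tt tT mu (fun p i => uB p i None).
  apply: eq_integrable => // y _ /=; congr _%:E.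
  by have := represents_Gamma_xi (untcol xi) y i j ru tt tT; rewrite untcolK.
- move=> t s xi x ts sT i; split.
    by have := represents_integrable (untcol xi) x i mu ru ts sT; rewrite untcolK.
  rewrite (Theta_of_potential _ _ _ fu ts sT).
  by have := represents_integral (untcol xi) x i ru ts; rewrite untcolK => ->.
- split; first by move=> t x _; rewrite /Gamma_of eqxx.
  move=> t s x st tT i; have [s0 slt] := andP st; split.
    have := act_integrable fund x st tT (diag_bounded_measurable t i au).
    by apply: eq_integrable => // y _ /=; rewrite mxE !tcolK.
  by rewrite /Gamma_of lt_eqF// mxE.
Qed.

(** The zeros outside the time domains agree with those of [Phi], so that a mild solution gives a
    fixed point on the whole index set. *)
Definition state_of (Theta : R -> R -> 'cV[R]_n -> 'cV[R]_n -> 'cV[R]_m) : state := fun p i o =>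
  match o with
  | None => if (0 <= p.1.1.1 <= p.1.1.2) && (p.1.1.2 <= T)
            then Theta p.1.1.1 p.1.1.2 (tcol p.1.2) (tcol p.2) i 0 else 0
  | Some j => if (0 <= p.1.1.1 < p.1.1.2) && (p.1.1.2 <= T)
              then jac (Theta p.1.1.1 p.1.1.2 (tcol p.1.2)) (tcol p.2) i j else 0
  end.

Lemma represents_state_of Theta : represents (state_of Theta) Theta.
Proof. by split=> [t s xi x i ts sT|t s xi x i j ts sT]; rewrite /state_of/= ts sT. Qed.

Lemma state_of_measurable Gamma Theta : mild_solution T sigma g G Gamma Theta ->
  measurable_state (state_of Theta).
Proof.
move=> [mTheta dTheta _ _ _].
have q1 := @measurable_coord1 R n; have q2 := @measurable_coord2 R n.
have mle i : measurable_fun [set p : X4 | (0 <= p.1.1.1 <= p.1.1.2) && (p.1.1.2 <= T)]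
    (fun p : X4 => Theta p.1.1.1 p.1.1.2 (tcol p.1.2) (tcol p.2) i 0).
  have := mTheta i; congr measurable_fun.
  by apply/seteqP; split => p /= => [[-> ->]|/andP[]].
move=> i [j|]; last by apply: measurable_if0 => //; exact: measurable_time_le.
pose f (q : mR * mR * E) (z : 'cV[R]_n) : R :=
  if (0 <= q.1.1 < q.1.2) && (q.1.2 <= T) then Theta q.1.1 q.1.2 (tcol q.2) z i 0 else 0.
have mf : measurable_fun setT (fun p : (mR * mR * E) * E => f p.1 (tcol p.2)).
  apply: measurable_if0; first exact: measurable_time_lt.
  apply: measurable_funS (mle i); first exact: measurable_time_le.
  by move=> p /= /andP[/andP[-> /ltW ->] ->].
have dj (q : mR * mR * E) z : (0 <= q.1.1 < q.1.2) && (q.1.2 <= T) ->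
    differentiable (Theta q.1.1 q.1.2 (tcol q.2)) z.
  by move=> /andP[/andP[t0 ts] sT]; apply: dTheta => //; rewrite t0 ltW.
have df q z : derivable (f q) z (unitv R j).
  rewrite /f; have [act|_] := boolP ((0 <= q.1.1 < q.1.2) && (q.1.2 <= T));
    last exact: derivable_cst.
  by apply: (derivable_mxP _ _ _).1; apply: diff_derivable; exact: dj.
have := measurable_derive mf df; congr measurable_fun; apply/funext => p.
rewrite /state_of /f; case: ifP => [act|_]; last by rewrite derive_cst.
by rewrite jacE//; exact: dj.
Qed.

(** The integral equation identifies [Theta t s xi] with a potential as functions of the last
    variable, so their partial derivatives agree and the components [Some j] need no equation of
    their own. *)
Lemma fixed_point_of_mild Gamma Theta : mild_solution T sigma g G Gamma Theta ->
  Phi (state_of Theta) = state_of Theta.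
Proof.
move=> mild; have [_ dTheta _ TE _] := mild.
have ru := represents_state_of Theta.
have E0 (t s : R) (xi : E) x i : 0 <= t <= s -> s <= T ->
    Theta_potential (state_of Theta) t s xi i x = Theta t s (tcol xi) x i 0.
  by move=> ts sT; rewrite -(represents_integral xi x i ru ts) -(TE t s (tcol xi) x ts sT i).2.
apply/funext => p; apply/funext => i; apply/funext => -[j|].
- rewrite /Phi /state_of -/(state_of Theta).
  have [act|//] := boolP ((0 <= p.1.1.1 < p.1.1.2) && (p.1.1.2 <= T)).
  have /andP[/andP[t0 ts] sT] := act.
  have ts' : 0 <= p.1.1.1 <= p.1.1.2 by rewrite t0 ltW.
  rewrite jacE; last exact: dTheta.
  apply: (f_equal (fun h => 'D_(unitv R j) h (tcol p.2))); apply/funext => y.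
  exact: (E0 _ _ _ _ _ ts' sT).
- rewrite /Phi /state_of -/(state_of Theta).
  have [/andP[ts sT]|//] := boolP ((0 <= p.1.1.1 <= p.1.1.2) && (p.1.1.2 <= T)).
  exact: E0.
Qed.

Lemma operator_unique_mild_solution : unique_mild_solution T sigma g G.
Proof.
have [u au fu] := fixed_point_exists; exists (Gamma_of u), (Theta_of u).
split; first exact: mild_of_fixed_point.
move=> Gamma' Theta' mild; have fv := fixed_point_of_mild mild.
have mv := state_of_measurable mild.
have av : admissible (state_of Theta') by split => // p i o; rewrite -fv; exact: Phi_bounded.
have uv := fixed_point_unique au av fu fv.
have TE (t s : R) xi x : 0 <= t <= s -> s <= T -> Theta_of u t s xi x = Theta' t s xi x.
  move=> ts sT; apply/matrixP => i j; rewrite (ord1 j) mxE uv.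
  by rewrite (represents_state_of Theta').1// !untcolK.
have [_ _ _ _ [GE0 GE]] := mild.
split=> //; move=> t s x /andP[s0]; rewrite le_eqVlt => /orP[/eqP <-|slt] tT.
  by rewrite GE0 ?s0// /Gamma_of eqxx TE// s0 lexx.
have st : 0 <= s < t by rewrite s0.
apply/matrixP => i j; rewrite (ord1 j) (GE t s x st tT i).2 /Gamma_of lt_eqF// mxE.
by apply: eq_Rintegral => y _; rewrite TE// lexx (le_trans s0 (ltW slt)).
Qed.

End operator.

(** * Lipschitz constants of the data, and conclusion *)

Section injections.
Context (R : realType) (n m d : nat).

(** The inclusions of single factors are the maps [iota] of [Cb_lipschitz]. They leave the times
    unchanged, so a segment in their directions stays in the domain. *)
Definition inj_x (x : 'cV[R]_n) : R * 'cV[R]_n := (0, x).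

Lemma inj_x_is_linear : linear inj_x.
Proof. by move=> a u v; congr pair; rewrite /= scaler0 addr0. Qed.

HB.instance Definition _ :=
  GRing.isLinear.Build R 'cV[R]_n (R * 'cV[R]_n)%type _ inj_x inj_x_is_linear.

Local Notation V7 := (R * R * 'cV[R]_n * 'cV[R]_n * 'cV[R]_m * 'M[R]_(m, d) * 'M[R]_(m, d))%type.

Definition inj_y (y : 'cV[R]_m) : V7 := (0, y, 0, 0).
Definition inj_z (z : 'M[R]_(m, d)) : V7 := (0, z, 0).
Definition inj_w (w : 'M[R]_(m, d)) : V7 := (0, w).

Lemma inj_y_is_linear : linear inj_y.
Proof. by move=> a u v; do ![congr pair]; rewrite /= scaler0 addr0. Qed.

Lemma inj_z_is_linear : linear inj_z.
Proof. by move=> a u v; do ![congr pair]; rewrite /= scaler0 addr0. Qed.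

Lemma inj_w_is_linear : linear inj_w.
Proof. by move=> a u v; do ![congr pair]; rewrite /= scaler0 addr0. Qed.

HB.instance Definition _ := GRing.isLinear.Build R 'cV[R]_m V7 _ inj_y inj_y_is_linear.
HB.instance Definition _ := GRing.isLinear.Build R 'M[R]_(m, d) V7 _ inj_z inj_z_is_linear.
HB.instance Definition _ := GRing.isLinear.Build R 'M[R]_(m, d) V7 _ inj_w inj_w_is_linear.

End injections.

Lemma Cb_strip_lipschitz (R : realType) (T : R) (n p q : nat)
    (f : R -> 'cV[R]_n -> 'M[R]_(p, q)) :
  Cb 1 [set p : R * 'cV[R]_n | 0 <= p.1 <= T] (fun p => f p.1 p.2) ->
  exists2 C : R, 0 < C & forall s x y, 0 <= s <= T -> `|f s x - f s y| <= C * `|x - y|.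
Proof.
move=> cf; have [C C0 H] := Cb_lipschitz (@inj_x R n) cf; exists C => // s x y sT.
have := H (s, y) (x - y); rewrite /inj_x /= addr0 (addrC y) subrK; apply => t _.
by rewrite scaler0 addr0.
Qed.

Lemma Cb_driver_lipschitz (R : realType) (T : R) (n m d : nat)
    (g : R -> R -> 'cV[R]_n -> 'cV[R]_n ->
         'cV[R]_m -> 'M[R]_(m, d) -> 'M[R]_(m, d) -> 'cV[R]_m) :
  Cb 1
    [set q : R * R * 'cV[R]_n * 'cV[R]_n * 'cV[R]_m * 'M[R]_(m, d) * 'M[R]_(m, d) |
      let: (t, s, _, _, _, _, _) := q in 0 <= t <= s /\ s <= T]
    (fun q => let: (t, s, xi, x, y, z, w) := q in g t s xi x y z w) ->
  exists2 L : R, 0 < L & forall t s xi x y z w y' z' w', 0 <= t <= s -> s <= T ->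
    `|g t s xi x y z w - g t s xi x y' z' w'| <= L * (`|y - y'| + `|z - z'| + `|w - w'|).
Proof.
move=> cg.
have H7 := fun a b iota => @Cb_lipschitz R _ a b m 1 _ _ iota cg.
have [Cy Cy0 Hy] := H7 _ _ (@inj_y R n m d).
have [Cz Cz0 Hz] := H7 _ _ (@inj_z R n m d).
have [Cw Cw0 Hw] := H7 _ _ (@inj_w R n m d).
exists (Cy + Cz + Cw) => [|t s xi x y z w y' z' w' ts sT]; first by rewrite !addr_gt0.
have Ly : `|g t s xi x y z w - g t s xi x y' z w| <= Cy * `|y - y'|.
  have := Hy (t, s, xi, x, y', z, w) (y - y'); rewrite /inj_y /= !addr0 (addrC y') subrK; apply => r _.
  by rewrite !scaler0 !addr0.
have Lz : `|g t s xi x y' z w - g t s xi x y' z' w| <= Cz * `|z - z'|.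
  have := Hz (t, s, xi, x, y', z', w) (z - z'); rewrite /inj_z /= !addr0 (addrC z') subrK; apply => r _.
  by rewrite !scaler0 !addr0.
have Lw : `|g t s xi x y' z' w - g t s xi x y' z' w'| <= Cw * `|w - w'|.
  have := Hw (t, s, xi, x, y', z', w') (w - w'); rewrite /inj_w /= !addr0 (addrC w') subrK; apply => r _.
  by rewrite !scaler0 !addr0.
have -> : g t s xi x y z w - g t s xi x y' z' w' =
    (g t s xi x y z w - g t s xi x y' z w) + (g t s xi x y' z w - g t s xi x y' z' w) +
    (g t s xi x y' z' w - g t s xi x y' z' w') by rewrite !addrA !subrK.
apply: le_trans (ler_normD _ _) _; apply: le_trans (lerD (ler_normD _ _) (lexx _)) _.
apply: le_trans (lerD (lerD Ly Lz) Lw) _.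
have C0 : 0 <= Cy + Cz + Cw by rewrite !addr_ge0// ltW.
rewrite !mulrDr !lerD// ler_wpM2r//.
- by rewrite -addrA lerDl addr_ge0 // ltW.
- by rewrite -addrA addrCA lerDl addr_ge0 // ltW.
- by rewrite lerDr addr_ge0 // ltW.
Qed.

Lemma sqnorm_cols (R : realType) (n d : nat) (A : 'M[R]_(n, d)) (c : R) : `|A| <= c ->
  \sum_k sqnorm (col k A) <= d%:R * n%:R * c ^+ 2.
Proof.
move=> Ac; apply: (@le_trans _ _ (\sum_(k < d) n%:R * c ^+ 2)).
  apply: ler_sum => k _; apply: (@le_trans _ _ (\sum_(i < n) c ^+ 2)).
    apply: ler_sum => i _; rewrite mxE -real_normK ?num_real//.
    by rewrite lerXn2r ?nnegrE ?(le_trans _ Ac) ?mx_norm_entry// (le_trans (mx_norm_entry _ _ _) Ac).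
  by rewrite sumr_const card_ord mulr_natl.
by rewrite sumr_const card_ord -[leLHS]mulr_natl mulrA.
Qed.

Theorem theorem5p4 (R : realType) (T : R) (n m d : nat)
  (T_gt0 : 0 < T) (n_ge1 : (1 <= n)%N) (m_ge1 : (1 <= m)%N) (d_ge1 : (1 <= d)%N) :
  exists k : nat, (1 <= k)%N /\
  forall (b : R -> 'cV[R]_n -> 'cV[R]_n)
         (sigma : R -> 'cV[R]_n -> 'M[R]_(n, d))
         (g : R -> R -> 'cV[R]_n -> 'cV[R]_n ->
              'cV[R]_m -> 'M[R]_(m, d) -> 'M[R]_(m, d) -> 'cV[R]_m),
  Cb k [set p : R * 'cV[R]_n | 0 <= p.1 <= T] (fun p => b p.1 p.2) ->
  Cb k [set p : R * 'cV[R]_n | 0 <= p.1 <= T] (fun p => sigma p.1 p.2) ->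
  Cb k
    [set q : R * R * 'cV[R]_n * 'cV[R]_n * 'cV[R]_m * 'M[R]_(m, d) * 'M[R]_(m, d) |
      let: (t, s, _, _, _, _, _) := q in 0 <= t <= s /\ s <= T]
    (fun q => let: (t, s, xi, x, y, z, w) := q in g t s xi x y z w) ->
  (exists sbar : R, 0 < sbar /\
     forall (s : R) (x xi : 'cV[R]_n), 0 <= s <= T ->
       sbar * sqnorm xi <= sqnorm ((sigma s x)^T *m xi)) ->
  forall G : R -> 'cV[R]_n -> R -> 'cV[R]_n -> R,
  fundamental_solution b sigma T G ->
  unique_mild_solution T sigma g G.
Proof.
exists 1%N; split=> // b sigma g cb cs cg [sbar [sbar0 elliptic]] G fund.
have [Mb Mb0 bM] := Cb_bounded cb; have [Ms Ms0 sM] := Cb_bounded cs.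
have [Mg Mg0 gM] := Cb_bounded cg.
have [Lb Lb0 bL] := Cb_strip_lipschitz cb; have [Ls Ls0 sL] := Cb_strip_lipschitz cs.
have [Lg Lg0 gL] := Cb_driver_lipschitz cg.
have n0 : 0 <= n%:R :> R by []; have dn0 : 0 <= d%:R * n%:R :> R by rewrite mulr_ge0.
(* Common constants for [b] and [sigma]; the factors [n] and [d n] pass from maximum norms to sums
   of squares. The gradient estimate is stated with [L ^+ 2], and the summand 1 ensures
   [L <= L ^+ 2]. *)
pose B := n%:R * Mb ^+ 2 + d%:R * n%:R * Ms ^+ 2 + 1.
pose L := n%:R * Lb ^+ 2 + d%:R * n%:R * Ls ^+ 2 + 1.
have p1 : 0 <= n%:R * Mb ^+ 2 by rewrite mulr_ge0 ?sqr_ge0.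
have p2 : 0 <= d%:R * n%:R * Ms ^+ 2 by rewrite mulr_ge0 ?sqr_ge0.
have p3 : 0 <= n%:R * Lb ^+ 2 by rewrite mulr_ge0 ?sqr_ge0.
have p4 : 0 <= d%:R * n%:R * Ls ^+ 2 by rewrite mulr_ge0 ?sqr_ge0.
have B0 : 0 < B by rewrite ltr_wpDl// addr_ge0.
have L0 : 0 < L by rewrite ltr_wpDl// addr_ge0.
have L1 : L <= L ^+ 2 by rewrite expr2 ler_peMl ?(ltW L0)// lerDr addr_ge0.
have bB s x : 0 <= s <= T -> sqnorm (b s x) <= B.
  move=> sT; apply: le_trans (sqnorm_le_norm _) _; rewrite /B -addrA.
  apply: (@le_trans _ _ (n%:R * Mb ^+ 2)); last by rewrite lerDl addr_ge0.
  by rewrite ler_wpM2l// lerXn2r ?nnegrE// ?(ltW Mb0)//; exact: (bM (s, x)).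
have bLip s x y : 0 <= s <= T -> sqnorm (b s x - b s y) <= L ^+ 2 * sqnorm (x - y).
  move=> sT; apply: le_trans (sqnorm_le_norm _) _.
  apply: (@le_trans _ _ (n%:R * (Lb * `|x - y|) ^+ 2)).
    by rewrite ler_wpM2l// lerXn2r ?nnegrE ?mulr_ge0 ?(ltW Lb0)// bL.
  rewrite exprMn mulrA ler_pM ?sqr_ge0 ?norm_le_sqnorm// (le_trans _ L1)// /L -addrA.
  by rewrite lerDl addr_ge0.
have sB s x : 0 <= s <= T -> \sum_k sqnorm (col k (sigma s x)) <= B.
  move=> sT; apply: le_trans (sqnorm_cols (sM (s, x) sT)) _.
  by rewrite /B addrAC lerDr addr_ge0.
have sLip s x y : 0 <= s <= T ->
    \sum_k sqnorm (col k (sigma s x - sigma s y)) <= L ^+ 2 * sqnorm (x - y).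
  move=> sT; apply: le_trans (sqnorm_cols (sL s x y sT)) _.
  rewrite exprMn mulrA ler_pM ?sqr_ge0 ?norm_le_sqnorm// (le_trans _ L1)// /L addrAC.
  by rewrite lerDr addr_ge0.
have [K K0 HK] := lipschitz_estimate B0 L0 sbar0 bB bLip sB sLip elliptic T_gt0.
have estimate : gradient_estimate b sigma T K.
  move=> tau h v M tauT sv hM; split; first by move=> s x; exact: (max_principle B0 bB sB tauT sv hM).
  exact: (HK tau h v M tauT sv hM).
pose C := contraction_constant n T K Lg Ms * (1 + K).
have C0 : 0 <= C.
  by apply: mulr_ge0; [exact: contraction_constant_ge0|rewrite addr_ge0// ltW].
have C8 : 0 < 8 * (C + 1) by rewrite mulr_gt0// ltr_wpDl.
have sM' s x : 0 <= s <= T -> `|sigma s x| <= Ms by exact: (sM (s, x)).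
have gM' t s xi x y z w : 0 <= t <= s -> s <= T -> `|g t s xi x y z w| <= Mg.
  by move=> ts sT; exact: (gM (t, s, xi, x, y, z, w)).
(* With [a = 1 / (8 (C + 1))] the product is [C / (2 (C + 1))], below one half. *)
have a_small : C * (4 * (8 * (C + 1))^-1) <= 2^-1.
  have C1 : 0 < C + 1 by rewrite ltr_wpDl.
  rewrite (_ : C * _ = 2^-1 * (C / (C + 1))); last by field; rewrite gt_eqF.
  by rewrite ler_piMr// ler_pdivrMr// mul1r lerDl.
have a0 : 0 < (8 * (C + 1))^-1 by rewrite invr_gt0.

exact: (@operator_unique_mild_solution R n m d b sigma T K G g K0 fund estimate Mg Lg Ms
  Mg0 Lg0 Ms0 (Cb_continuous cs) sM' (Cb_continuous cg) gM' gL _ a0 a_small).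
Qed.
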